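(* There are absolute constants $0<c\le C<\infty$ such that for every sequence $(\lambda_n)_{n>_{\mathrm{last}}0}$ of nonnegative real numbers, the norm $M(\lambda)\in[0,\infty]$ of $\lambda$ as a Fourier multiplier from $H^1_{\mathrm{last}}(\mathbb{T}^{\mathbb{N}})$ to $\ell^1$ satisfies $c\,Q(\lambda)\le M(\lambda)\le C\,Q(\lambda)$, where $$Q(\lambda)=\sup_{k\ge 1}\left\|\left(\sum_{n_{<k}\in\mathbb{Z}^{k-1}}\lambda_{n_{<k},n_k}\right)_{n_k\in\mathbb{Z}_+}\right\|_{F}+\sup_{k\ge 0}\left(\sum_{n_{>k}\in\mathbb{Z}^{[k+1,\infty)}\setminus\{0\}}\left(\sum_{n_{\le k}\in\mathbb{Z}^k}\lambda_{n_{\le k},n_{>k}}\right)^2\right)^{1/2}.$$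
   Context: $\mathbb{T}=\mathbb{R}/\mathbb{Z}$ with normalized Haar measure, $\mathbb{N}=\mathbb{Z}_+=\{1,2,3,\dots\}$, and $\mathbb{T}^{\mathbb{N}}$ carries the product probability measure. Its dual group is $\mathbb{Z}^{\oplus\mathbb{N}}$, the finitely supported integer sequences, with characters $x\mapsto e^{2\pi i\langle n,x\rangle}$, and $\widehat f(n)=\int_{\mathbb{T}^{\mathbb{N}}} f(x)e^{-2\pi i\langle n,x\rangle}\,dx$. For $n\in\mathbb{Z}^{\oplus\mathbb{N}}\setminus\{0\}$, write $n>_{\mathrm{last}}0$ if $n_j>0$ for $j=\max\operatorname{supp} n$. The space of Hardy martingales $H^1_{\mathrm{last}}(\mathbb{T}^{\mathbb{N}})$ is the closed linear span in $L^1(\mathbb{T}^{\mathbb{N}})$ of the characters $e^{2\pi i\langle n,x\rangle}$ with $n>_{\mathrm{last}}0$ (that is, $n=(n_1,\dots,n_k,0,\dots)$ with $n_k>0$ for some $k\ge1$), equipped with the $L^1(\mathbb{T}^{\mathbb{N}})$ norm. The norm $M(\lambda)$ of $\lambda$ as an $H^1_{\mathrm{last}}(\mathbb{T}^{\mathbb{N}})\to\ell^1$ multiplier is the least $M\in[0,\infty]$ such that $\sum_{n>_{\mathrm{last}}0}\lambda_n|\widehat f(n)|\le M\|f\|_{L^1(\mathbb{T}^{\mathbb{N}})}$ for all $f\in H^1_{\mathrm{last}}(\mathbb{T}^{\mathbb{N}})$. For a sequence $\mu=(\mu_j)_{j\in\mathbb{Z}_+}$ with values in $[0,\infty]$, $$\|\mu\|_F=\sup_{a\ge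 1}\left(\sum_{k=1}^\infty\left(\sum_{j=ak}^{a(k+1)-1}\mu_j\right)^2\right)^{1/2},$$ the supremum being over positive integers $a$. Notation: $(n_{<k},n_k)$ denotes the element $(n_1,\dots,n_{k-1},n_k,0,0,\dots)$ of $\mathbb{Z}^{\oplus\mathbb{N}}$ with $n_{<k}=(n_1,\dots,n_{k-1})$. $\mathbb{Z}^{[k+1,\infty)}$ denotes the finitely supported integer sequences indexed by $\{k+1,k+2,\dots\}$, and $(n_{\le k},n_{>k})$ is the concatenation of $n_{\le k}\in\mathbb{Z}^k$ and $n_{>k}\in\mathbb{Z}^{[k+1,\infty)}$. $\mathbb{Z}^0$ is a one-point set. By convention $\lambda_n=0$ when $n>_{\mathrm{last}}0$ fails. *)

(* Defs.v *)
From HB Require Import structures.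
From mathcomp Require Import all_boot all_order all_algebra finmap.
From mathcomp Require Import all_classical all_reals all_analysis.
From mathcomp Require Import measurable_realfun complex lra ring.
Set Implicit Arguments.
Unset Strict Implicit.
Unset Printing Implicit Defensive.
Import Order.TTheory GRing.Theory Num.Theory.
Import numFieldNormedType.Exports.
Local Open Scope classical_set_scope.
Local Open Scope ring_scope.

(* Coordinates are numbered from 0: the coordinate written [j] in mathematical
   texts indexing T^N by {1, 2, ...} is the coordinate [j.-1] here. *)

Definition cylinders (R : realType) : set (set (nat -> R)) :=
  [set A | exists j : nat, exists2 B : set R,
     measurable B & A = (fun x : nat -> R => x j) @^-1` B].

(* A point of T^N = (R/Z)^N is given by a sequence of real representatives; the
   Haar measure [haarTN] is carried by the fundamental domain [0, 1]^N, and the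
   functions on T^N are the Z^N-periodic ones (see [periodicTN]). *)
Definition TN (R : realType) := g_sigma_algebraType (@cylinders R).

(* Existence of a countable product of uniform laws.  If [u x] has the binary
   digits of even rank of [x] and [v x] those of odd rank, then under the uniform
   law [u] and [v] are independent and uniform, so the [u (iter k v x)], for
   [k : nat], are independent and uniform. *)
Section haar_existence.
Variable R : realType.
Local Notation U := (uniform_prob (@ltr01 R)).

Let rays_unique (m1 m2 : {measure set (measurableTypeR R) -> \bar R}) :
  (m1 setT < +oo)%E -> (forall s, m1 `]s, +oo[%classic = m2 `]s, +oo[%classic) ->
  forall A, measurable A -> m1 A = m2 A.
Proof.
move=> m1oo m12 A mA.
apply: (@measure_unique _ R (measurableTypeR R) (@measurable_realfun.RGenOInfty.G R)
  (fun n => `]- n%:R, +oo[%classic) _ _ _ _ m1 m2 _ _ A mA) => //.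
- exact: measurable_realfun.RGenOInfty.measurableE.
- move=> _ _ [x ->] [y ->]; exists (Num.max x y).
  apply/seteqP; split => z /=; rewrite !in_itv/= !andbT ?gt_max.
    by case=> -> ->.
  by move=> /andP[].
- by move=> n; eexists.
- apply/seteqP; split => // x _; exists (Num.truncn `|x|).+1 => //=.
  rewrite in_itv/= andbT ltrNl.
  by apply: (le_lt_trans (ler_norm _)); rewrite normrN truncnS_gt.
- by move=> _ [x ->].
- move=> k; apply: le_lt_trans m1oo; apply: le_measure => //; rewrite inE//.
Qed.

Let UE A : measurable A -> U A = lebesgue_measure (A `&` `[0, 1]%classic).
Proof.
move=> mA; rewrite /uniform_prob integral_uniform_pdf.
rewrite (eq_integral (fun=> 1%E)).
  by rewrite integral_cst ?mul1e//; exact: measurableI.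
move=> x; rewrite inE/= in_itv/= /uniform_pdf => -[_ ->].
by rewrite subr0 invr1.
Qed.

Let surv (s : R) : R := if s < 0 then 1 else if s < 1 then 1 - s else 0.

Let U_ray s : U `]s, +oo[%classic = (surv s)%:E.
Proof.
rewrite UE ?/surv; last exact: measurable_itv.
case: ltP => s0.
  rewrite setIidr ?lebesgue_measure_itv/= ?lte01 ?sube0//.
  by move=> x /=; rewrite !in_itv/= andbT => /andP[x0 _]; exact: lt_le_trans x0.
case: ltP => s1.
  rewrite (_ : _ `&` _ = `]s, 1]%classic).
    by rewrite lebesgue_measure_itv/= lte_fin s1.
  apply/seteqP; split => x /=; rewrite !in_itv/= andbT.
    by move=> [-> /andP[_ ->]].
  by move=> /andP[sx x1]; rewrite sx x1 andbT; split => //; lra.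
rewrite (_ : _ `&` _ = set0) ?measure0//.
by apply/seteqP; split => x //=; rewrite !in_itv/= andbT => -[sx /andP[_ x1]]; lra.
Qed.

(* The leading binary digit of [x] in [0, 1[ and the shifted expansion. *)
Let dig (x : R) : R := if x < 2^-1 then 0 else 1.
Let shift (x : R) : R := 2 * x - dig x.

Let mdig : measurable_fun setT dig.
Proof. by apply: measurable_fun_if => //; exact: measurable_fun_ltr. Qed.

Let mshift : measurable_fun setT shift.
Proof. by apply: measurable_funB => //; exact: measurable_funM. Qed.

Let mhalf : measurable [set x : R | x < 2^-1].
Proof.
rewrite (_ : [set _ | _] = `]-oo, 2^-1[%classic); first exact: measurable_itv.
by apply/seteqP; split => x /=; rewrite in_itv.
Qed.

Let half_ge0 : 0 <= 2^-1 :> R.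
Proof. by rewrite invr_ge0. Qed.

Let half_nng : {nonneg R} := NngNum half_ge0.

Let law_unique (E : set R) (f : R -> R) (r : {nonneg R}) :
  measurable E -> measurable_fun setT f ->
  (forall s, U (f @^-1` `]s, +oo[%classic `&` E) = (r%:num%:E * (surv s)%:E)%E) ->
  forall A, measurable A -> U (f @^-1` A `&` E) = (r%:num%:E * U A)%E.
Proof.
move=> mE mf H.
pose m1 : {measure set (measurableTypeR R) -> \bar R} :=
  @measure_function_pushforward__canonical__measure_function_Measure
    _ _ (measurableTypeR R) (measurableTypeR R) _ (mrestr U mE) f mf.
pose m2 : {measure set (measurableTypeR R) -> \bar R} := mscale r U.
apply: (@rays_unique m1 m2).
  rewrite /m1/= /pushforward /mrestr preimage_setT setTI.
  by rewrite (le_lt_trans (probability_le1 _ _)) ?ltry.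
move=> s; rewrite /m1 /m2 /= /pushforward /mrestr /mscale/=.
by rewrite H U_ray.
Qed.


Let U_shift0 A : measurable A ->
  U (shift @^-1` A `&` [set x | x < 2^-1]) = (2^-1%:E * U A)%E.
Proof.
apply: (law_unique (r := half_nng)) => // s.
have mE : measurable (shift @^-1` `]s, +oo[%classic `&` [set x | x < 2^-1]).
  by apply: measurableI => //; rewrite -[X in measurable X]setTI; exact: mshift.
have h : (shift @^-1` `]s, +oo[%classic `&` [set x | x < 2^-1]) `&` `[0, 1]%classic =
    [set x | [/\ s < 2 * x, 0 <= x & x < 2^-1]].
  apply/seteqP; split => x /=; rewrite !in_itv/= !andbT /shift /dig.
    by move=> [[+ xh] /andP[-> _]]; rewrite xh subr0 => ->.
  move=> [sx x0 xh]; rewrite xh subr0 sx x0; split => //=.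
  by apply/ltW/(lt_trans xh); rewrite invf_lt1 ?ltr1n.
rewrite UE// {}h -EFinM /surv.
case: ltP => s0.
  rewrite (_ : [set x | _] = `[0, 2^-1[%classic).
    by rewrite lebesgue_measure_itv/= lte_fin invr_gt0 ltr0n sube0 mulr1.
  apply/seteqP; split => x /=; rewrite in_itv/=; first by move=> [_ -> ->].
  by move=> /andP[x0 ->]; split => //; lra.
case: ltP => s1.
  rewrite (_ : [set x | _] = `]2^-1 * s, 2^-1[%classic).
    rewrite lebesgue_measure_itv/= lte_fin ifT; last by lra.
    by rewrite -EFinB; congr EFin; lra.
  apply/seteqP; split => x /=; rewrite in_itv/=.
    by move=> [? ? ?]; apply/andP; split; lra.
  by move=> /andP[? ?]; split; lra.
rewrite (_ : [set x | _] = set0) ?measure0 ?mulr0//.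
by apply/seteqP; split => x //= [? ? ?]; lra.
Qed.

Let U_shift1 A : measurable A ->
  U (shift @^-1` A `&` ~` [set x | x < 2^-1]) = (2^-1%:E * U A)%E.
Proof.
apply: (law_unique (r := half_nng)) => //; first exact: measurableC.
move=> s.
have mE : measurable (shift @^-1` `]s, +oo[%classic `&` ~` [set x | x < 2^-1]).
  apply: measurableI; last exact: measurableC.
  by rewrite -[X in measurable X]setTI; exact: mshift.
have h : (shift @^-1` `]s, +oo[%classic `&` ~` [set x | x < 2^-1]) `&` `[0, 1]%classic =
    [set x | [/\ s < 2 * x - 1, 2^-1 <= x & x <= 1]].
  apply/seteqP; split => x /=; rewrite !in_itv/= !andbT /shift /dig.
    move=> [[+ /negP]]; rewrite -leNgt => + xh /andP[_ ->].
    by rewrite (ltNge x) xh.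
  move=> [sx xh x1]; rewrite (ltNge x) xh sx x1 andbT; split => //=.
  by apply: le_trans xh; rewrite invr_ge0.
rewrite UE// {}h -EFinM /surv.
case: ltP => s0.
  rewrite (_ : [set x | _] = `[2^-1, 1]%classic).
    rewrite lebesgue_measure_itv/= lte_fin invf_lt1 ?ltr1n// mulr1.
    by rewrite -EFinB; congr EFin; lra.
  apply/seteqP; split => x /=; rewrite in_itv/=; first by move=> [_ -> ->].
  by move=> /andP[x0 ->]; split => //; lra.
case: ltP => s1.
  rewrite (_ : [set x | _] = `]2^-1 * (s + 1), 1]%classic).
    rewrite lebesgue_measure_itv/= lte_fin ifT; last by lra.
    by rewrite -EFinB; congr EFin; lra.
  apply/seteqP; split => x /=; rewrite in_itv/=.
    by move=> [? ? ?]; apply/andP; split; lra.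
  by move=> /andP[? ?]; split; lra.
rewrite (_ : [set x | _] = set0) ?measure0 ?mulr0//.
by apply/seteqP; split => x //= [? ? ?]; lra.
Qed.

(* [evens n x] is the [n]-th truncation of the number whose binary digits are
   the digits of even rank of [x]. *)
Fixpoint evens (n : nat) (x : R) : R :=
  if n is n'.+1 then 2^-1 * (dig x + evens n' (shift (shift x))) else 0.

Let evens01 n x : 0 <= evens n x <= 1.
Proof.
elim: n x => [|n IH] x /=; first by rewrite lexx ler01.
have := IH (shift (shift x)); rewrite /dig; case: ifP => _ /andP[? ?];
by apply/andP; split; lra.
Qed.

Let evens_nd x : nondecreasing_seq (evens ^~ x).
Proof.
apply/nondecreasing_seqP => n; elim: n x => [|n IH] x.
  by have /andP[] := evens01 1 x.
have := IH (shift (shift x)); rewrite [evens n.+2 x]/= [evens n.+1 x]/=.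
by move=> ?; rewrite ler_pM2l ?invr_gt0// lerD2l.
Qed.

Let evens_cvg x : cvgn (evens ^~ x).
Proof.
apply: nondecreasing_is_cvgn; first exact: evens_nd.
by exists 1 => _ [n _ <-]; have /andP[] := evens01 n x.
Qed.

Let u (x : R) : R := limn (evens ^~ x).
Let v (x : R) : R := u (shift x).

Let u01 x : 0 <= u x <= 1.
Proof.
apply/andP; split.
  by apply: limr_ge; [exact: evens_cvg|near=> n; have /andP[] := evens01 n x].
by apply: limr_le; [exact: evens_cvg|near=> n; have /andP[] := evens01 n x].
Unshelve. all: by end_near. Qed.

Let uE x : u x = 2^-1 * (dig x + v (shift x)).
Proof.
apply/cvg_lim => //; rewrite -(cvg_shiftS (evens ^~ x)) /=.
by apply: cvgMl_tmp; apply: cvgD; [exact: cvg_cst|exact: evens_cvg].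
Qed.

Let mu_ : measurable_fun setT u.
Proof.
have me n : measurable_fun setT (evens n).
  elim: n => [|n IH] //=; apply: measurable_funM => //.
  apply: measurable_funD => //; apply: measurableT_comp => //.
  exact: measurableT_comp.
apply/measurable_EFinP.
apply: (emeasurable_fun_cvg (fun n x => (evens n x)%:E)) => //.
  by move=> n; apply/measurable_EFinP.
by move=> x _; apply: cvg_EFin; [exact: nearW|exact: evens_cvg].
Qed.

Let mv : measurable_fun setT v.
Proof. exact: measurableT_comp. Qed.

Let E (s t : R) : set R := [set x | s < u x /\ t < v x].

Let mgt (f : R -> R) (s : R) : measurable_fun setT f ->
  measurable [set x | s < f x].
Proof.
move=> mf; rewrite (_ : [set x | _] = setT `&` f @^-1` `]s, +oo[%classic).
  by apply: mf => //; exact: measurable_itv.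
by apply/seteqP; split => x /=; rewrite in_itv/= andbT//; case.
Qed.

Let mE s t : measurable (E s t).
Proof. by apply: measurableI; exact: mgt. Qed.

Let F (s t : R) : R := fine (U (E s t)).

Let UF s t : U (E s t) = (F s t)%:E.
Proof. by rewrite fineK//; apply: fin_num_measure; exact: mE. Qed.

Let F01 s t : 0 <= F s t <= 1.
Proof. by rewrite -!lee_fin -UF measure_ge0/=; apply: probability_le1; exact: mE. Qed.

Let F_rec s t : F s t = 2^-1 * (F t (2 * s) + F t (2 * s - 1)).
Proof.
apply: EFin_inj; rewrite mulrDr EFinD !EFinM -!UF -U_shift0// -U_shift1//.
rewrite (measureDI U (mE s t) mhalf) addeC setDE.
congr (_ + _)%E; congr (U _); apply/seteqP; split => x /=.
- move=> [[+ +] /negP xh]; rewrite uE /dig (negbTE xh) => h1 h2.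
  by split; [split=> //; lra|exact/negP].
- move=> [[h1 h2] /negP xh]; split; last exact/negP.
  by split => //; rewrite uE /dig (negbTE xh); lra.
- move=> [[+ +] xh]; rewrite uE /dig xh => h1 h2; split => //.
  by split=> //; lra.
- move=> [[h1 h2] xh]; split => //; split => //.
  by rewrite uE /dig xh; lra.
Qed.

Let F_ge1l s t : 1 <= s -> F s t = 0.
Proof.
move=> s1; rewrite /F (_ : E s t = set0) ?measure0//.
by apply/seteqP; split => // x [/= h _]; have /andP[_ ?] := u01 x; lra.
Qed.

Let F_ge1r s t : 1 <= t -> F s t = 0.
Proof.
move=> s1; rewrite /F (_ : E s t = set0) ?measure0//.
by apply/seteqP; split => // x [/= _ h]; have /andP[_ ?] := u01 (shift x); rewrite /v in h; lra.
Qed.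

Let F_lt0l s t : s < 0 -> F s t = F (-1) t.
Proof.
move=> s0; rewrite /F (_ : E s t = E (-1) t)//.
apply/seteqP; split => x [/= h1 h2]; split => //;
by have /andP[? ?] := u01 x; lra.
Qed.

Let F_lt0r s t : t < 0 -> F s t = F s (-1).
Proof.
move=> s0; rewrite /F (_ : E s t = E s (-1))//.
apply/seteqP; split => x [/= h1 h2]; split => //;
by have /andP[? ?] := u01 (shift x); rewrite /v in h2 *; lra.
Qed.

Let F_lt0 : F (-1) (-1) = 1.
Proof.
rewrite /F (_ : E _ _ = setT) ?probability_setT//.
apply/seteqP; split => // x _; split => /=.
  by have /andP[? ?] := u01 x; lra.
by have /andP[? ?] := u01 (shift x); rewrite /v; lra.
Qed.

Let surv01 s : 0 <= surv s <= 1.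
Proof.
rewrite /surv; case: ifPn; rewrite -?leNgt => ?; first by rewrite ler01 lexx.
by case: ifPn; rewrite -?leNgt => ?; apply/andP; split; lra.
Qed.

Let K (s t : R) : R := F s t - surv s * surv t.

Let K_rec s t : K s t = 2^-1 * (K t (2 * s) + K t (2 * s - 1)).
Proof.
have -> : K s t = F s t - 2^-1 * (surv (2 * s) + surv (2 * s - 1)) * surv t.
  congr (_ - _ * _); rewrite /surv.
  by case: (ltP s 0); case: (ltP s 1); case: (ltP (2 * s) 0);
    case: (ltP (2 * s) 1); case: (ltP (2 * s - 1) 0);
    case: (ltP (2 * s - 1) 1) => *; lra.
by rewrite F_rec /K; ring.
Qed.

Let K_le1 s t : `|K s t| <= 1.
Proof.
have /andP[? ?] := F01 s t.
have /andP[? ?] := surv01 s; have /andP[? ?] := surv01 t.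
have ? : 0 <= surv s * surv t by apply: mulr_ge0.
have ? : surv s * surv t <= 1 by apply: mulr_ile1.
by rewrite /K ler_norml; apply/andP; split; lra.
Qed.

Let K_ge1r s t : 1 <= t -> K s t = 0.
Proof.
move=> t1; rewrite /K F_ge1r// /surv !ltNge t1 (le_trans ler01 t1)/=.
by rewrite mulr0 subrr.
Qed.

Let K_lt0r s t : t < 0 -> K s t = K s (-1).
Proof.
by move=> t0; rewrite /K F_lt0r// /surv t0 oppr_lt0 ltr01.
Qed.

Let K_lt0l s t : s < 0 -> K s t = K (-1) t.
Proof.
by move=> t0; rewrite /K F_lt0l// /surv t0 oppr_lt0 ltr01.
Qed.

Let squeeze (x : R) : (forall n, `|x| <= 2^-1 ^+ n) -> x = 0.
Proof.
move=> H; apply/eqP; rewrite -normr_eq0 eq_le normr_ge0 andbT leNgt.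
apply/negP => x0.
have h := H (Num.truncn `|x|^-1).+1; move: h; apply/negP; rewrite -ltNge.
rewrite exprVn invf_plt ?posrE ?exprn_gt0//.
apply: lt_trans (truncnS_gt _) _; rewrite -natrX ltr_nat.
exact: ltn_expl.
Qed.

Let K_right t : K t (-1) = 0.
Proof.
apply: squeeze => n; elim: n t => [|n IH] t; first exact: K_le1.
have Kt r : K (-1) r = K r (-1).
  rewrite K_rec (K_lt0r r (t := 2 * -1)); last by lra.
  by rewrite (K_lt0r r (t := 2 * -1 - 1)); lra.
have [t0|t0] := ltP t 0.
  rewrite K_lt0l// /K F_lt0 /surv oppr_lt0 ltr01 mulr1 subrr normr0.
  by rewrite exprn_ge0.
have [t1|t1] := leP 1 t.
  by rewrite -Kt K_ge1r// normr0 exprn_ge0.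
rewrite K_rec !Kt normrM ger0_norm// exprS ler_pM2l ?invr_gt0//.
have [th|th] := ltP (2 * t) 1.
  have -> : K (2 * t - 1) (-1) = 0.
    rewrite K_lt0l; last by lra.
    by rewrite /K F_lt0 /surv oppr_lt0 ltr01 mulr1 subrr.
  by rewrite addr0; exact: IH.
by rewrite -(Kt (2 * t)) (K_ge1r _ th) add0r; exact: IH.
Qed.

Let K0 s t : K s t = 0.
Proof.
apply: squeeze => n; elim: n s t => [|n IH] s t; first exact: K_le1.
rewrite K_rec normrM ger0_norm// exprS ler_pM2l ?invr_gt0//.
have [th|th] := ltP (2 * s) 1.
  rewrite (K_lt0r _ (t := 2 * s - 1)); last by lra.
  by rewrite K_right addr0; exact: IH.
by rewrite (K_ge1r _ th) add0r; exact: IH.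
Qed.

Let U_indep A B : measurable A -> measurable B ->
  U (u @^-1` A `&` v @^-1` B) = (U A * U B)%E.
Proof.
move=> mA mB.
have h t : U (u @^-1` A `&` [set x | t < v x]) = ((surv t)%:E * U A)%E.
  have /andP[st0 _] := surv01 t.
  apply: (law_unique (r := NngNum st0)) => //=; first exact: mgt.
  move=> s; rewrite (_ : _ `&` _ = E s t).
    by rewrite UF -EFinM; congr EFin; rewrite mulrC; apply/eqP; rewrite -subr_eq0; apply/eqP; exact: K0.
  by apply/seteqP; split => x /=; rewrite in_itv/= andbT.
have UA0 : 0 <= fine (U A) by rewrite fine_ge0.
have UAE : U A = (fine (U A))%:E by rewrite fineK// fin_num_measure.
rewrite setIC UAE; apply: (law_unique (r := NngNum UA0)) => //=.
  by rewrite -[X in measurable X]setTI; exact: mu_.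
move=> t; rewrite -UAE muleC -h setIC; congr (U (_ `&` _)).
by apply/seteqP; split => x /=; rewrite in_itv/= andbT.
Qed.

Let xi (x : R) : TN R := fun k => u (iter k v x).

Let mxi_ k : measurable_fun setT (fun x => xi x k).
Proof.
apply: (measurableT_comp mu_); elim: k => [|k IH] /=; first exact: measurable_id.
exact: measurableT_comp.
Qed.

Let mxi : measurable_fun setT (xi : measurableTypeR R -> TN R).
Proof.
apply: (@measurability _ _ (measurableTypeR R) (TN R) setT xi (@cylinders R)) => //.
move=> _ [_ [k [B mB ->]] <-].
exact: mxi_.
Qed.

Let xi_box m (B : nat -> set R) : (forall j, measurable (B j)) ->
  U [set x | forall j, (j < m)%N -> B j (xi x j)] = (\prod_(j < m) U (B j))%E.
Proof.
elim: m B => [|m IH] B mB.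
  rewrite big_ord0 (_ : [set x | _] = setT) ?probability_setT//.
  by apply/seteqP; split.
rewrite big_ord_recl -(IH (fun j => B j.+1))// -U_indep//.
  congr (U _); apply/seteqP; split => x /=.
    move=> h; split; first exact: (h 0%N).
    by move=> j jm; have := h j.+1 jm; rewrite /xi iterSr.
  by move=> [h0 h] [_//|j jm]; have := h j jm; rewrite /xi iterSr.
rewrite (_ : [set x | _] =
   \bigcap_(j in [set j | (j < m)%N]) (fun x => xi x j) @^-1` B j.+1)//.
apply: bigcap_measurableType => j _.
by rewrite -[X in measurable X]setTI; exact: mxi_.
Qed.

Lemma product_measure_TN_exists : exists P : probability (TN R) R,
  forall (m : nat) (B : nat -> set R), (forall j, measurable (B j)) ->
  P [set x | forall j, (j < m)%N -> B j (x j)] = (\prod_(j < m) U (B j))%E.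
Proof.
pose X : {mfun measurableTypeR R >-> TN R} :=
  HB.pack xi (isMeasurableFun.Build _ _ _ _ _ mxi).
exists (distribution U X) => m B mB.
by rewrite -xi_box.
Qed.

End haar_existence.

Definition haarTN (R : realType) : probability (TN R) R :=
  projT1 (cid (product_measure_TN_exists R)).

Lemma haarTN_box (R : realType) (m : nat) (B : nat -> set R) :
  (forall j, measurable (B j)) ->
  haarTN R [set x | forall j, (j < m)%N -> B j (x j)] =
  (\prod_(j < m) uniform_prob (@ltr01 R) (B j))%E.
Proof. by move=> mB; rewrite /haarTN; case: cid => P /= ->. Qed.

Section dual_group.

Definition ZN := {fsfun nat -> int with 0}.

Definition gt_last (n : ZN) : Prop :=
  exists k : nat, 0 < n k /\ forall j : nat, (k < j)%N -> n j = 0.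

(* Z^k, as the elements of [ZN] supported on the first [k] coordinates *)
Definition Zlow (k : nat) : set ZN :=
  [set u | forall j : nat, (k <= j)%N -> u j = 0].

(* Z^[k+1, oo), as the elements of [ZN] vanishing on the first [k] coordinates *)
Definition Zhigh (k : nat) : set ZN :=
  [set v | forall j : nat, (j < k)%N -> v j = 0].

Definition ZN0 : ZN := [fsfun].

Definition concat (k : nat) (u v : ZN) : ZN :=
  [fsfun j in (finsupp u `|` finsupp v)%fset =>
     if (j < k)%N then u j else v j].

Definition single (k : nat) (m : int) : ZN := [fsfun j in [fset k]%fset => m].

Lemma concatE k u v j : concat k u v j = if (j < k)%N then u j else v j.
Proof.
rewrite fsfunE in_fsetU; case: ifPn => //; rewrite negb_or.
by move=> /andP[ju jv]; rewrite !fsfun_dflt// if_same.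
Qed.

Lemma singleE k m j : single k m j = if j == k then m else 0.
Proof. by rewrite fsfunE in_fset1. Qed.

End dual_group.

Section hardy_martingales.
Variable R : realType.
Local Notation C := R[i].
Local Notation P := (haarTN R).
Implicit Types (f g : TN R -> C) (n : ZN) (lam : ZN -> R).

Definition pairing n (x : TN R) : R := \sum_(j <- finsupp n) (n j)%:~R * x j.

Definition expi (t : R) : C := (cos t +i* sin t)%C.

Definition echar n (x : TN R) : C := expi (2 * pi * pairing n x).

Definition periodicTN f : Prop :=
  forall (x : TN R) (k : nat -> int), f (fun j => x j + (k j)%:~R) = f x.

Definition integrableTN f : Prop :=
  P.-integrable setT (fun x => (complex.Re (f x))%:E) /\
  P.-integrable setT (fun x => (complex.Im (f x))%:E).

Definition integralTN f : C :=
  (Rintegral P setT (fun x => complex.Re (f x)) +i*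
   Rintegral P setT (fun x => complex.Im (f x)))%C.

Definition L1 : set (TN R -> C) := [set f | periodicTN f /\ integrableTN f].

Definition L1norm f : \bar R := (\int[P]_x (Normc.normc (f x))%:E)%E.

Definition fourier f n : C :=
  integralTN (fun x => f x * expi (- (2 * pi * pairing n x))).

Definition span_last : set (TN R -> C) :=
  [set g | exists (s : seq ZN) (c : ZN -> C),
     (forall n, n \in s -> gt_last n) /\
     g = (fun x => \sum_(n <- s) c n * echar n x)].

Definition H1_last : set (TN R -> C) :=
  [set f | L1 f /\ forall eps : R, 0 < eps ->
     exists2 g, span_last g & (L1norm (fun x => (f x - g x)%R) < eps%:E)%E].

Definition multiplier_norm lam : \bar R :=
  ereal_inf [set M : \bar R | (0 <= M)%E /\ forall f, H1_last f ->
    (\esum_(n in gt_last) (lam n * Normc.normc (fourier f n))%:E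
       <= M * L1norm f)%E].

(* [mu 0] is irrelevant: all the blocks lie in {1, 2, ...}. *)
Definition Fnorm (mu : nat -> \bar R) : \bar R :=
  ereal_sup [set sqrte (\sum_(1 <= k <oo)
      (\sum_(a * k <= j < a * k.+1) mu j) ^+ 2)%E | a in [set a | (0 < a)%N]].

Definition Q lam : \bar R :=
  (ereal_sup (range (fun k : nat =>
     Fnorm (fun m : nat =>
       \esum_(u in Zlow k) (lam (concat k u (single k m%:Z)))%:E)))
   + ereal_sup (range (fun k : nat =>
       sqrte (\esum_(v in Zhigh k `\ ZN0)
         (\esum_(u in Zlow k) (lam (concat k u v))%:E) ^+ 2))))%E.

End hardy_martingales.

(* Main.v *)
(* Upper bound.  Let s >= Q(lambda), f = sum f_n e_n, and choose c_n with
   |c_n| = lambda_n / s and f_n conj(c_n) = lambda_n |f_n| / s.  For a coordinate k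
   and 0 <= r <= 1, let F and Phi be the sums of the r^(n_k) f_n e_n and of the
   r^(n_k) c_n e_n over the n supported on the coordinates up to k, and let
   V = Re sum c_n conj(c_m) r^|n_k - m_k| e_(n-m) over the pairs with the same
   coordinates beyond k.  At r = 1 these are the values for k+1 at r = 0, so r
   interpolates between two steps of the martingale.  The bound
   |V - |Phi|^2| <= C0 is what Q controls: the pairs with a nonzero tail beyond k
   give the second term of Q, the other ones a form with the kernel
   r^|m - m'| - r^(m + m'), for which blocks of length about 1/(1 - r) give the
   first term.  The expectation of the Bellman function
     sqrt(|F|^2 + eps^2) / (L + V - |Phi|^2) - b Re(F conj(Phi))
   is nondecreasing in r: the sum of its increments in the directions
   r -> (1 + h)r, r -> r/(1 + h), x_k -> x_k +- asin(h)/(2 pi) is bounded below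
   by - C r h^3, and the translations of x_k preserve the measure.  Comparing the
   two ends gives sum lambda_n |f_n| / s <= C E|f|.

   Lower bound.  For finite sets A and A' with A + U in A', and
   b_q = sum_(u in U) lambda_(u+q), the test function
   |A|^(-1) conj(sum_(p in A) e_p) (sum_(p' in A') e_p') (sum_q b_q e_q)
   has a coefficient at least b_q at each u + q, and Cauchy-Schwarz bounds its L^1
   norm by (|A'| / |A|)^(1/2) (sum_q b_q^2)^(1/2) when the sums p' + q are
   distinct.  Large boxes keep |A'| / |A| bounded. *)
From HB Require Import structures.
Require Import Defs.
From mathcomp Require Import all_boot all_order all_algebra finmap.
From mathcomp Require Import all_classical all_reals all_analysis.
From mathcomp Require Import measurable_realfun complex lra ring zify.
Import Order.TTheory GRing.Theory Num.Theory.
Import numFieldNormedType.Exports.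
Local Open Scope classical_set_scope.
Local Open Scope ring_scope.

Set Implicit Arguments.
Unset Strict Implicit.
Unset Printing Implicit Defensive.

(** * Sums over blocks and the Poisson kernel *)

(** The quotient works because $|F|^{1/2}$, and not only $|F|$, is subharmonic when $F$ is analytic
    in $r e^{2\pi i x_k}$. With $g = L + V - |\Phi|^2$, AM-GM bounds the increment of $|F|/g$ from
    below by $|F|/g$ times twice the relative increment of $|F|^{1/2}$ minus the relative increment
    of $g$, so no mixed term in $F$ and $g$ survives. Over the four directions $V$ is harmonic and
    $-|\Phi|^2$ loses $4h^2|\Phi'|^2$; the gains in $|F'|^2$ and $|\Phi'|^2$ together dominate the
    increment $4bh^2\,\mathrm{Re}(F'\overline{\Phi'})$ of the pairing, which fixes $b$. Positivity
    of the last coordinate enters through the analyticity of $F$ and $\Phi$. The regularisation eps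
    keeps the quotient smooth at the zeros of $F$; its cost is a constant depending on eps, harmless
    because $h$ tends to 0 with eps fixed. Every error must carry the factor $r$, since it has to be
    absorbed by the second difference of a small multiple of $r$. *)

Section blocks.
Variable R : realType.
Implicit Types (f mu : nat -> R).

Lemma ler_sum_nat_range f m n m' n' : (forall i, 0 <= f i) ->
  (m' <= m)%N -> (n <= n')%N ->
  \sum_(m <= i < n) f i <= \sum_(m' <= i < n') f i.
Proof.
move=> f0 mm nn; have [mn|nm] := leqP m n; last first.
  by rewrite big_geq ?sumr_ge0// ltnW.
rewrite [leRHS](big_cat_nat (n := m)) ?(leq_trans mn)//=.
rewrite [X in _ <= _ + X](big_cat_nat (n := n))//=.
by rewrite addrCA lerDl addr_ge0 ?sumr_ge0.
Qed.

Lemma sum_nat_pairs f (a : nat) : (0 < a)%N ->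
  \sum_(1 <= j < a) (f (2 * j)%N.-1 + f (2 * j)%N) = \sum_(1 <= i < (2 * a).-1) f i.
Proof.
case: a => // a _; elim: a => [|a IH]; first by rewrite !big_geq.
have e : (2 * a.+2).-1 = (2 * a.+1).-1.+2 by lia.
rewrite big_nat_recr// {}IH e !big_nat_recr//; last by lia.
rewrite /= addrA.
by rewrite (_ : (2 * a.+1).-1.+1 = 2 * a.+1)%N//= addrA; lia.
Qed.

Lemma sum_nat_blocks f (a L : nat) :
  \sum_(a <= j < a * L.+1) f j =
  \sum_(1 <= l < L.+1) \sum_(a * l <= j < a * l.+1) f j.
Proof.
elim: L => [|L IH]; first by rewrite muln1 !big_geq.
rewrite (big_cat_nat (n := a * L.+1)) ?leq_mul2l ?leqnSn ?orbT//=; last first.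
  by rewrite leq_pmulr.
by rewrite IH [RHS]big_nat_recr.
Qed.

Section window.
Variables (mu : nat -> R) (a : nat).
Hypothesis mu0 : forall j, 0 <= mu j.
Hypothesis blockF : forall b L : nat, (0 < b)%N ->
  \sum_(1 <= l < L) (\sum_(b * l <= j < b * l.+1) mu j) ^+ 2 <= 1.
Hypothesis a0 : (0 < a)%N.

Let block_le1 b : (0 < b)%N -> \sum_(b <= j < b * 2) mu j <= 1.
Proof.
move=> b0; have := blockF 2 b0; rewrite big_nat1 muln1.
by rewrite expr_le1// sumr_ge0.
Qed.

Let U j := \sum_(j <= m < a) mu m.

(** The blocks of length [a] leave out [0, a), where only the dyadic blocks [b, 2b) give
    information: [U j] is of order log(a / j), whose square sums to O(a). The logarithm stays
    implicit: [U j <= 1 + U (2 * j)], (1 + u)^2 <= 3 + (3/2) u^2, and by monotonicity the squares at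
    even indices sum to at most X / 2, so that X <= 3 a + (3/4) X. *)
Let sumU : \sum_(1 <= j < a) U j ^+ 2 <= 12 * a%:R.
Proof.
have U0 j : 0 <= U j by rewrite sumr_ge0.
have Ud j : U j.+1 <= U j by exact: ler_sum_nat_range.
have US j : (0 < j)%N -> U j <= 1 + U (2 * j)%N.
  move=> j0; have [ja|ja] := leqP (2 * j) a.
    rewrite /U (big_cat_nat (n := (2 * j)%N)) ?leq_pmull//=.
    by rewrite lerD2r mulnC; exact: block_le1.
  apply: (@le_trans _ _ 1); last by rewrite lerDl.
  by apply: le_trans (block_le1 j0); apply: ler_sum_nat_range => //; lia.
set X := leLHS.
have h : \sum_(1 <= j < a) U (2 * j)%N ^+ 2 <= 2^-1 * X.
  rewrite mulr_sumr.
  apply: (@le_trans _ _ (\sum_(1 <= j < a)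
     2^-1 * (U (2 * j)%N.-1 ^+ 2 + U (2 * j)%N ^+ 2))).
    apply: ler_sum_nat => j /andP[j0 _].
    have : U (2 * j)%N ^+ 2 <= U (2 * j)%N.-1 ^+ 2.
      rewrite ler_pXn2r ?nnegrE//.
      by have := Ud (2 * j)%N.-1; rewrite prednK// muln_gt0.
    by move=> ?; lra.
  rewrite -!mulr_sumr ler_pM2l ?invr_gt0// /X.
  apply: (@le_trans _ _ (\sum_(1 <= i < (2 * a).-1) U i ^+ 2)).
    by rewrite (sum_nat_pairs (fun i => U i ^+ 2)).
  rewrite (big_cat_nat (n := a))//=; last by lia.
  rewrite [Y in _ + Y]big_nat [Y in _ + Y]big1 ?addr0// => i /andP[ai _].
  by rewrite /U big_geq ?expr0n.
have : X <= \sum_(1 <= j < a) (3 + 3 / 2 * U (2 * j)%N ^+ 2).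
  apply: ler_sum_nat => j /andP[j0 _].
  have : U j ^+ 2 <= (1 + U (2 * j)%N) ^+ 2.
    by rewrite ler_pXn2r ?nnegrE ?addr_ge0// US.
  move=> /le_trans; apply; move: (U _) => u; have := sqr_ge0 (u - 2); nra.
rewrite big_split/= -mulr_sumr sumr_const_nat.
have : (3 : R) *+ (a - 1) <= 3 * a%:R.
  by rewrite -[leLHS]mulr_natr ler_pM2l// ler_nat leq_subr.
move=> h1 h2; move: (\sum_(1 <= j < a) U (2 * j)%N ^+ 2) h h2 => Y ? ?; lra.
Qed.

(** A window starting at [a] or later meets two consecutive blocks of length [a], and each block
    contains [a] starting points: 4 a in all. A window starting before [a] is [U j] plus a part of
    [a, 2a), which has mass at most 1: this gives 2 * 12 a + 2 a. *)
Lemma sum_window_sqr_le N :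
  \sum_(1 <= j < N) (\sum_(j <= m < j + a) mu m) ^+ 2 <= 30 * a%:R.
Proof.
set W := fun j => \sum_(j <= m < j + a) mu m.
have W0 j : 0 <= W j by rewrite sumr_ge0.
apply: (@le_trans _ _ (\sum_(1 <= j < a * N.+1) W j ^+ 2)).
  by apply: ler_sum_nat_range => //; [move=> i; rewrite sqr_ge0|rewrite (leq_trans (leqnSn N))// leq_pmull].
rewrite (big_cat_nat (n := a)) ?leq_pmulr//=.
have h1 : \sum_(1 <= j < a) W j ^+ 2 <= 26 * a%:R.
  apply: (@le_trans _ _ (\sum_(1 <= j < a) (2 * U j ^+ 2 + 2))).
    apply: ler_sum_nat => j /andP[j0 ja].
    have WU : W j <= U j + 1.
      rewrite /W (big_cat_nat (n := a)) ?leq_addl ?(ltnW ja)//= lerD2l.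
      by apply: le_trans (block_le1 a0); apply: ler_sum_nat_range => //; lia.
    have : W j ^+ 2 <= (U j + 1) ^+ 2.
      by rewrite ler_pXn2r ?nnegrE ?addr_ge0// sumr_ge0.
    move=> /le_trans; apply; move: (U j) => u; have := sqr_ge0 (u - 1); nra.
  rewrite big_split/= -mulr_sumr sumr_const_nat.
  have : (2 : R) *+ (a - 1) <= 2 * a%:R.
    by rewrite -[leLHS]mulr_natr ler_pM2l// ler_nat leq_subr.
  have := sumU; lra.
have h2 : \sum_(a <= j < a * N.+1) W j ^+ 2 <= 4 * a%:R.
  rewrite sum_nat_blocks.
  pose La l := \sum_(a * l <= j < a * l.+1) mu j.
  have La0 l : 0 <= La l by rewrite sumr_ge0.
  apply: (@le_trans _ _ (\sum_(1 <= l < N.+1) a%:R * (2 * La l ^+ 2 + 2 * La l.+1 ^+ 2))).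
    apply: ler_sum_nat => l _.
    apply: (@le_trans _ _ (\sum_(a * l <= j < a * l.+1) (2 * La l ^+ 2 + 2 * La l.+1 ^+ 2))).
      apply: ler_sum_nat => j /andP[lj jl].
      have : W j <= La l + La l.+1.
        rewrite /La -big_cat_nat/= ?leq_mul2l ?leqnSn ?orbT//.
        by apply: ler_sum_nat_range => //; rewrite (mulnS a l.+1) addnC leq_add2l ltnW.
      have : 0 <= W j by [].
      move: (W j) (La l) (La l.+1) => w x y w0 wxy.
      have : w ^+ 2 <= (x + y) ^+ 2 by rewrite ler_pXn2r ?nnegrE// (le_trans w0).
      move=> /le_trans; apply; have := sqr_ge0 (x - y); nra.
    by rewrite sumr_const_nat mulnS addnK -[leLHS]mulr_natl.
  rewrite -mulr_sumr [leRHS]mulrC ler_wpM2l// big_split/= -!mulr_sumr.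
  have : \sum_(1 <= l < N.+1) La l.+1 ^+ 2 <= 1.
    apply: le_trans (blockF N.+2 a0); rewrite -/La.
    rewrite [leRHS]big_nat_recl//= lerDr sqr_ge0//.
  have := blockF N.+1 a0; rewrite -/La; lra.
lra.
Qed.

End window.
End blocks.

Section poisson_kernel.
Variable R : realType.
Implicit Types (mu : nat -> R).

(** The kernel is 1 - r^2 times the Gram matrix of the sequences j -> r^(m - j), 1 <= j <= m. The
    quadratic form it defines is therefore a sum of squares. *)
Lemma geometric_kernelE (r : R) (m n : nat) :
  r ^+ (`|m%:Z - n%:Z|) - r ^+ (m + n) =
  (1 - r ^+ 2) * \sum_(1 <= j < (minn m n).+1) r ^+ (m - j) * r ^+ (n - j).
Proof.
wlog mn : m n / (m <= n)%N.
  move=> H; have /orP[/H//|/H] := leq_total m n.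
  rewrite distnC addnC minnC => ->; congr (_ * _).
  by apply: eq_bigr => j _; rewrite mulrC.
rewrite (minn_idPl mn) distnC distnEl//.
elim: m mn => [|m IH] mn; first by rewrite subn0 add0n subrr big_geq ?mulr0.
rewrite big_nat_recr//= subnn expr0 mul1r mulrDr.
have -> : \sum_(1 <= j < m.+1) r ^+ (m.+1 - j) * r ^+ (n - j) =
   r * \sum_(1 <= j < m.+1) r ^+ (m - j) * r ^+ (n - j).
  rewrite mulr_sumr; apply: eq_big_nat => j /andP[_ jm].
  by rewrite mulrA -exprS subSn.
rewrite mulrCA -IH; last exact: ltnW.
have [k ->] : exists k, n = (m.+1 + k)%N by exists (n - m.+1)%N; lia.
rewrite (_ : m.+1 + k - m = k.+1)%N; last by lia.
rewrite (_ : m.+1 + k - m.+1 = k)%N; last by lia.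
rewrite (_ : m + (m.+1 + k) = (m + m + k).+1)%N; last by lia.
rewrite (_ : m.+1 + (m.+1 + k) = (m + m + k).+2)%N; last by lia.
by rewrite !exprS; ring.
Qed.

(** The block length adapted to [r]: [a] is just above 1 / (1 - r), so (1 - r) a stays bounded,
    while Bernoulli's inequality for 1 / r >= 1 + (1 - r) makes r^a fall below 1/2. *)
Lemma pow_truncn_le_half (r : R) : 0 <= r < 1 ->
  exists2 a : nat, (0 < a)%N & r ^+ a <= 2^-1 /\ (1 - r) * a%:R <= 2.
Proof.
move=> /andP[r0 r1]; set t := (1 - r)^-1.
have t0 : 0 < 1 - r by rewrite subr_gt0.
have tt : (1 - r) * t = 1 by rewrite divff ?gt_eqF.
have tge : 0 <= t by rewrite invr_ge0 ltW.
exists (Num.truncn t).+1 => //; have /andP[h1 h2] := truncn_itv tge.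
set a := (Num.truncn t).+1 in h2 *.
have h3 : a%:R <= t + 1 by rewrite /a -natr1 lerD2r.
split; last first.
  by rewrite (le_trans (ler_wpM2l (ltW t0) h3))// mulrDr tt; lra.
have [->|rn0] := eqVneq r 0; first by rewrite expr0n /a/= invr_ge0.
have rp : 0 < r by rewrite lt_def rn0.
rewrite -lef_pV2 ?posrE ?invr_gt0 ?exprn_gt0// invrK -exprVn.
have rV : 1 + (1 - r) <= r^-1.
  by rewrite -[r^-1]mul1r ler_pdivlMr//; have := sqr_ge0 (1 - r); nra.
have bern (n : nat) (x : R) : 0 <= x -> 1 + n%:R * x <= (1 + x) ^+ n.
  move=> x0; elim: n => [|n IH]; first by rewrite mul0r addr0 expr0.
  rewrite exprS -natr1; apply: (@le_trans _ _ ((1 + x) * (1 + n%:R * x))).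
    have : 0 <= n%:R * x ^+ 2 by rewrite mulr_ge0 ?sqr_ge0.
    by move: (n%:R) => c; nra.
  by rewrite ler_wpM2l//; lra.
have : (1 + (1 - r)) ^+ a <= r^-1 ^+ a by rewrite lerXn2r// nnegrE ?invr_ge0//; lra.
apply: le_trans; apply: le_trans (bern _ _ (ltW t0)).
have : (1 - r) * t <= (1 - r) * a%:R by rewrite ler_wpM2l// ltW.
by rewrite tt mulrC; lra.
Qed.

(** With r^a <= 1/2 the tails satisfy T j <= W j + T (j + a) / 2, where W is the sum over a window
    of length [a]. Squaring gives T^2 <= 2 W^2 + (1/2) T(. + a)^2; the last sum is absorbed, and the
    sum of the T^2 is at most 4 * 30 a. Finally (1 - r^2) a <= 2 (1 - r) a <= 4, whence 480. *)
Lemma poisson_kernel_form_le mu (r : R) N : (forall j, 0 <= mu j) ->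
  (forall b L : nat, (0 < b)%N ->
    \sum_(1 <= l < L) (\sum_(b * l <= j < b * l.+1) mu j) ^+ 2 <= 1) ->
  0 <= r <= 1 ->
  \sum_(1 <= m < N) \sum_(1 <= n < N)
     mu m * mu n * (r ^+ (`|m%:Z - n%:Z|) - r ^+ (m + n)) <= 480.
Proof.
move=> mu0 F /andP[r0]; rewrite le_eqVlt => /predU1P[->|r1].
  rewrite big1 ?ler0n// => m _; rewrite big1// => n _.
  by rewrite !expr1n subrr mulr0.
pose T j := \sum_(j <= m < N) mu m * r ^+ (m - j).
have T0 j : 0 <= T j by rewrite sumr_ge0// => m _; rewrite mulr_ge0// exprn_ge0.
have -> : \sum_(1 <= m < N) \sum_(1 <= n < N)
     mu m * mu n * (r ^+ (`|m%:Z - n%:Z|) - r ^+ (m + n)) =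
     (1 - r ^+ 2) * \sum_(1 <= j < N) T j ^+ 2.
  transitivity (\sum_(1 <= m < N) \sum_(1 <= n < N) \sum_(1 <= j < N)
     (1 - r ^+ 2) * (if (j <= m)%N && (j <= n)%N then
        (mu m * r ^+ (m - j)) * (mu n * r ^+ (n - j)) else 0)).
    apply: eq_big_nat => m /andP[m0 mN]; apply: eq_big_nat => n /andP[n0 nN].
    rewrite geometric_kernelE mulrCA -mulr_sumr; congr (_ * _).
    rewrite -big_mkcond/= mulr_sumr.
    rewrite [LHS](big_nat_widen _ _ N); last by rewrite gtn_min mN.
    apply: eq_big => j; first by rewrite ltnS leq_min.
    by move=> _; ring.
  under eq_bigr do rewrite exchange_big/=.
  rewrite exchange_big/= mulr_sumr; apply: eq_big_nat => j /andP[j1 jN].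
  have TE : T j = \sum_(1 <= m < N) if (j <= m)%N then mu m * r ^+ (m - j) else 0.
    rewrite /T (big_cat_nat (n := j) (m := 1))//=; last exact: ltnW.
    rewrite [X in _ = X + _]big_nat [X in _ = X + _]big1 ?add0r.
      by apply: eq_big_nat => m /andP[-> _].
    by move=> i /andP[_]; rewrite ltnNge => /negbTE ->.
  rewrite [T j ^+ 2]expr2 TE big_distrlr/= mulr_sumr; apply: eq_bigr => m _.
  rewrite mulr_sumr; apply: eq_bigr => n _; congr (_ * _).
  by case: (j <= m)%N; case: (j <= n)%N; rewrite ?mul0r ?mulr0.
have /pow_truncn_le_half[a a0 [ra arl]] : 0 <= r < 1 by rewrite r0.
pose W j := \sum_(j <= m < j + a) mu m.
have TW j : T j <= W j + 2^-1 * T (j + a)%N.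
  have m1 m : mu m * r ^+ (m - j) <= mu m.
    by rewrite ler_piMr// exprn_ile1// ltW.
  have [jaN|Nja] := leqP (j + a) N; last first.
    apply: (@le_trans _ _ (W j)); last by rewrite lerDl mulr_ge0.
    apply: (@le_trans _ _ (\sum_(j <= m < N) mu m)); first exact: ler_sum.
    by apply: ler_sum_nat_range => //; exact: ltnW.
  rewrite {1}/T (big_cat_nat (n := (j + a)%N)) ?leq_addr//=.
  apply: lerD; first exact: ler_sum.
  rewrite mulr_sumr; apply: ler_sum_nat => m /andP[jam mN].
  rewrite (_ : m - j = a + (m - (j + a)))%N; last by lia.
  by rewrite exprD mulrCA ler_wpM2r// mulr_ge0// exprn_ge0.
have h1 : \sum_(1 <= j < N) T j ^+ 2 <= 120 * a%:R.
  set Y := leLHS.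
  have hW : \sum_(1 <= j < N) W j ^+ 2 <= 30 * a%:R by exact: sum_window_sqr_le.
  have hT : \sum_(1 <= j < N) T (j + a)%N ^+ 2 <= Y.
    have -> : \sum_(1 <= j < N) T (j + a)%N ^+ 2 = \sum_(1 + a <= j < N + a) T j ^+ 2.
      by rewrite [RHS]big_addn addnK.
    have [aN|Na] := leqP (1 + a) N; last first.
      rewrite big_nat big1 ?sumr_ge0// => [j _|j /andP[j1 j2]]; first by rewrite sqr_ge0.
      by rewrite /T big_geq ?expr0n//; lia.
    rewrite (big_cat_nat (n := N)) ?leq_addr//=.
    rewrite [Z in _ + Z]big_nat [Z in _ + Z]big1 ?addr0.
      by apply: ler_sum_nat_range => // i; rewrite sqr_ge0.
    by move=> j /andP[Nj _]; rewrite /T big_geq ?expr0n.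
  have : Y <= \sum_(1 <= j < N) (2 * W j ^+ 2 + 2^-1 * T (j + a)%N ^+ 2).
    apply: ler_sum => j _; have := TW j; have := T0 j.
    have : 0 <= W j by rewrite sumr_ge0.
    move: (T (j + a)%N) (T j) (W j) (T0 (j + a)%N) => t u w t0 w0 u0 uw.
    have : u ^+ 2 <= (w + 2^-1 * t) ^+ 2 by rewrite ler_pXn2r ?nnegrE// (le_trans u0).
    by move=> /le_trans; apply; have := sqr_ge0 (w - 2^-1 * t); nra.
  by rewrite big_split/= -!mulr_sumr; lra.
have : (1 - r ^+ 2) * (\sum_(1 <= j < N) T j ^+ 2) <= (1 - r ^+ 2) * (120 * a%:R).
  by rewrite ler_wpM2l// subr_ge0 exprn_ile1// ltW.
move=> /le_trans; apply.
have : 0 <= (1 - r) * a%:R by rewrite mulr_ge0// subr_ge0 ltW.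
by move: (a%:R) arl => A; nra.
Qed.

End poisson_kernel.

(** * The Bellman function *)

Section dotc.
Variable R : realType.
Implicit Types (x y z : R[i]) (a b : R).
Local Notation normc := Normc.normc.

Definition dotc x y : R :=
  complex.Re x * complex.Re y + complex.Im x * complex.Im y.

Lemma dotcE x y : dotc x y = complex.Re (x * conjc y).
Proof. by case: x => a b; case: y => c d /=; rewrite /dotc/=; ring. Qed.

Lemma dotcC x y : dotc x y = dotc y x.
Proof. by rewrite /dotc; ring. Qed.

Lemma dotcDl x y z : dotc (x + y) z = dotc x z + dotc y z.
Proof. by case: x => a b; case: y => c d; rewrite /dotc/=; ring. Qed.

Lemma dotcDr x y z : dotc x (y + z) = dotc x y + dotc x z.
Proof. by rewrite ![dotc x _]dotcC dotcDl. Qed.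

Lemma dotcZr a x y : dotc x (a%:C%C * y) = a * dotc x y.
Proof. by case: x => b c; case: y => d e; rewrite /dotc/=; ring. Qed.

Lemma dotcZl a x y : dotc (a%:C%C * x) y = a * dotc x y.
Proof. by rewrite dotcC dotcZr dotcC. Qed.

Lemma normc_dotE x : normc x = Num.sqrt (dotc x x).
Proof. by case: x => a b; rewrite /dotc -!expr2. Qed.

Lemma dotcc_ge0 x : 0 <= dotc x x.
Proof. by rewrite /dotc -!expr2 addr_ge0 ?sqr_ge0. Qed.

Lemma normc_ge0 x : 0 <= normc x.
Proof. by rewrite normc_dotE sqrtr_ge0. Qed.

Lemma sqr_normc_dot x : normc x ^+ 2 = dotc x x.
Proof. by rewrite normc_dotE sqr_sqrtr// dotcc_ge0. Qed.

Lemma ler_dotc x y : `|dotc x y| <= normc x * normc y.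
Proof.
rewrite -(@ler_pXn2r _ 2) ?nnegrE ?mulr_ge0 ?normc_ge0//.
rewrite exprMn !sqr_normc_dot real_normK ?num_real//.
case: x => a b; case: y => c d; rewrite /dotc/=.
by have := sqr_ge0 (a * d - b * c); nra.
Qed.

Lemma dotc_le x y (a b : R) : normc x <= a -> normc y <= b -> dotc x y <= a * b.
Proof.
move=> xa yb; apply: le_trans (ler_norm _) _; apply: le_trans (ler_dotc _ _) _.
by rewrite ler_pM ?normc_ge0.
Qed.

Lemma dotc_ge x y (a b : R) : normc x <= a -> normc y <= b -> - (a * b) <= dotc x y.
Proof.
move=> xa yb; have /ler_normlP[h _] := ler_dotc x y.
by rewrite lerNl (le_trans h)// ler_pM ?normc_ge0.
Qed.

Lemma normc_le_add x y : normc (x + y) <= normc x + normc y.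
Proof. exact: le_normcD. Qed.

Lemma normc_real a : normc a%:C%C = `|a|.
Proof. by rewrite /= expr0n addr0 sqrtr_sqr. Qed.

Lemma normc_i : normc ('i%C : R[i]) = 1.
Proof. by rewrite /= expr0n add0r expr1n sqrtr1. Qed.

End dotc.

Section pointwise.
Variable R : realType.
Local Notation normc := Normc.normc.

(* AM-GM: [X + Y >= 2 sqrt (X Y)] with [X = (s1 / s0) (g0 / g1)] and
   [Y = g1 / g0] removes [g1]; the constant [11 / 50] lies between the Taylor
   coefficient [3 / 16] and the value [1 / 4] needed in [four_points]. *)
Lemma sqrt_div_ge (A0 A1 g0 g1 : R) : 0 < A0 -> 0 <= A1 -> 0 < g0 -> 0 < g1 ->
  `|A1 - A0| <= 10^-1 * A0 ->
  Num.sqrt A0 / g0 * ((A1 - A0) / A0 / 2 - (g1 - g0) / g0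
     - 11 / 50 * ((A1 - A0) / A0) ^+ 2) <=
  Num.sqrt A1 / g1 - Num.sqrt A0 / g0.
Proof.
move=> A0p A1p g0p g1p dA.
set u := (A1 - A0) / A0.
have uE : A1 = A0 * (1 + u) by rewrite /u mulrDr mulr1 mulrCA divff ?gt_eqF// mulr1 addrC subrK.
have /andP[u1 u2] : - 10^-1 <= u <= 10^-1.
  rewrite -ler_norml /u normrM normfV (gtr0_norm A0p) ler_pdivrMr//.
have ps0 : 0 < Num.sqrt A0 by rewrite sqrtr_gt0.
set s0 := Num.sqrt A0 in ps0 *; set s1 := Num.sqrt A1.
have s1E : (s1 / s0) ^+ 2 = 1 + u.
  rewrite expr_div_n !sqr_sqrtr ?(ltW A0p)// uE mulrAC divff ?mul1r// gt_eqF//.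
pose t := s1 / s0.
have t0 : 0 <= t by rewrite divr_ge0 ?sqrtr_ge0// ltW.
(* [q] is a lower bound for (1 + u)^(1/4), the ratio of the values of $A^{1/4}$. It is checked by
   squaring twice, with 1 + u/2 - (3/20) u^2 as an intermediate bound below (1 + u)^(1/2). *)
pose q := 1 + u / 4 - 11 / 100 * u ^+ 2.
have uu : u ^+ 2 <= 100^-1.
  have : 0 <= (10^-1 - u) * (10^-1 + u) by rewrite mulr_ge0//; lra.
  by rewrite (_ : _ * _ = 100^-1 - u ^+ 2); [lra|field].
have uu0 := sqr_ge0 u.
have q0 : 0 <= q by rewrite /q; lra.
have qp : q ^+ 2 <= 1 + u / 2 - 3 / 20 * u ^+ 2.
  rewrite -subr_ge0 /q (_ : _ - _ = u ^+ 2 * (3 / 400 + 11 / 200 * u - (11 / 100) ^+ 2 * u ^+ 2)); last by field.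
  by apply: mulr_ge0; [exact: sqr_ge0|lra].
have pu : (1 + u / 2 - 3 / 20 * u ^+ 2) ^+ 2 <= 1 + u.
  rewrite -subr_ge0 (_ : _ - _ = u ^+ 2 * (1 / 20 + 3 / 20 * u - (3 / 20) ^+ 2 * u ^+ 2)); last by field.
  by apply: mulr_ge0; [exact: sqr_ge0|lra].
have qt : q ^+ 2 <= t.
  apply: (le_trans qp); rewrite -(@ler_pXn2r _ 2) ?nnegrE//; first by rewrite /t s1E.
  by apply: le_trans qp; rewrite sqr_ge0.
pose X := t * (g0 / g1); pose Y := g1 / g0.
have XY : X * Y = t by rewrite /X /Y; field; rewrite !gt_eqF.
have X0 : 0 <= X by rewrite mulr_ge0// divr_ge0// ltW.
have Y0 : 0 <= Y by rewrite divr_ge0// ltW.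
have XYq : 2 * q <= X + Y.
  have XY0 : 0 <= X + Y by exact: addr_ge0.
  have q20 : 0 <= 2 * q by lra.
  by rewrite -(@ler_pXn2r _ 2) ?nnegrE//; have := sqr_ge0 (X - Y); nra.
have -> : s1 / g1 - s0 / g0 = s0 / g0 * (X - 1) by rewrite /X /t; field; rewrite !gt_eqF.
rewrite ler_pM2l ?divr_gt0//.
have -> : (g1 - g0) / g0 = Y - 1 by rewrite /Y; field; rewrite gt_eqF.
by move: XYq; rewrite /q; lra.
Qed.

Section direction.
Variables (K r h e2 : R).
Hypotheses (K1 : 1 <= K) (r01 : 0 <= r <= 1) (h01 : 0 <= h <= 1).

(** Increments have the form h d + e, with [d] the derivative in one direction and [e] of second
    order. Both carry a factor [r], so the cross term costs r^2 h^3, and one factor [r] is kept in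
    the error on purpose. *)
Lemma sqr_incr_ge (d e : R[i]) : normc d <= K * r -> normc e <= K * r * h ^+ 2 ->
  h ^+ 2 * dotc d d - 2 * K ^+ 2 * r * h ^+ 3 <=
  dotc (h%:C%C * d + e) (h%:C%C * d + e).
Proof.
move=> dK eK; rewrite !dotcDl !dotcDr !dotcZl !dotcZr (dotcC e d).
have h1 := dotc_ge dK eK; have h2 := dotcc_ge0 e.
have /andP[r0 r1] := r01; have /andP[h0 h1'] := h01.
have : - (h * (K * r * (K * r * h ^+ 2))) <= h * dotc d e.
  by rewrite -mulrN ler_wpM2l.
have : h * (K * r * (K * r * h ^+ 2)) <= K ^+ 2 * r * h ^+ 3.
  rewrite (_ : _ * _ = r * (K ^+ 2 * r * h ^+ 3)); last by ring.
  by rewrite ler_piMl// !mulr_ge0 ?exprn_ge0// (le_trans ler01).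
lra.
Qed.

Lemma incr_le (d e : R[i]) : normc d <= K * r -> normc e <= K * r * h ^+ 2 ->
  normc (h%:C%C * d + e) <= 2 * K * r * h.
Proof.
move=> dK eK; apply: (le_trans (normc_le_add _ _)).
have /andP[r0 r1] := r01; have /andP[h0 h1'] := h01.
have K0 : 0 <= K by apply: le_trans K1.
have Kr : 0 <= K * r by rewrite mulr_ge0.
rewrite Normc.normcM normc_real ger0_norm//.
have : h * normc d <= h * (K * r) by rewrite ler_wpM2l.
have : K * r * h ^+ 2 <= K * r * h by rewrite ler_wpM2l// expr2 ler_piMr.
lra.
Qed.

(** [sqrt_div_ge] along one direction, with A1 - A0 expanded to second order. The linear term is
    left as it stands, since it becomes small only after summation over the four directions. The
    constant 80 is 10 * 8: |A1 - A0| <= 8 K^2 h must be at most A0 / 10. *)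
Lemma direction_ge (f d e : R[i]) (g0 g1 : R) : 
  0 < e2 -> 80 * K ^+ 2 * h <= e2 ->
  0 < g0 -> 0 < g1 -> normc f <= K ->
  normc d <= K * r -> normc e <= K * r * h ^+ 2 ->
  forall (f1 : R[i]) (A0 A1 w0 : R), f1 = f + (h%:C%C * d + e) ->
  A0 = dotc f f + e2 -> A1 = dotc f1 f1 + e2 -> w0 = Num.sqrt A0 / g0 ->
  w0 * (dotc f (h%:C%C * d + e) / A0 + (h ^+ 2 * dotc d d - 2 * K ^+ 2 * r * h ^+ 3) / (2 * A0)
     - 11 / 50 * ((4 * h ^+ 2 * dotc f d ^+ 2 + 60 * K ^+ 4 * r * h ^+ 3) / A0 ^+ 2)
     - (g1 - g0) / g0) <= Num.sqrt A1 / g1 - w0.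
Proof.
move=> e20 he g00 g10 fK dK eK f1 A0 A1 w0 f1E A0E A1E w0E.
have /andP[r0 r1] := r01; have /andP[h0 h1'] := h01.
have K0 : 0 <= K by apply: le_trans K1.
have Kr : 0 <= K * r by rewrite mulr_ge0.
have A0p : 0 < A0 by rewrite A0E ltr_wpDl// dotcc_ge0.
have A1p : 0 <= A1 by rewrite A1E addr_ge0 ?dotcc_ge0// ltW.
have eA : e2 <= A0 by rewrite A0E lerDr dotcc_ge0.
set df := h%:C%C * d + e.
have dA : A1 - A0 = 2 * dotc f df + dotc df df.
  by rewrite A1E A0E f1E -/df !(dotcDl f df) !(dotcDr _ f df) (dotcC df f); ring.
have dfK : normc df <= 2 * K * r * h by exact: incr_le.
have dfdf : dotc df df <= (2 * K * r * h) * (2 * K * r * h) by exact: dotc_le.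
have Krh : K * r * h <= K * h by rewrite ler_wpM2r// ler_piMr.
have KrK2 : K * h <= K ^+ 2 * h by rewrite ler_wpM2r// expr2 ler_peMl.
have Krh0 : 0 <= K * r * h by rewrite mulr_ge0.
have Kh0 : 0 <= K * h by rewrite mulr_ge0.
have bound4 : (2 * K * r * h) * (2 * K * r * h) <= 4 * K ^+ 2 * r * h ^+ 2.
  rewrite (_ : _ * _ = r * (4 * K ^+ 2 * r * h ^+ 2)); last by ring.
  by rewrite ler_piMl// !mulr_ge0 ?exprn_ge0.
have small : `|A1 - A0| <= 10^-1 * A0.
  have hs : 4 * K ^+ 2 * r * h ^+ 2 <= 4 * K ^+ 2 * h.
    rewrite (_ : 4 * K ^+ 2 * r * h ^+ 2 = (4 * K ^+ 2 * h) * (r * h)); last by ring.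
    by rewrite ler_piMr ?mulr_ge0 ?exprn_ge0// mulr_ile1.
  have hk : K * (2 * K * r * h) <= 2 * K ^+ 2 * h.
    rewrite (_ : K * _ = 2 * (K * (K * r * h))); last by ring.
    by rewrite -[leRHS]mulrA ler_pM2l// expr2 -[leRHS]mulrA ler_wpM2l.
  have := dotc_le fK dfK; have := dotc_ge fK dfK; have := dotcc_ge0 df.
  rewrite dA ler_norml => ? ? ?; apply/andP; split; lra.
have H := sqrt_div_ge A0p A1p g00 g10 small; rewrite -w0E in H; apply: le_trans H.
have w00 : 0 <= w0 by rewrite w0E divr_ge0 ?sqrtr_ge0// ltW.
rewrite ler_wpM2l//.
have sq : (A1 - A0) ^+ 2 <= 4 * h ^+ 2 * dotc f d ^+ 2 + 60 * K ^+ 4 * r * h ^+ 3.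
  pose eta := 2 * dotc f e + dotc df df.
  have -> : A1 - A0 = 2 * (h * dotc f d) + eta by rewrite dA /eta /df dotcDr dotcZr; ring.
  have Keta : `|eta| <= 6 * K ^+ 2 * r * h ^+ 2.
    have := dotc_le fK eK; have := dotc_ge fK eK; have := dotcc_ge0 df.
    rewrite /eta ler_norml => ? ? ?; apply/andP; split; first by nra.
    by nra.
  have fd : `|dotc f d| <= K * (K * r) by apply: le_trans (ler_dotc _ _) _; rewrite ler_pM// normc_ge0.
  have cross : dotc f d * eta <= K * (K * r) * (6 * K ^+ 2 * r * h ^+ 2).
    by apply: le_trans (ler_norm _) _; rewrite normrM ler_pM.
  have c1 : h * (dotc f d * eta) <= 6 * K ^+ 4 * r * h ^+ 3.
    apply: le_trans (ler_wpM2l h0 cross) _.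
    rewrite (_ : h * _ = r * (6 * K ^+ 4 * r * h ^+ 3)); last by ring.
    by rewrite ler_piMl// !mulr_ge0 ?exprn_ge0.
  have c2 : eta ^+ 2 <= 36 * K ^+ 4 * r * h ^+ 3.
    apply: (@le_trans _ _ ((6 * K ^+ 2 * r * h ^+ 2) ^+ 2)).
      by rewrite -(real_normK (num_real eta)) ler_pXn2r ?nnegrE ?mulr_ge0 ?exprn_ge0.
    rewrite (_ : _ ^+ 2 = (36 * K ^+ 4 * r * h ^+ 3) * (r * h)); last by ring.
    by rewrite ler_piMr ?mulr_ge0 ?exprn_ge0// mulr_ile1.
  by rewrite sqrrD; lra.
have A02 : 0 < A0 ^+ 2 by rewrite exprn_gt0.
have sq' : ((A1 - A0) / A0) ^+ 2 <= (4 * h ^+ 2 * dotc f d ^+ 2 + 60 * K ^+ 4 * r * h ^+ 3) / A0 ^+ 2.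
  by rewrite expr_div_n ler_pM2r ?invr_gt0.
have lin : dotc f df / A0 + (h ^+ 2 * dotc d d - 2 * K ^+ 2 * r * h ^+ 3) / (2 * A0) <= (A1 - A0) / A0 / 2.
  have := sqr_incr_ge dK eK; rewrite -/df => hh.
  rewrite dA (_ : _ / A0 / 2 = dotc f df / A0 + dotc df df / (2 * A0)); last by field; rewrite gt_eqF.
  by rewrite lerD2l ler_pM2r// invr_gt0 mulr_gt0.
by rewrite [leRHS]addrAC lerB// lerB// ler_wpM2l// divr_ge0.
Qed.

End direction.
End pointwise.

Section four_points.
Variable R : realType.
Local Notation normc := Normc.normc.
Implicit Types (f p phi q : R[i]).

(** [e2] is the square of the regularisation eps; [L] is chosen later so that the denominator is at
    least 1. *)
Definition bellman (e2 L b : R) (f phi : R[i]) (v : R) : R :=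
  Num.sqrt (dotc f f + e2) / (L + v - dotc phi phi) - b * dotc f phi.

Lemma normc_iX (k : nat) p : normc ('i%C ^+ k * p) = normc p.
Proof.
elim: k => [|k IH]; first by rewrite expr0 mul1r.
by rewrite exprS -mulrA Normc.normcM normc_i mul1r.
Qed.

Lemma dotc_iX (k : nat) p q : dotc ('i%C ^+ k * p) ('i%C ^+ k * q) = dotc p q.
Proof.
have H x y : dotc ('i%C * x) ('i%C * y) = dotc x y :> R.
  by case: x => a b; case: y => c d; rewrite /dotc/=; ring.
by elim: k => [|k IH]; rewrite ?expr0 ?mul1r// exprS -!mulrA H.
Qed.

(** [p] and [i p] are orthogonal of equal length, so the squared components of [f] along them add up
    to |f|^2 |p|^2. The total is half of what Cauchy-Schwarz gives term by term; this factor, due to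
    the Cauchy-Riemann equations, is what makes |F|^(1/2) subharmonic. *)
Lemma sum_dotc_iX_sqr f p :
  \sum_(i < 4) dotc f ('i%C ^+ i * p) ^+ 2 = 2 * (dotc f f * dotc p p).
Proof.
rewrite !big_ord_recl big_ord0 /= addr0 /bump/= !exprS expr0 !mulr1 mul1r.
by case: f => a b; case: p => c d; rewrite /dotc/=; ring.
Qed.

Lemma sum_iX p : \sum_(i < 4) 'i%C ^+ i * p = 0.
Proof.
rewrite !big_ord_recl big_ord0 /= addr0 /bump/= !exprS expr0 !mulr1 mul1r.
by case: p => c d; apply/eqP; rewrite eq_complex/=; apply/andP; split; apply/eqP; ring.
Qed.

Lemma dotc_suml (I : Type) (s : seq I) (P : pred I) (F : I -> R[i]) p :
  dotc (\sum_(i <- s | P i) F i) p = \sum_(i <- s | P i) dotc (F i) p.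
Proof.
elim/big_rec2: _ => [|i y1 y2 _ <-]; last by rewrite dotcDl.
by rewrite /dotc/= !mul0r addr0.
Qed.

Lemma dotc_sumr (I : Type) (s : seq I) (P : pred I) (F : I -> R[i]) p :
  dotc p (\sum_(i <- s | P i) F i) = \sum_(i <- s | P i) dotc p (F i).
Proof. by rewrite dotcC dotc_suml; apply: eq_bigr => i _; rewrite dotcC. Qed.

(** [p] and [q] are the complex derivatives of F and Phi, so the four directions multiply them by
    the powers of i and the first-order terms cancel up to the sums of [e], [e'] and [dv], of order
    r h^3. The second-order terms are a quadratic form in (p, q), nonnegative for this value of
    [b]. *)
Lemma four_points (K r h e2 L gm b : R) (f p phi q : R[i]) (v : R)
    (e e' : 'I_4 -> R[i]) (dv : 'I_4 -> R) :
  1 <= K -> 0 <= r <= 1 -> 0 <= h <= 1 -> 0 < e2 -> e2 <= 1 ->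
  80 * K ^+ 2 * h <= e2 ->
  normc f <= K -> normc phi <= K -> normc p <= K * r -> normc q <= K * r ->
  (forall i, normc (e i) <= K * r * h ^+ 2) ->
  (forall i, normc (e' i) <= K * r * h ^+ 2) ->
  normc (\sum_i e i) <= K * r * h ^+ 3 ->
  normc (\sum_i e' i) <= K * r * h ^+ 3 ->
  \sum_i dv i <= K * r * h ^+ 3 ->
  b = 2 / 5 / gm ^+ 2 ->
  let df (i : 'I_4) := h%:C%C * ('i%C ^+ (i : nat) * p) + e i in
  let dphi (i : 'I_4) := h%:C%C * ('i%C ^+ (i : nat) * q) + e' i in
  1 <= L + v - dotc phi phi <= gm ->
  (forall i, 1 <= L + (v + dv i) - dotc (phi + dphi i) (phi + dphi i)) ->
  - (150 * K ^+ 5 * r * h ^+ 3 / e2 ^+ 2) <=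
  \sum_(i < 4) (bellman e2 L b (f + df i) (phi + dphi i) (v + dv i) -
    bellman e2 L b f phi v).
Proof.
move=> K1 r01 h01 e20 e21 he fK phiK pK qK eK eK' seK seK' sdv bE df dphi /andP[g1 gm0] gi.
set g0 := L + v - dotc phi phi in g1 gm0.
have /andP[r0 r1] := r01; have /andP[h0 h1] := h01.
have K0 : 0 <= K by apply: le_trans K1.
have g00 : 0 < g0 by apply: lt_le_trans g1.
have gmp : 1 <= gm by apply: le_trans gm0.
pose gg i := L + (v + dv i) - dotc (phi + dphi i) (phi + dphi i).
pose A0 := dotc f f + e2.
pose w0 := Num.sqrt A0 / g0.
have pi_ (i : 'I_4) : normc ('i%C ^+ i * p) <= K * r by rewrite normc_iX.
have qi_ (i : 'I_4) : normc ('i%C ^+ i * q) <= K * r by rewrite normc_iX.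
have krh3 : 0 <= r * h ^+ 3 by rewrite mulr_ge0 ?exprn_ge0.
set Z := r * h ^+ 3 in krh3.
have sdf : \sum_i df i = \sum_i e i.
  by rewrite big_split/= -mulr_sumr sum_iX mulr0 add0r.
have sdphi : \sum_i dphi i = \sum_i e' i.
  by rewrite big_split/= -mulr_sumr sum_iX mulr0 add0r.
pose D (i : 'I_4) := w0 * (dotc f (df i) / A0 + (h ^+ 2 * dotc p p - 2 * K ^+ 2 * r * h ^+ 3) / (2 * A0)
     - 11 / 50 * ((4 * h ^+ 2 * dotc f ('i%C ^+ i * p) ^+ 2 + 60 * K ^+ 4 * r * h ^+ 3) / A0 ^+ 2)
     - (gg i - g0) / g0).
have HD i : D i <= Num.sqrt (dotc (f + df i) (f + df i) + e2) / gg i - w0.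
  have gi0 : 0 < gg i by apply: lt_le_trans (gi i).
  have := direction_ge K1 r01 h01 e20 he g00 gi0 fK (pi_ i) (eK i)
    (erefl _) (erefl _) (erefl _) (erefl _).
  by rewrite dotc_iX.
have A0p : 0 < A0 by rewrite ltr_wpDl// dotcc_ge0.
have eA : e2 <= A0 by rewrite lerDr dotcc_ge0.
have s0p : 0 < Num.sqrt A0 by rewrite sqrtr_gt0.
have s0A : Num.sqrt A0 ^+ 2 = A0 by rewrite sqr_sqrtr// ltW.
have w0p : 0 <= w0 by rewrite divr_ge0// ltW.
have sumD : \sum_i D i = w0 * (dotc f (\sum_i df i) / A0
    + 2 * (h ^+ 2 * dotc p p - 2 * K ^+ 2 * r * h ^+ 3) / A0
    - 11 / 50 * ((8 * h ^+ 2 * (dotc f f * dotc p p) + 240 * K ^+ 4 * r * h ^+ 3) / A0 ^+ 2)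
    - (\sum_i (gg i - g0)) / g0).
  rewrite -mulr_sumr; congr (_ * _).
  rewrite dotc_sumr sumrB sumrB big_split/= -!mulr_suml -mulr_sumr; congr (_ + _ - _ * _ - _).
    by rewrite sumr_const card_ord -mulr_natl; field; rewrite gt_eqF.
  rewrite -mulr_suml big_split/= -mulr_sumr sum_dotc_iX_sqr sumr_const card_ord -mulr_natl.
  by congr (_ / _); ring.
have b1 : - (K ^+ 2 * Z) <= dotc f (\sum_i df i).
  rewrite sdf; have := dotc_ge fK seK; rewrite /Z; apply: le_trans; rewrite lerN2.
  by rewrite le_eqVlt; apply/orP; left; apply/eqP; ring.
have b2 : \sum_i (gg i - g0) <= 11 * K ^+ 2 * Z - 4 * h ^+ 2 * dotc q q.
  have e1 i : gg i - g0 = dv i - (2 * dotc phi (dphi i) + dotc (dphi i) (dphi i)).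
    by rewrite /gg /g0 !(dotcDl phi) !(dotcDr _ phi) (dotcC (dphi i) phi); ring.
  have e2' : \sum_(i < 4) dotc (dphi i) (dphi i) >= 4 * (h ^+ 2 * dotc q q - 2 * K ^+ 2 * r * h ^+ 3).
    rewrite (_ : 4 * _ = \sum_(i < 4) (h ^+ 2 * dotc q q - 2 * K ^+ 2 * r * h ^+ 3)); last first.
      by rewrite sumr_const card_ord mulr_natl.
    apply: ler_sum => i _; rewrite -(dotc_iX i q q).
    exact: (sqr_incr_ge K1 r01 h01 (qi_ i) (eK' i)).
  rewrite (eq_bigr _ (fun i _ => e1 i)) sumrB big_split/= -mulr_sumr -dotc_sumr sdphi.
  have h3 := dotc_ge phiK seK'.
  have h4 : K * r * h ^+ 3 <= K ^+ 2 * Z.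
    by rewrite -mulrA ler_wpM2r// expr2 ler_peMl.
  have h5 : K * (K * r * h ^+ 3) = K ^+ 2 * Z by rewrite /Z; ring.
  have h6 : 2 * K ^+ 2 * r * h ^+ 3 = 2 * (K ^+ 2 * Z) by rewrite /Z; ring.
  rewrite h5 in h3; rewrite h6 in e2'; lra.
have K4Z : 0 <= K ^+ 4 * Z by rewrite mulr_ge0 ?exprn_ge0.
pose E := K ^+ 4 * Z / e2 ^+ 2.
have E0 : 0 <= E by rewrite divr_ge0 ?exprn_ge0// ltW.
have e2V : 1 <= e2^-1 by rewrite invf_ge1.
have ZE : K ^+ 2 * Z <= E * e2.
  rewrite /E (_ : _ * e2 = K ^+ 2 * Z * (K ^+ 2 * e2^-1)); last by field; rewrite gt_eqF.
  rewrite ler_peMr ?mulr_ge0 ?exprn_ge0//.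
  by rewrite -[1]mulr1 ler_pM// exprn_ege1.
have ZE1 : K ^+ 2 * Z <= E by apply: (le_trans ZE); rewrite ler_piMr.
(* 6/25 = 2 - 8 * (11/50): the gain 2 h^2 |p|^2 / A0 minus the loss from the squares, bounded with
   |f|^2 <= A0. *)
have bracket : 6 / 25 * (h ^+ 2 * dotc p p) / A0 + 4 * (h ^+ 2 * dotc q q) / g0 - 70 * E <=
    dotc f (\sum_i df i) / A0
    + 2 * (h ^+ 2 * dotc p p - 2 * K ^+ 2 * r * h ^+ 3) / A0
    - 11 / 50 * ((8 * h ^+ 2 * (dotc f f * dotc p p) + 240 * K ^+ 4 * r * h ^+ 3) / A0 ^+ 2)
    - (\sum_i (gg i - g0)) / g0.
  have c1 : - E <= dotc f (\sum_i df i) / A0.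
    rewrite ler_pdivlMr// mulNr; apply: le_trans b1; rewrite lerN2 (le_trans ZE)//.
    by rewrite ler_wpM2l.
  have c2 : 4 * K ^+ 2 * Z / A0 <= 4 * E.
    by rewrite ler_pdivrMr// -(mulrA 4 (K ^+ 2)) -(mulrA 4 E) ler_pM2l// (le_trans ZE)// ler_wpM2l.
  have c3 : 240 * K ^+ 4 * Z / A0 ^+ 2 <= 240 * E.
    rewrite -(mulrA 240 (K ^+ 4)) -(mulrA 240); apply: (ler_wpM2l (ler0n _ _)).
    rewrite /E; apply: (ler_wpM2l K4Z).
    by rewrite lef_pV2 ?posrE ?exprn_gt0// ler_pXn2r ?nnegrE ?(ltW e20) ?(ltW A0p).
  have c4 : 8 * h ^+ 2 * (dotc f f * dotc p p) / A0 ^+ 2 <= 8 * (h ^+ 2 * dotc p p) / A0.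
    rewrite (_ : 8 * (h ^+ 2 * dotc p p) / A0 = 8 * h ^+ 2 * (A0 * dotc p p) / A0 ^+ 2); last first.
      by field; rewrite gt_eqF.
    rewrite ler_pM2r ?invr_gt0 ?exprn_gt0// ler_wpM2l ?mulr_ge0 ?exprn_ge0//.
    by rewrite ler_wpM2r ?dotcc_ge0// lerDl ltW.
  have c5 : (\sum_i (gg i - g0)) / g0 <= 11 * E - 4 * (h ^+ 2 * dotc q q) / g0.
    apply: (@le_trans _ _ ((11 * K ^+ 2 * Z - 4 * h ^+ 2 * dotc q q) / g0)).
      by rewrite ler_pM2r ?invr_gt0.
    rewrite mulrBl lerB//; last by rewrite -!mulrA.
    rewrite -(mulrA 11 (K ^+ 2)) -(mulrA 11) ler_pM2l// ler_pdivrMr//.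
    by rewrite (le_trans ZE1)// ler_peMr.
  have -> : 2 * (h ^+ 2 * dotc p p - 2 * K ^+ 2 * r * h ^+ 3) / A0 =
      2 * (h ^+ 2 * dotc p p / A0) - 4 * K ^+ 2 * Z / A0 by rewrite /Z; ring.
  have -> : (8 * h ^+ 2 * (dotc f f * dotc p p) + 240 * K ^+ 4 * r * h ^+ 3) / A0 ^+ 2 =
     8 * h ^+ 2 * (dotc f f * dotc p p) / A0 ^+ 2 + 240 * K ^+ 4 * Z / A0 ^+ 2.
    by rewrite /Z; ring.
  have := c4; rewrite -[8 * (h ^+ 2 * dotc p p) / A0]mulrA -[6 / 25 * (h ^+ 2 * dotc p p) / A0]mulrA.
  have : 0 <= h ^+ 2 * dotc p p / A0 by rewrite divr_ge0 ?mulr_ge0 ?exprn_ge0 ?dotcc_ge0// ltW.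
  move: c1 c2 c3 c5.
  move: (h ^+ 2 * dotc p p / A0) (4 * K ^+ 2 * Z / A0) (8 * h ^+ 2 * (dotc f f * dotc p p) / A0 ^+ 2)
    (240 * K ^+ 4 * Z / A0 ^+ 2) (dotc f (\sum_i df i) / A0) (_ / g0) (_ / g0) => x1 x2 x3 x4 x5 x6 x7.
  lra.
have w02K : w0 <= 2 * K.
  apply: (@le_trans _ _ (Num.sqrt A0)).
    by rewrite ler_pdivrMr// ler_peMr// ltW.
  have K20 : 0 <= 2 * K by rewrite mulr_ge0.
  rewrite -(@ler_pXn2r _ 2) ?nnegrE ?(ltW s0p)// s0A.
  have : dotc f f <= K * K by exact: dotc_le.
  have : 1 <= K * K by rewrite -[1]mulr1 ler_pM.
  by rewrite /A0; lra.
have main : 4 * b * (h ^+ 2 * dotc p q) <=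
    w0 * (6 / 25 * (h ^+ 2 * dotc p p) / A0 + 4 * (h ^+ 2 * dotc q q) / g0).
  set s0 := Num.sqrt A0 in s0p s0A.
  have -> : w0 * (6 / 25 * (h ^+ 2 * dotc p p) / A0 + 4 * (h ^+ 2 * dotc q q) / g0) =
     h ^+ 2 * (6 / 25 * dotc p p / (s0 * g0) + 4 * s0 * dotc q q / g0 ^+ 2).
    by rewrite /w0 -/s0 -s0A; field; rewrite !gt_eqF.
  rewrite mulrCA ler_wpM2l ?exprn_ge0//.
  (* Expand the square of (2/5) p - 2 s0 q and use 4/25 <= 6/25. The factor 8/5 is 4 b gm^2; the
     powers of 1 / g0 are then bounded below by gm^-2, since 1 <= g0 <= gm. *)
  have key : 8 / 5 * dotc p q <= 6 / 25 * dotc p p / s0 + 4 * s0 * dotc q q.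
    rewrite -(ler_pM2l s0p) (_ : s0 * (_ + _) = 6 / 25 * dotc p p + 4 * s0 ^+ 2 * dotc q q); last first.
      by field; rewrite gt_eqF.
    have : 0 <= dotc ((2 / 5)%:C%C * p - (2 * s0)%:C%C * q) ((2 / 5)%:C%C * p - (2 * s0)%:C%C * q).
      exact: dotcc_ge0.
    rewrite -mulNr -rmorphN !(dotcDl, dotcDr, dotcZl, dotcZr) (dotcC q p).
    have := dotcc_ge0 p; nra.
  apply: (@le_trans _ _ (gm^-1 ^+ 2 * (6 / 25 * dotc p p / s0 + 4 * s0 * dotc q q))).
    rewrite bE (_ : 4 * _ * _ = gm^-1 ^+ 2 * (8 / 5 * dotc p q)); last by field; rewrite gt_eqF// (lt_le_trans ltr01).
    by rewrite ler_wpM2l// exprn_ge0// invr_ge0 (le_trans ler01).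
  have gmg : gm^-1 <= g0^-1 by rewrite lef_pV2 ?posrE// (lt_le_trans ltr01).
  have g0i : g0^-1 <= 1 by rewrite invf_le1.
  have gmi0 : 0 <= gm^-1 by rewrite invr_ge0 (le_trans ler01).
  rewrite mulrDr lerD//.
    have -> : 6 / 25 * dotc p p / (s0 * g0) = g0^-1 * (6 / 25 * dotc p p / s0) by rewrite invfM; ring.
    rewrite ler_wpM2r ?divr_ge0 ?mulr_ge0 ?dotcc_ge0 ?(ltW s0p)//.
    by rewrite expr2 -[leRHS]mulr1 ler_pM// (le_trans gmg).
  rewrite mulrC -exprVn ler_wpM2l ?mulr_ge0 ?dotcc_ge0 ?(ltW s0p)//.
  by rewrite ler_pXn2r ?nnegrE// invr_ge0 ltW.
have gm2 : 1 <= gm ^+ 2 by exact: exprn_ege1.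
have gm20 : 0 < gm ^+ 2 by apply: lt_le_trans gm2.
have b0 : 0 <= b by rewrite bE divr_ge0// ltW.
have b25 : b <= 2 / 5 by rewrite bE ler_pdivrMr// ler_peMr.
have sdot : \sum_i (dotc (f + df i) (phi + dphi i) - dotc f phi) <=
    4 * (h ^+ 2 * dotc p q) + 14 * K ^+ 2 * Z.
  have e1 i : dotc (f + df i) (phi + dphi i) - dotc f phi =
    dotc f (dphi i) + dotc (df i) phi + dotc (df i) (dphi i).
    by rewrite !(dotcDl f) !(dotcDr _ phi); ring.
  rewrite (eq_bigr _ (fun i _ => e1 i)) big_split [X in X + _ <= _]big_split/= -dotc_sumr -dotc_suml sdf sdphi.
  have h1' := dotc_le fK seK'; have h2' := dotc_le seK phiK.
  have h3' (i : 'I_4) : dotc (df i) (dphi i) <= h ^+ 2 * dotc p q + 3 * K ^+ 2 * Z.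
    rewrite /df /dphi !dotcDl !dotcDr !dotcZl !dotcZr dotc_iX.
    have k1 := dotc_le (pi_ i) (eK' i).
    have k2 := dotc_le (eK i) (qi_ i).
    have k3 := dotc_le (eK i) (eK' i).
    have rZ : K ^+ 2 * (r * Z) <= K ^+ 2 * Z by rewrite ler_wpM2l ?exprn_ge0// ler_piMl.
    have k1' := ler_wpM2l h0 k1; have k2' := ler_wpM2l h0 k2.
    have k3' : K * r * h ^+ 2 * (K * r * h ^+ 2) <= K ^+ 2 * Z.
      rewrite (_ : _ * _ = K ^+ 2 * (r * Z) * h); last by rewrite /Z; ring.
      apply: le_trans rZ; rewrite ler_piMr// mulr_ge0 ?exprn_ge0// mulr_ge0//.
    have k1'' : h * (K * r * (K * r * h ^+ 2)) = K ^+ 2 * (r * Z) by rewrite /Z; ring.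
    have k2'' : h * (K * r * h ^+ 2 * (K * r)) = K ^+ 2 * (r * Z) by rewrite /Z; ring.
    rewrite k1'' in k1'; rewrite k2'' in k2'; lra.
  have : \sum_(i < 4) dotc (df i) (dphi i) <= 4 * (h ^+ 2 * dotc p q + 3 * K ^+ 2 * Z).
    apply: le_trans (ler_sum _ (fun i _ => h3' i)) _.
    by rewrite sumr_const card_ord -[leLHS]mulr_natl.
  have k4 : K * (K * r * h ^+ 3) = K ^+ 2 * Z by rewrite /Z; ring.
  have k5 : K * r * h ^+ 3 * K = K ^+ 2 * Z by rewrite /Z; ring.
  rewrite k4 in h1'; rewrite k5 in h2'; lra.
rewrite (eq_bigr (fun i => (Num.sqrt (dotc (f + df i) (f + df i) + e2) / gg i - w0) -
    b * (dotc (f + df i) (phi + dphi i) - dotc f phi))); last first.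
  by move=> i _; rewrite /bellman -/(gg i) -/g0 -/A0 -/w0; ring.
rewrite sumrB -mulr_sumr.
have t1 : \sum_i D i <= \sum_(i < 4) (Num.sqrt (dotc (f + df i) (f + df i) + e2) / gg i - w0).
  by apply: ler_sum => i _; exact: HD.
have t2 := ler_wpM2l b0 sdot.
have t3 := ler_wpM2l w0p bracket; rewrite -sumD mulrBr in t3.
have t4 : w0 * (70 * E) <= 2 * K * (70 * E) by rewrite ler_wpM2r// mulr_ge0.
have t5 : b * (14 * K ^+ 2 * Z) <= 2 / 5 * (14 * E).
  rewrite ler_pM ?mulr_ge0 ?exprn_ge0// -mulrA ler_pM2l//.
have t6 : E <= K * E by rewrite ler_peMl.
have -> : 150 * K ^+ 5 * r * h ^+ 3 / e2 ^+ 2 = 150 * (K * E) by rewrite /E /Z; ring.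
rewrite (_ : b * (_ + _) = 4 * b * (h ^+ 2 * dotc p q) + b * (14 * K ^+ 2 * Z)) in t2; last by ring.
move: main t1 t2 t3 t4 t5 t6.
rewrite (_ : 2 * K * (70 * E) = 140 * (K * E)); last by ring.
move: (\sum_(i < 4) (Num.sqrt _ / _ - _)) (\sum_i D i) (b * \sum_(i < 4) _) (w0 * (_ + _)) (w0 * (70 * E))
  (b * (14 * K ^+ 2 * Z)) (4 * b * _) => x1 x2 x3 x4 x5 x6 x7.
lra.
Qed.

End four_points.

(** * Increments of polynomials at the star points *)

Section increments.
Variable R : realType.
Local Notation C := R[i].
Local Notation normc := Normc.normc.

Lemma eq_complexP (x y : C) :
  complex.Re x = complex.Re y -> complex.Im x = complex.Im y -> x = y.
Proof. by case: x => a b; case: y => c d /= -> ->. Qed.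

Lemma normc_sum (I : Type) (s : seq I) (P : pred I) (F : I -> C) :
  normc (\sum_(i <- s | P i) F i) <= \sum_(i <- s | P i) normc (F i).
Proof.
elim/big_rec2: _ => [|i x y _ h]; first by rewrite Normc.normc0.
by apply: le_trans (normc_le_add _ _) _; rewrite lerD2l.
Qed.

Lemma normc_natr (m : nat) : normc (m%:R : C) = m%:R.
Proof. by rewrite normcMn Normc.normc1. Qed.

Lemma normcX (z : C) (m : nat) : normc (z ^+ m) = normc z ^+ m.
Proof.
elim: m => [|m IH]; first by rewrite !expr0 Normc.normc1.
by rewrite !exprS Normc.normcM IH.
Qed.

Lemma leq_bin2_expn4 m : ('C(m, 2) <= 4 ^ m)%N.
Proof.
elim: m => // m IH; rewrite binS bin1 expnS.
have := ltn_expl m (isT : 1 < 4)%N; lia.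
Qed.

(** Only the exponent of [normc e] matters: finitely many degrees [m] occur, and 4^m is absorbed by
    the constant [K]. *)
Lemma expr_1D_taylor2 (e : C) (m : nat) : normc e <= 1 ->
  normc ((1 + e) ^+ m - 1 - m%:R * e - 'C(m, 2)%:R * e ^+ 2) <=
  4 ^+ m * normc e ^+ 3.
Proof.
move=> e1; elim: m => [|m IH].
  rewrite expr0 subrr bin_small// !mul0r !subr0 Normc.normc0.
  by rewrite mulr_ge0 ?exprn_ge0 ?normc_ge0.
have -> : (1 + e) ^+ m.+1 - 1 - m.+1%:R * e - 'C(m.+1, 2)%:R * e ^+ 2 =
   (1 + e) * ((1 + e) ^+ m - 1 - m%:R * e - 'C(m, 2)%:R * e ^+ 2) + 'C(m, 2)%:R * e ^+ 3.
  by rewrite exprS binS bin1 natrD -(natr1 m); ring.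
apply: le_trans (normc_le_add _ _) _.
rewrite Normc.normcM (Normc.normcM _ (e ^+ 3)) normc_natr normcX.
have h1 : normc (1 + e) <= 2.
  by apply: le_trans (normc_le_add _ _) _; rewrite Normc.normc1; lra.
have h2 : 'C(m, 2)%:R <= 4 ^+ m :> R by rewrite -natrX ler_nat leq_bin2_expn4.
have h3 : 'C(m, 2)%:R * normc e ^+ 3 <= 4 ^+ m * normc e ^+ 3.
  by rewrite ler_wpM2r// exprn_ge0// normc_ge0.
have h4 := ler_pM (normc_ge0 _) (normc_ge0 _) h1 IH.
have : 0 <= 4 ^+ m * normc e ^+ 3 by rewrite mulr_ge0 ?exprn_ge0 ?normc_ge0.
rewrite (exprS 4) -[4 * _ * _]mulrA; lra.
Qed.

(* Two dilations and two rotations, chosen so that the sums of the [z_i - 1] and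
   of the [(z_i - 1) ^+ 2] are both [O(h ^+ 3)]: they discretize a Laplacian. *)
Definition star_point (h : R) (i : 'I_4) : C :=
  [:: ((1 + h)%:C)%C; (Num.sqrt (1 - h ^+ 2) +i* h)%C;
      ((1 + h)^-1%:C)%C; (Num.sqrt (1 - h ^+ 2) -i* h)%C]`_i.

Section star.
Variable h : R.
Hypotheses (hge0 : 0 <= h) (hle2V : h <= 2^-1).

Let s : R := Num.sqrt (1 - h ^+ 2).

Let sbound : 1 - h ^+ 2 <= s <= 1.
Proof.
have a0 := hge0; have a1 := hle2V.
have h2 : 0 <= h ^+ 2 by rewrite sqr_ge0.
have h21 : h ^+ 2 <= 1 by rewrite expr_le1//; lra.
have s1 : s <= 1.
  by rewrite -sqrtr1 ler_wsqrtr// lerBlDr lerDl.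
rewrite s1 andbT.
have -> : 1 - h ^+ 2 = s * s by rewrite -expr2 sqr_sqrtr// subr_ge0.
by rewrite ler_piMl// sqrtr_ge0.
Qed.

Let ssqr : s ^+ 2 = 1 - h ^+ 2.
Proof.
have a0 := hge0; have a1 := hle2V. by rewrite sqr_sqrtr// subr_ge0 expr_le1//; lra. Qed.

Let t := (1 + h)^-1.

Let tE : t = 1 - h + h ^+ 2 * t.
Proof.
have a0 := hge0; have a1 := hle2V. by rewrite /t; field; lra. Qed.

Let t01 : 0 <= t <= 1.
Proof.
have a0 := hge0; have a1 := hle2V. by rewrite invr_ge0 invf_le1; lra. Qed.

Lemma star_point_dist (i : 'I_4) :
  normc (star_point h i - 1 - h%:C%C * 'i%C ^+ i) <= h ^+ 2.
Proof.
have a0 := hge0; have a1 := hle2V.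
have /andP[s1 s2] := sbound; have /andP[t0 t1] := t01.
have H2 : 0 <= h ^+ 2 by rewrite sqr_ge0.
suff [w -> hw] : exists2 w : R,
    star_point h i - 1 - h%:C%C * 'i%C ^+ i = w%:C%C & `|w| <= h ^+ 2 by rewrite normc_real.
case: i => -[|[|[|[|//]]]] ?; [exists 0|exists (s - 1)|exists (h ^+ 2 * t)|exists (s - 1)].
- by apply: eq_complexP; rewrite /=; ring.
- by rewrite normr0.
- by apply: eq_complexP; rewrite /= -/s; ring.
- by rewrite ler_norml; apply/andP; split; lra.
- by apply: eq_complexP; rewrite /= /t; [field; lra|ring].
- by rewrite ger0_norm ?mulr_ge0// ler_piMr.
- by apply: eq_complexP; rewrite /= -/s; ring.
- by rewrite ler_norml; apply/andP; split; lra.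
Qed.

Lemma star_point_dist1 (i : 'I_4) : normc (star_point h i - 1) <= 2 * h.
Proof.
have a0 := hge0; have a1 := hle2V.
rewrite -(subrK (h%:C%C * 'i%C ^+ i) (_ - 1)).
apply: le_trans (normc_le_add _ _) _.
have -> : normc (h%:C%C * 'i%C ^+ i) = h.
  by rewrite Normc.normcM normc_real normcX normc_i expr1n mulr1 ger0_norm//; lra.
have := star_point_dist i.
have : h ^+ 2 <= h by rewrite expr2 ler_piMr//; lra.
lra.
Qed.

(** The dilations contribute h + (t - 1) = h^2 t with t = 1 / (1 + h), the rotations -2 (1 - s) =
    -h^2 - (1 - s)^2, so the terms in h^2 cancel. With 1 - h in place of 1 / (1 + h) they would
    not. *)
Lemma star_point_sum : normc (\sum_i (star_point h i - 1)) <= 4 * h ^+ 3.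
Proof.
have a0 := hge0; have a1 := hle2V.
have /andP[s1 s2] := sbound; have /andP[t0 t1] := t01.
have H2 : 0 <= h ^+ 2 by rewrite sqr_ge0.
have H3 : 0 <= h ^+ 3 by rewrite exprn_ge0//; lra.
rewrite (_ : \sum_i _ = (h ^+ 2 * t - 2 * (1 - s))%:C%C); last first.
  rewrite !big_ord_recl big_ord0; apply: eq_complexP; rewrite /star_point/= /bump/= -/s; last by ring.
  by rewrite /t; field; lra.
have sE : (1 - s) * (1 + s) = h ^+ 2.
  by rewrite (_ : _ * _ = 1 - s ^+ 2); [rewrite ssqr; ring|ring].
have H4 : h ^+ 2 * h ^+ 2 <= h ^+ 3.
  rewrite -exprD; have -> : h ^+ 4 = h * h ^+ 3 by rewrite -exprS.
  by rewrite ler_piMl//; lra.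
have u1 : h ^+ 2 * t = h ^+ 2 - h ^+ 3 + h ^+ 2 * h ^+ 2 * t by rewrite {1}tE; ring.
have u2 : h ^+ 2 * h ^+ 2 * t <= h ^+ 2 * h ^+ 2 by rewrite ler_piMr// mulr_ge0.
have u2' : 0 <= h ^+ 2 * h ^+ 2 * t by rewrite !mulr_ge0.
have u3 : (1 - s) * (1 - s) <= h ^+ 2 * h ^+ 2 by rewrite ler_pM//; lra.
have u3' : 0 <= (1 - s) * (1 - s) by rewrite mulr_ge0; lra.
have u4 : 2 * (1 - s) = h ^+ 2 + (1 - s) * (1 - s) by rewrite -sE; ring.
rewrite normc_real u1 u4 ler_norml; apply/andP; split; lra.
Qed.

Lemma star_point_sum_sqr : normc (\sum_i (star_point h i - 1) ^+ 2) <= 6 * h ^+ 3.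
Proof.
have a0 := hge0; have a1 := hle2V.
have /andP[s1 s2] := sbound; have /andP[t0 t1] := t01.
have H2 : 0 <= h ^+ 2 by rewrite sqr_ge0.
have H3 : 0 <= h ^+ 3 by rewrite exprn_ge0//; lra.
rewrite (_ : \sum_i _ = (h ^+ 2 + (h * t) ^+ 2 + 2 * ((1 - s) ^+ 2 - h ^+ 2))%:C%C); last first.
  rewrite !big_ord_recl big_ord0; apply: eq_complexP; rewrite /star_point/= /bump/= -/s; last by ring.
  by rewrite /t; field; lra.
have u3 : (1 - s) * (1 - s) <= h ^+ 2 * h ^+ 2 by rewrite ler_pM//; lra.
have u3' : 0 <= (1 - s) * (1 - s) by rewrite mulr_ge0; lra.
have H4 : h ^+ 2 * h ^+ 2 <= h ^+ 3.
  rewrite -exprD; have -> : h ^+ 4 = h * h ^+ 3 by rewrite -exprS.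
  by rewrite ler_piMl//; lra.
have v1 : (h * t) ^+ 2 = h ^+ 2 * t ^+ 2 by rewrite exprMn.
have v2 : 1 - t = h * t by rewrite /t; field; lra.
have v3 : h ^+ 2 - h ^+ 2 * t ^+ 2 = h ^+ 3 * (t * (1 + t)).
  by rewrite (_ : _ - _ = h ^+ 2 * ((1 - t) * (1 + t))); [rewrite v2; ring|ring].
have v4 : 0 <= h ^+ 3 * (t * (1 + t)) by rewrite !mulr_ge0// addr_ge0.
have v5 : h ^+ 3 * (t * (1 + t)) <= h ^+ 3 * 2 by rewrite ler_wpM2l//; nra.
rewrite normc_real v1 ler_norml expr2; apply/andP; split; lra.
Qed.

Lemma star_monomial_incr (m : nat) (i : 'I_4) :
  normc (star_point h i ^+ m - 1 - h%:C%C * ('i%C ^+ i * m%:R)) <= 42 * 4 ^+ m * h ^+ 2.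
Proof.
have a0 := hge0; have a1 := hle2V.
set e := star_point h i - 1.
have zE : star_point h i = 1 + e by rewrite /e addrC subrK.
have he : normc e <= 2 * h by exact: star_point_dist1.
have T := @expr_1D_taylor2 e m; rewrite -zE in T.
have -> : star_point h i ^+ m - 1 - h%:C%C * ('i%C ^+ i * m%:R) =
  (star_point h i ^+ m - 1 - m%:R * e - 'C(m, 2)%:R * e ^+ 2)
  + (m%:R * (e - h%:C%C * 'i%C ^+ i) + 'C(m, 2)%:R * e ^+ 2) by ring.
have P4 : 0 <= 4 ^+ m :> R by rewrite exprn_ge0.
have h1 : 'C(m, 2)%:R <= 4 ^+ m :> R by rewrite -natrX ler_nat leq_bin2_expn4.
have h2 : m%:R <= 4 ^+ m :> R by rewrite -natrX ler_nat ltnW// ltn_expl.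
have H2 : 0 <= h ^+ 2 by rewrite sqr_ge0.
have e2 : normc e ^+ 2 <= 4 * h ^+ 2.
  rewrite (_ : 4 * h ^+ 2 = (2 * h) ^+ 2); last by ring.
  by rewrite ler_pXn2r ?nnegrE ?normc_ge0//; lra.
have e3 : normc e ^+ 3 <= 4 * h ^+ 2.
  by rewrite exprSr (le_trans _ e2)// ler_piMr ?exprn_ge0 ?normc_ge0//; lra.
apply: le_trans (normc_le_add _ _) _.
have B2 := normc_le_add (m%:R * (e - h%:C%C * 'i%C ^+ i)) ('C(m, 2)%:R * e ^+ 2).
move: B2; rewrite (Normc.normcM m%:R) (Normc.normcM _ (e ^+ 2)) !normc_natr normcX => B2.
have k1 := ler_pM (ler0n _ m) (normc_ge0 _) h2 (star_point_dist i).
have k2 := ler_pM (ler0n _ _) (exprn_ge0 2 (normc_ge0 e)) h1 e2.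
have k3 := ler_pM P4 (exprn_ge0 3 (normc_ge0 e)) (lexx (4 ^+ m)) e3.
have T1 := T ltac:(lra).
have X0 : 0 <= 4 ^+ m * h ^+ 2 by rewrite mulr_ge0.
rewrite -/e in k1.
rewrite -(mulrA 42); rewrite !(mulrCA (4 ^+ m) 4) in k2 k3; lra.
Qed.

(** An approximate mean value property of z^m. In the second-order Taylor formula the linear and
    quadratic terms are controlled by the two sums above, and 42 = 32 + 4 + 6, where 32 = 4 * 8
    comes from the four remainders. *)
Lemma star_monomial_sum (m : nat) :
  normc (\sum_i (star_point h i ^+ m - 1)) <= 42 * 4 ^+ m * h ^+ 3.
Proof.
have a0 := hge0; have a1 := hle2V.
pose e i := star_point h i - 1.
have zE i : star_point h i = 1 + e i by rewrite /e addrC subrK.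
have he i : normc (e i) <= 2 * h by exact: star_point_dist1.
have T i := @expr_1D_taylor2 (e i) m.
have -> : \sum_i (star_point h i ^+ m - 1) =
  \sum_i (star_point h i ^+ m - 1 - m%:R * e i - 'C(m, 2)%:R * e i ^+ 2)
  + (m%:R * (\sum_i e i) + 'C(m, 2)%:R * (\sum_i e i ^+ 2)).
  by rewrite !mulr_sumr -!big_split/=; apply: eq_bigr => i _; ring.
have P4 : 0 <= 4 ^+ m :> R by rewrite exprn_ge0.
have h1 : 'C(m, 2)%:R <= 4 ^+ m :> R by rewrite -natrX ler_nat leq_bin2_expn4.
have h2 : m%:R <= 4 ^+ m :> R by rewrite -natrX ler_nat ltnW// ltn_expl.
have e3 i : normc (e i) ^+ 3 <= 8 * h ^+ 3.
  rewrite (_ : 8 * h ^+ 3 = (2 * h) ^+ 3); last by ring.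
  by rewrite ler_pXn2r ?nnegrE ?normc_ge0//; lra.
apply: le_trans (normc_le_add _ _) _.
have B2 := normc_le_add (m%:R * (\sum_i e i)) ('C(m, 2)%:R * (\sum_i e i ^+ 2)).
move: B2; rewrite (Normc.normcM m%:R) (Normc.normcM 'C(m, 2)%:R) !normc_natr => B2.
have k1 := ler_pM (ler0n _ m) (normc_ge0 _) h2 star_point_sum.
have k2 := ler_pM (ler0n _ _) (normc_ge0 _) h1 star_point_sum_sqr.
have k3 : normc (\sum_i (star_point h i ^+ m - 1 - m%:R * e i - 'C(m, 2)%:R * e i ^+ 2)) <=
   32 * (4 ^+ m * h ^+ 3).
  apply: le_trans (normc_sum _ _ _) _.
  apply: (@le_trans _ _ (\sum_(i < 4) (8 * (4 ^+ m * h ^+ 3)))); last first.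
    by rewrite sumr_const card_ord -[leLHS]mulr_natl mulrA -natrM.
  apply: ler_sum => i _; rewrite {1}zE; apply: le_trans (T i _) _.
    by have := he i; lra.
  by rewrite (mulrCA 8) ler_wpM2l.
rewrite -(mulrA 42); rewrite (mulrCA (4 ^+ m) 4) in k1; rewrite (mulrCA (4 ^+ m) 6) in k2.
have X0 : 0 <= 4 ^+ m * h ^+ 3 by rewrite mulr_ge0// exprn_ge0//; lra.
rewrite -/(e _) in k1 k2; move: B2 k1 k2 k3.
move: (4 ^+ m * h ^+ 3) => X; lra.
Qed.

Section family.
Variables (J : Type) (s_ : seq J) (a : J -> C) (m : J -> nat) (r K : R).
Hypothesis r01 : 0 <= r <= 1.
Hypothesis aK : \sum_(j <- s_) normc (a j) * (42 * 4 ^+ m j) <= K.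

(** [r] is the base radius and [z], equal to 1 or to a star point, a multiplicative displacement;
    [radial_deriv] is the derivative in log z at z = 1. *)
Definition radial_poly (z : C) : C := \sum_(j <- s_) a j * (r%:C%C * z) ^+ m j.
Definition radial_deriv : C := \sum_(j <- s_) a j * r%:C%C ^+ m j * (m j)%:R.

Let r0 : 0 <= r. Proof. by case/andP: r01. Qed.
Let r1 : r <= 1. Proof. by case/andP: r01. Qed.

Let aKr (F : J -> C) (B : R) : 0 <= B ->
  (forall j, normc (r%:C%C ^+ m j * F j) <= (42 * 4 ^+ m j) * B) ->
  normc (\sum_(j <- s_) a j * r%:C%C ^+ m j * F j) <= K * B.
Proof.
move=> B0 HF; apply: le_trans (normc_sum _ _ _) _.
apply: le_trans (ler_wpM2r B0 aK); rewrite mulr_suml; apply: ler_sum => j _.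
by rewrite -mulrA Normc.normcM -mulrA ler_wpM2l ?normc_ge0.
Qed.

(** A constant term has no increment, and any other one carries r^m <= r. This is the source of the
    factor [r] in the bounds below. *)
Let rm (j : J) (z : C) (B : R) : 0 <= B -> (m j = 0%N -> z = 0) -> normc z <= B ->
  normc (r%:C%C ^+ m j * z) <= B * r.
Proof.
move=> B0; case: (m j) => [->//|k _ zB].
  by rewrite mulr0 Normc.normc0 mulr_ge0.
rewrite Normc.normcM normcX normc_real ger0_norm// mulrC ler_pM ?normc_ge0 ?exprn_ge0//.
by rewrite exprS ler_piMr// exprn_ile1.
Qed.

Let P4 n : 1 <= 42 * 4 ^+ n :> R.
Proof. by rewrite -natrX -natrM ler1n muln_gt0 expn_gt0. Qed.

Lemma radial_deriv_le : normc radial_deriv <= K * r.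
Proof.
apply: aKr => // j; apply: rm => // [->//|]; rewrite normc_natr.
have : (m j)%:R <= 4 ^+ m j :> R by rewrite -natrX ler_nat ltnW// ltn_expl.
by move=> /le_trans; apply; rewrite ler_peMl// ?exprn_ge0// ler1n.
Qed.

Lemma radial_poly1_le : normc (radial_poly 1) <= K.
Proof.
rewrite -[leRHS]mulr1 /radial_poly (eq_bigr (fun j => a j * r%:C%C ^+ m j * 1)); last first.
  by move=> j _; rewrite !mulr1.
apply: aKr => // j; rewrite !mulr1 normcX normc_real ger0_norm//.
by apply: le_trans (P4 _); rewrite exprn_ile1.
Qed.

Let incrE (z : C) : radial_poly z - radial_poly 1 =
  \sum_(j <- s_) a j * r%:C%C ^+ m j * (z ^+ m j - 1).
Proof.
rewrite /radial_poly -sumrB; apply: eq_bigr => j _.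
by rewrite mulr1 exprMn; ring.
Qed.

Lemma radial_poly_incr (i : 'I_4) :
  normc (radial_poly (star_point h i) - radial_poly 1 - h%:C%C * ('i%C ^+ i * radial_deriv))
  <= K * r * h ^+ 2.
Proof.
rewrite incrE /radial_deriv !mulr_sumr -sumrB.
rewrite (eq_bigr (fun j => a j * r%:C%C ^+ m j *
  (star_point h i ^+ m j - 1 - h%:C%C * ('i%C ^+ i * (m j)%:R)))); last by move=> j _; ring.
rewrite -mulrA; apply: aKr; first by rewrite mulr_ge0// sqr_ge0.
move=> j; rewrite (mulrC r) [leRHS]mulrA; apply: rm; first by rewrite mulr_ge0 ?sqr_ge0.
  by move=> ->; rewrite expr0 subrr !mulr0 subr0.
exact: star_monomial_incr.
Qed.

Lemma radial_poly_sum :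
  normc (\sum_i (radial_poly (star_point h i) - radial_poly 1)) <= K * r * h ^+ 3.
Proof.
have h3 : 0 <= h ^+ 3 by rewrite exprn_ge0.
under eq_bigr do rewrite incrE.
rewrite exchange_big/=.
under eq_bigr do rewrite -mulr_sumr.
rewrite -mulrA; apply: aKr; first by rewrite mulr_ge0.
move=> j; rewrite (mulrC r) [leRHS]mulrA; apply: rm; first by rewrite mulr_ge0.
  by move=> ->; under eq_bigr do rewrite expr0 subrr; rewrite big1.
exact: star_monomial_sum.
Qed.

(** As 0^0 = 1, the subtracted sum is the value at radius 0, that is, the constant terms. *)
Lemma radial_poly1_0 :
  normc (radial_poly 1 - \sum_(j <- s_) a j * 0 ^+ m j) <= K * r.
Proof.
rewrite /radial_poly -sumrB.
rewrite (eq_bigr (fun j => a j * r%:C%C ^+ m j * (1 - 0 ^+ m j))); last first.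
  move=> j _; rewrite mulr1; case: (m j) => [|k]; first by rewrite !expr0; ring.
  by rewrite expr0n/=; ring.
apply: aKr => // j; apply: rm => // [->|]; first by rewrite expr0 subrr.
apply: le_trans (P4 _); case: (m j) => [|k]; first by rewrite expr0 subrr Normc.normc0.
by rewrite expr0n subr0 Normc.normc1.
Qed.

End family.
End star.
End increments.

(** * Translation invariance and characters *)

Section uniform_shift.
Variable R : realType.
Local Notation U := (uniform_prob (@ltr01 R)).
Local Notation mu := (@lebesgue_measure R).

Lemma lebesgue_measure_translate (t : R) (A : set R) : measurable A ->
  mu [set y | A (y + t)] = mu A.
Proof.
move=> mA.
have mt : measurable_fun setT (fun y : measurableTypeR R => y + t : measurableTypeR R).
  by apply: measurable_funD.
pose m := @measure_function_pushforward__canonical__measure_function_Measure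
    _ _ (measurableTypeR R) (measurableTypeR R) _ mu (fun y => y + t) mt.
apply/esym; apply: (@lebesgue_measure_unique _ m _ A mA) => _ [[a b] _ <-].
rewrite /m /= /pushforward.
rewrite [X in _ = mu X](_ : _ = `]a - t, b - t]%classic); last first.
  by apply/seteqP; split => x /=; rewrite !in_itv/= ltrBlDr lerBrDr.
rewrite !lebesgue_measure_itv/= !lte_fin ltrD2r; case: ifPn => // _.
by rewrite -!EFinB; congr EFin; ring.
Qed.

(** The half-open interval is a fundamental domain on which [circle_shift] is a bijection; the
    endpoint 1 is negligible. *)
Lemma uniform_prob_lebesgue (A : set R) : measurable A -> U A = mu (A `&` `[0, 1[%classic).
Proof.
move=> mA; rewrite /uniform_prob integral_uniform_pdf.
rewrite (eq_integral (fun=> 1%E)).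
  rewrite integral_cst ?mul1e//; last exact: measurableI.
  have -> : `[0, 1]%classic = `[0, 1[%classic `|` [set 1 : R].
    by rewrite setUitv1// bnd_simp.
  rewrite setIUr measureU//; first last.
  - by apply/seteqP; split => // x /= [[_ x1] [_ xE]]; move: x1; rewrite xE in_itv/= ltxx andbF.
  - exact: measurableI.
  - exact: measurableI.
  rewrite [X in (_ + X)%E](_ : _ = 0%E) ?adde0//.
  apply/eqP; rewrite eq_le measure_ge0 andbT -(@lebesgue_measure_set1 R 1).
  by apply: le_measure; rewrite ?inE//; exact: measurableI.
move=> x; rewrite inE/= in_itv/= /uniform_pdf => -[_ ->].
by rewrite subr0 invr1.
Qed.

Definition circle_shift (t y : R) : R := if y + t < 1 then y + t else y + t - 1.

Lemma measurable_circle_shift t : measurable_fun setT (circle_shift t).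
Proof.
apply: measurable_fun_ifT.
- by apply: measurable_fun_ltr => //; apply: measurable_funD.
- by apply: measurable_funD.
- by apply: measurable_funB => //; apply: measurable_funD.
Qed.

Lemma uniform_prob_circle_shift (t : R) (A : set R) : 0 <= t < 1 -> measurable A ->
  U (circle_shift t @^-1` A) = U A.
Proof.
move=> /andP[t0 t1] mA.
have mS : measurable (circle_shift t @^-1` A).
  by rewrite -[X in measurable X]setTI; exact: measurable_circle_shift.
rewrite !uniform_prob_lebesgue//.
have -> : circle_shift t @^-1` A `&` `[0, 1[%classic =
   [set y | (A `&` `[t, 1[%classic) (y + t)] `|` [set y | (A `&` `[0, t[%classic) (y + (t - 1))].
  apply/seteqP; split => y; rewrite /circle_shift/= !in_itv/=.
    case: ifPn => yt [Ay /andP[y0 y1]]; [left|right]; rewrite ?addrA; split => //.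
      by rewrite andbT lerDr.
    by move: yt; rewrite -leNgt => yt; apply/andP; split; lra.
  move=> [|] [+ /andP[h1 h2]]; rewrite ?h2 => Ay.
    by split => //; apply/andP; split; lra.
  rewrite ifF; last by apply/negbTE; rewrite -leNgt; lra.
  by rewrite -addrA; split => //; apply/andP; split; lra.
have m1 : measurable (A `&` `[t, 1[%classic) by exact: measurableI.
have m2 : measurable (A `&` `[0, t[%classic) by exact: measurableI.
have mt (s : R) (B : set R) : measurable B -> measurable [set y | B (y + s)].
  move=> mB; rewrite (_ : [set y | _] = setT `&` (fun y : R => y + s) @^-1` B); last by rewrite setTI.
  by apply: (measurable_funD _ _) => //.
rewrite measureU//; [|exact: mt|exact: mt|].
  pose A1 : set R := A `&` `[t, 1[%classic; pose A2 : set R := A `&` `[0, t[%classic.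
  transitivity (mu A1 + mu A2)%E.
    by congr (_ + _)%E; exact: lebesgue_measure_translate.
  transitivity (mu (A1 `|` A2)).
    apply/esym; rewrite measureU//.
    apply/seteqP; split => x //; rewrite /A1 /A2 /= !in_itv/= => -[[_ /andP[? ?]] [_ /andP[? ?]]]; lra.
  rewrite /A1 /A2 -setIUr setUC; congr (mu (_ `&` _)).
  apply/seteqP; split => x /=; rewrite !in_itv/=.
    by move=> [|] /andP[? ?]; apply/andP; split; lra.
  move=> /andP[? ?]; have [xt|tx] := ltP x t; [left|right]; apply/andP; split => //.
apply/seteqP; split => x //=; rewrite !in_itv/= => -[[_ /andP[? ?]] [_ /andP[? ?]]]; lra.
Qed.

End uniform_shift.

Section haar_translation.
Variable R : realType.
Local Notation P := (haarTN R).
Local Notation U := (uniform_prob (@ltr01 R)).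

Lemma measurable_coord (j : nat) : measurable_fun setT (fun x : TN R => x j : R).
Proof.
move=> _ B mB; rewrite setTI.
by apply: sub_sigma_algebra; exists j, B.
Qed.

Definition Zperiodic (T : Type) (f : TN R -> T) : Prop :=
  forall (x : TN R) (k : nat -> int), f (fun j => x j + (k j)%:~R) = f x.

Definition translate (k : nat) (t : R) (x : TN R) : TN R :=
  fun j => x j + (if j == k then t else 0).

Definition boxes : set (set (TN R)) :=
  [set A | exists (m : nat) (B : nat -> set R),
     (forall j, measurable (B j)) /\ A = [set x | forall j, (j < m)%N -> B j (x j)]].

Lemma measurable_box (m : nat) (B : nat -> set R) : (forall j, measurable (B j)) ->
  measurable ([set x | forall j, (j < m)%N -> B j (x j)] : set (TN R)).
Proof.
move=> mB; rewrite (_ : [set x | _] =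
   \bigcap_(j in [set j | (j < m)%N]) (fun x : TN R => x j) @^-1` B j)//.
apply: bigcap_measurableType => j _.
by rewrite -[X in measurable X]setTI; exact: measurable_coord.
Qed.

Lemma measurable_boxesE : @measurable _ (TN R) = <<s boxes >>.
Proof.
apply/seteqP; split.
  apply: smallest_sub; first exact: smallest_sigma_algebra.
  move=> _ [j [B mB ->]]; apply: sub_sigma_algebra.
  exists j.+1, (fun i => if i == j then B else setT); split.
    by move=> i; case: ifP.
  apply/seteqP; split => x /=.
    by move=> Bx i _; case: eqP => // ->.
  by move=> /(_ j (ltnSn j)); rewrite eqxx.
apply: smallest_sub; first exact: sigma_algebra_measurable.
by move=> _ [m [B [mB ->]]]; exact: measurable_box.
Qed.

Lemma haarTN_unique (Q : {measure set (TN R) -> \bar R}) :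
  (forall m B, (forall j, measurable (B j)) ->
    Q [set x | forall j, (j < m)%N -> B j (x j)] = (\prod_(j < m) U (B j))%E) ->
  forall A, measurable A -> P A = Q A.
Proof.
move=> QE A mA.
apply: (@measure_unique _ R (TN R) boxes (fun=> setT) _ _ _ _ P Q _ _ A mA) => //.
- exact: measurable_boxesE.
- move=> _ _ [m [B [mB ->]]] [m' [B' [mB' ->]]].
  exists (maxn m m'), (fun j => (if (j < m)%N then B j else setT) `&`
     (if (j < m')%N then B' j else setT)); split.
    by move=> j; apply: measurableI; case: ifP.
  apply/seteqP; split => x /=.
    by move=> [h h'] j _; split; case: ifP => // jm; [exact: h|exact: h'].
  move=> h; split => j jm; have := h j; rewrite leq_max jm ?orbT => /(_ isT)[].
    by [].
  by move=> _.
- by move=> _; exists 0%N, (fun=> setT); split => //; apply/seteqP; split.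
- by rewrite -subTset => x _; exists 0%N.
- by move=> _ [m [B [mB ->]]]; rewrite QE//; exact: haarTN_box.
- by move=> _; apply: (@le_lt_trans _ _ 1%E); [exact: probability_le1|exact: ltry].
Qed.

Definition Ex (f : TN R -> R) : R := Rintegral P setT f.

(** Apart from the elements of the closure, all the functions to be integrated are of this kind,
    which settles integrability once and for all. *)
Definition mbounded (f : TN R -> R) : Prop :=
  measurable_fun setT f /\ exists M : R, forall x, `|f x| <= M.

Lemma mbounded_integrable f : mbounded f -> P.-integrable setT (EFin \o f).
Proof.
move=> [mf [M fM]]; apply: measurable_bounded_integrable => //.
  by rewrite (le_lt_trans (probability_le1 _ _)) ?ltry.
by exists M; split; rewrite ?num_real// => x Mx t _; exact: le_trans (fM t) (ltW Mx).
Qed.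

(** By periodicity [t] may be taken in [0, 1[ and the translation replaced by [circle_shift] on the
    coordinate [k]. The latter pulls boxes back to boxes of the same measure, and boxes determine
    the measure. *)
Lemma Ex_translate f k t : mbounded f -> Zperiodic f ->
  Ex (fun x => f (translate k t x)) = Ex f.
Proof.
move=> mbf pf.
wlog t01 : t / 0 <= t < 1.
  move=> H; rewrite -(H (t - (Num.floor t)%:~R)); last first.
    by rewrite subr_ge0 floor_le/= ltrBlDl -intrD1 floorD1_gt.
  congr Ex; apply/funext => x.
  rewrite -(pf _ (fun j => if j == k then - Num.floor t else 0)).
  congr f; apply/funext => j; rewrite /translate.
  by case: eqP => _; rewrite ?intrN ?addr0// addrA.
pose S (x : TN R) : TN R := fun j => if j == k then circle_shift t (x j) else x j.
have mS : measurable_fun setT S.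
  apply: (@measurability _ _ (TN R) (TN R) setT S (@cylinders R)) => //.
  move=> _ [_ [j [B mB ->]] <-].
  have : measurable_fun setT (fun x : TN R => S x j).
    rewrite /S; case: eqP => _; last exact: measurable_coord.
    apply: measurableT_comp; [exact: measurable_circle_shift|exact: measurable_coord].
  exact.
pose X : {mfun TN R >-> TN R} := HB.pack S (isMeasurableFun.Build _ _ _ _ _ mS).
have PX A : measurable A -> P A = distribution P X A.
  apply: haarTN_unique => m B mB.
  pose B' j := if (j : nat) == k then circle_shift t @^-1` (B j) else B j.
  have mB' j : measurable (B' j).
    rewrite /B'; case: eqP => // _.
    by rewrite -[X in measurable X]setTI; exact: measurable_circle_shift.
  transitivity (P (S @^-1` [set x | forall j, (j < m)%N -> B j (x j)])) => //.
  rewrite (_ : _ @^-1` _ = [set x | forall j, (j < m)%N -> B' j (x j)]); last first.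
    by apply/seteqP; split => x /= h j jm; have := h j jm; rewrite /S /B'; case: eqP.
  transitivity (\prod_(j < m) U (B' j))%E; first exact: haarTN_box.
  apply: eq_bigr => j _; rewrite /B'; case: eqP => // _; exact: uniform_prob_circle_shift.
have fS : (fun x => f (translate k t x)) = f \o S.
  apply/funext => x; rewrite /=.
  rewrite -(pf (S x) (fun j => if j == k then (if x j + t < 1 then 0 else 1) else 0)).
  congr f; apply/funext => j; rewrite /translate /S /circle_shift.
  case: eqP => _; last by rewrite !addr0.
  by case: ifP => _; rewrite ?addr0// subrK.
rewrite fS /Ex /Rintegral; congr fine.
rewrite -(@integral_distribution _ _ _ _ _ P X (EFin \o f)).
  apply: eq_measure_integral => A mA _; exact/esym/PX.
  apply/measurable_EFinP; exact: mbf.1.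
apply: mbounded_integrable; split; last by have [M fM] := mbf.2; exists M.
exact: (measurableT_comp mbf.1 mS).
Qed.

End haar_translation.

(** * Expectations of bounded measurable functions *)

Section mbounded_theory.
Variable R : realType.
Implicit Types f g : TN R -> R.

Lemma mbounded_cst (c : R) : mbounded (fun _ : TN R => c).
Proof. by split; [exact: measurable_cst|exists `|c|]. Qed.

Lemma mboundedD f g : mbounded f -> mbounded g -> mbounded (fun x => f x + g x).
Proof.
move=> [mf [M fM]] [mg [N gN]]; split; first exact: measurable_funD.
by exists (M + N) => x; rewrite (le_trans (ler_normD _ _))// lerD.
Qed.

Lemma mboundedN f : mbounded f -> mbounded (fun x => - f x).
Proof.
move=> [mf [M fM]]; split; last by exists M => x; rewrite normrN.
exact: measurableT_comp.
Qed.

Lemma mboundedB f g : mbounded f -> mbounded g -> mbounded (fun x => f x - g x).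
Proof. by move=> mf mg; apply: mboundedD => //; exact: mboundedN. Qed.

Lemma mboundedM f g : mbounded f -> mbounded g -> mbounded (fun x => f x * g x).
Proof.
move=> [mf [M fM]] [mg [N gN]]; split; first exact: measurable_funM.
by exists (M * N) => x; rewrite normrM ler_pM.
Qed.

Lemma mbounded_sum (I : Type) (s : seq I) (F : I -> TN R -> R) :
  (forall i, mbounded (F i)) -> mbounded (fun x => \sum_(i <- s) F i x).
Proof.
move=> mF; elim: s => [|i s IH].
  rewrite (_ : (fun x => _) = fun=> 0); first exact: mbounded_cst.
  by apply/funext => x; rewrite big_nil.
rewrite (_ : (fun x => _) = fun x => F i x + \sum_(i <- s) F i x); first exact: mboundedD.
by apply/funext => x; rewrite big_cons.
Qed.

Lemma mbounded_sqrt f : mbounded f -> mbounded (fun x => Num.sqrt (f x)).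
Proof.
move=> [mf [M fM]]; split.
  apply: measurableT_comp mf; apply: continuous_measurable_fun; exact: sqrt_continuous.
exists (Num.sqrt M) => x; rewrite ger0_norm ?sqrtr_ge0//.
by rewrite ler_wsqrtr// (le_trans (ler_norm _)).
Qed.

Lemma mbounded_inv f : (forall x, 1 <= f x) -> mbounded f -> mbounded (fun x => (f x)^-1).
Proof.
move=> f1 [mf _]; split; last first.
  exists 1 => x; rewrite normfV invf_le1 ?normr_gt0 ?gt_eqF ?(lt_le_trans ltr01)//.
  by rewrite (le_trans (f1 x))// ler_norm.
rewrite (_ : (fun x => _) = (fun y : R => y `^ -1) \o f); last first.
  by apply/funext => x /=; rewrite powR_inv1// (le_trans ler01).
apply: measurableT_comp mf; exact: measurable_powR.
Qed.

Lemma ExD f g : mbounded f -> mbounded g -> Ex (fun x => f x + g x) = Ex f + Ex g.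
Proof. by move=> mf mg; rewrite /Ex RintegralD//; exact: mbounded_integrable. Qed.

Lemma ExB f g : mbounded f -> mbounded g -> Ex (fun x => f x - g x) = Ex f - Ex g.
Proof. by move=> mf mg; rewrite /Ex RintegralB//; exact: mbounded_integrable. Qed.

Lemma ExZ (c : R) f : mbounded f -> Ex (fun x => c * f x) = c * Ex f.
Proof. by move=> mf; rewrite /Ex RintegralZl//; exact: mbounded_integrable. Qed.

Lemma ExN f : mbounded f -> Ex (fun x => - f x) = - Ex f.
Proof.
move=> mf; rewrite -mulN1r -ExZ//; congr Ex.
by apply/funext => x; rewrite mulN1r.
Qed.

Lemma Ex_cst (c : R) : Ex (fun _ : TN R => c) = c.
Proof.
rewrite /Ex Rintegral_cst//.
by rewrite -[LHS]/(c * fine (haarTN R setT)) (probability_setT (haarTN R)) mulr1.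
Qed.

Lemma Ex_sum (I : Type) (s : seq I) (F : I -> TN R -> R) :
  (forall i, mbounded (F i)) -> Ex (fun x => \sum_(i <- s) F i x) = \sum_(i <- s) Ex (F i).
Proof.
move=> mF; elim: s => [|i s IH].
  rewrite big_nil -[RHS](Ex_cst 0); congr Ex.
  by apply/funext => x; rewrite big_nil.
rewrite big_cons -IH -ExD//; last exact: mbounded_sum.
by congr Ex; apply/funext => x; rewrite big_cons.
Qed.

Lemma le_Ex f g : mbounded f -> mbounded g -> (forall x, f x <= g x) -> Ex f <= Ex g.
Proof. by move=> mf mg fg; apply: le_Rintegral => //; exact: mbounded_integrable. Qed.

End mbounded_theory.

(** * Characters, their periodicity and their orthogonality *)

Section dual.
Variable R : realType.
Implicit Types (n m : ZN).

Definition zadd n m : ZN :=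
  [fsfun j in (finsupp n `|` finsupp m)%fset => (n j + m j)%R].

Definition zsub n m : ZN :=
  [fsfun j in (finsupp n `|` finsupp m)%fset => (n j - m j)%R].

Lemma zaddE n m j : zadd n m j = n j + m j.
Proof.
rewrite fsfunE in_fsetU; case: ifPn => //; rewrite negb_or => /andP[nj mj].
by rewrite !fsfun_dflt// addr0.
Qed.

Lemma zsubE n m j : zsub n m j = n j - m j.
Proof.
rewrite fsfunE in_fsetU; case: ifPn => //; rewrite negb_or => /andP[nj mj].
by rewrite !fsfun_dflt// subr0.
Qed.

Lemma Zlow_bound n : exists N, Zlow N n.
Proof.
exists (\max_(j <- finsupp n) j).+1 => j nj; apply: fsfun_dflt; apply/negP => jn.
by have := @leq_bigmax_seq _ (enum_fset (finsupp n)) xpredT id j jn isT; rewrite leqNgt nj.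
Qed.

Lemma ZlowW N N' n : (N <= N')%N -> Zlow N n -> Zlow N' n.
Proof. by move=> NN nN j jN; apply: nN; exact: leq_trans jN. Qed.

Lemma Zlow_bound_seq (s : seq ZN) : exists N, forall n, n \in s -> Zlow N n.
Proof.
elim: s => [|n s [N HN]]; first by exists 0%N.
have [M HM] := Zlow_bound n; exists (maxn N M) => k; rewrite inE => /predU1P[->|ks].
  by apply: ZlowW HM; exact: leq_maxr.
by apply: ZlowW (HN _ ks); exact: leq_maxl.
Qed.

(** A range common to several frequencies replaces the support of each one, so that their pairings
    can be subtracted termwise. *)
Lemma pairing_low N n (x : TN R) : Zlow N n ->
  pairing n x = \sum_(j < N) (n j)%:~R * x j.
Proof.
move=> nN; rewrite /pairing -(big_mkord xpredT (fun j => (n j)%:~R * x j)) /index_iota subn0.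
rewrite [RHS](bigID (mem (finsupp n)))/= [X in _ + X]big1 ?addr0; last first.
  by move=> j nj; rewrite fsfun_dflt// mul0r.
rewrite -[RHS]big_filter; apply: perm_big; apply: uniq_perm.
- exact: fset_uniq.
- by rewrite filter_uniq// iota_uniq.
move=> j; rewrite mem_filter mem_iota/= add0n -[LHS]/(j \in finsupp n).
case: (boolP (j \in finsupp n)) => //= jn; apply/esym; rewrite ltnNge; apply/negP => /nN n0.
by move: jn; rewrite mem_finsupp n0 eqxx.
Qed.

Lemma pairing_zsub n m (x : TN R) : pairing (zsub n m) x = pairing n x - pairing m x.
Proof.
have [N HN] := Zlow_bound_seq [:: n; m; zsub n m].
rewrite !(@pairing_low N) -?sumrB/=; try by apply: HN; rewrite !inE eqxx ?orbT.
by apply: eq_bigr => j _; rewrite zsubE intrB mulrBl.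
Qed.

Lemma pairing_addr n (x y : TN R) :
  pairing n (fun j => x j + y j) = pairing n x + pairing n y.
Proof. by rewrite /pairing -big_split/=; apply: eq_bigr => j _; rewrite mulrDr. Qed.

Lemma pairing_int n (k : nat -> int) :
  exists z : int, pairing n (fun j => (k j)%:~R : R) = z%:~R.
Proof.
exists (\sum_(j <- finsupp n) n j * k j).
by rewrite rmorph_sum/=; apply: eq_bigr => j _; rewrite intrM.
Qed.

Lemma pairing_translate n k (t : R) (x : TN R) :
  pairing n (translate k t x) = pairing n x + (n k)%:~R * t.
Proof.
rewrite /translate pairing_addr; congr (_ + _); rewrite /pairing.
case: (boolP (k \in finsupp n)) => kn.
  rewrite (big_fsetD1 _ kn)/= eqxx big1_fset ?addr0// => j.
  by rewrite !inE => /andP[/negbTE -> _] _; rewrite mulr0.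
rewrite fsfun_dflt// mul0r big1_fset// => j jn _.
by case: eqP => [jk|]; rewrite ?mulr0//; move: kn; rewrite -jk jn.
Qed.

Lemma expiD (s t : R) : expi (s + t) = expi s * expi t.
Proof. by apply: eq_complexP; rewrite /= ?cosD ?sinD//; ring. Qed.

Lemma expi0 : expi (0 : R) = 1.
Proof. by rewrite /expi cos0 sin0. Qed.

Lemma conjcM (a b : R[i]) : conjc (a * b) = conjc a * conjc b.
Proof. exact: rmorphM. Qed.

Lemma conjc_expi (t : R) : conjc (expi t) = expi (- t).
Proof. by rewrite /expi/= cosN sinN. Qed.

Lemma normc_expi (t : R) : Normc.normc (expi t) = 1.
Proof. by rewrite /= cos2Dsin2 sqrtr1. Qed.

Lemma expi_natmul (t : R) (m : nat) : expi (m%:R * t) = expi t ^+ m.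
Proof.
elim: m => [|m IH]; first by rewrite mul0r expi0 expr0.
by rewrite -natr1 mulrDl mul1r expiD IH exprSr.
Qed.

Lemma expi_2pi_int (z : int) : expi (2 * pi * z%:~R) = 1 :> R[i].
Proof.
have e (m : nat) : expi (2 * pi * m%:R) = 1 :> R[i].
  rewrite mulrC expi_natmul (_ : expi _ = 1) ?expr1n//.
  by rewrite /expi mulr_natl cos2pi sin2pi.
case: z => m; first exact: e.
by rewrite NegzE intrN mulrN -conjc_expi e; rewrite conjc1.
Qed.

Lemma echar_zsub n m (x : TN R) : echar (zsub n m) x = echar n x * conjc (echar m x).
Proof. by rewrite /echar pairing_zsub mulrBr expiD conjc_expi. Qed.

Lemma echar_translate n k (t : R) (x : TN R) :
  echar n (translate k t x) = echar n x * expi ((n k)%:~R * (2 * pi * t)).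
Proof. by rewrite /echar pairing_translate mulrDr expiD; congr (_ * expi _); ring. Qed.

Lemma Zperiodic_echar n : Zperiodic (@echar R n).
Proof.
move=> x k; rewrite /echar pairing_addr; have [z ->] := pairing_int n k.
by rewrite mulrDr expiD expi_2pi_int mulr1.
Qed.

Lemma normc_echar n (x : TN R) : Normc.normc (echar n x) = 1.
Proof. exact: normc_expi. Qed.

Lemma measurable_pairing n : measurable_fun setT (@pairing R n).
Proof.
rewrite /pairing; apply: measurable_sum => j.
by apply: measurable_funM => //; exact: measurable_coord.
Qed.

Definition cmbounded (f : TN R -> R[i]) : Prop :=
  mbounded (fun x => complex.Re (f x)) /\ mbounded (fun x => complex.Im (f x)).

Lemma cmbounded_echar n : cmbounded (@echar R n).
Proof.
have mp : measurable_fun setT (fun x : TN R => 2 * pi * pairing n x).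
  by apply: measurable_funM => //; exact: measurable_pairing.
split; split.
- apply: measurableT_comp mp; apply: continuous_measurable_fun; exact: continuous_cos.
- by exists 1 => x; exact: cos_max.
- apply: measurableT_comp mp; apply: continuous_measurable_fun; exact: continuous_sin.
- by exists 1 => x; exact: sin_max.
Qed.

Lemma cmbounded_cst (c : R[i]) : cmbounded (fun=> c).
Proof. by split; exact: mbounded_cst. Qed.

Lemma cmboundedM (f g : TN R -> R[i]) : cmbounded f -> cmbounded g ->
  cmbounded (fun x => f x * g x).
Proof.
move=> [rf if_] [rg ig]; split.
  rewrite (_ : (fun x => _) = fun x => complex.Re (f x) * complex.Re (g x) -
      complex.Im (f x) * complex.Im (g x)).
    by apply: mboundedB; exact: mboundedM.
  by apply/funext => x; case: (f x) => a b; case: (g x).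
rewrite (_ : (fun x => _) = fun x => complex.Re (f x) * complex.Im (g x) +
    complex.Im (f x) * complex.Re (g x)).
  by apply: mboundedD; exact: mboundedM.
by apply/funext => x; case: (f x) => a b; case: (g x).
Qed.

Lemma cmbounded_conjc (f : TN R -> R[i]) : cmbounded f -> cmbounded (fun x => conjc (f x)).
Proof.
move=> [rf if_]; split.
  rewrite (_ : (fun x => _) = fun x => complex.Re (f x))//.
  by apply/funext => x; case: (f x).
rewrite (_ : (fun x => _) = fun x => - complex.Im (f x)); first exact: mboundedN.
by apply/funext => x; case: (f x).
Qed.

Lemma Re_sum (I : Type) (s : seq I) (F : I -> R[i]) :
  complex.Re (\sum_(i <- s) F i) = \sum_(i <- s) complex.Re (F i).
Proof. by elim/big_rec2: _ => // i y1 y2 _ <-; case: (F i) => a b; case: y2. Qed.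

Lemma Im_sum (I : Type) (s : seq I) (F : I -> R[i]) :
  complex.Im (\sum_(i <- s) F i) = \sum_(i <- s) complex.Im (F i).
Proof. by elim/big_rec2: _ => // i y1 y2 _ <-; case: (F i) => a b; case: y2. Qed.

Lemma cmbounded_sum (I : Type) (s : seq I) (F : I -> TN R -> R[i]) :
  (forall i, cmbounded (F i)) -> cmbounded (fun x => \sum_(i <- s) F i x).
Proof.
move=> mF; split.
  rewrite (_ : (fun x => _) = fun x => \sum_(i <- s) complex.Re (F i x)).
    by apply: mbounded_sum => i; case: (mF i).
  by apply/funext => x; rewrite Re_sum.
rewrite (_ : (fun x => _) = fun x => \sum_(i <- s) complex.Im (F i x)).
  by apply: mbounded_sum => i; case: (mF i).
by apply/funext => x; rewrite Im_sum.
Qed.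

Lemma mbounded_dotc (f g : TN R -> R[i]) : cmbounded f -> cmbounded g ->
  mbounded (fun x => dotc (f x) (g x)).
Proof. by move=> [? ?] [? ?]; apply: mboundedD; exact: mboundedM. Qed.

Lemma mbounded_normc (f : TN R -> R[i]) : cmbounded f ->
  mbounded (fun x => Normc.normc (f x)).
Proof.
move=> mf; rewrite (_ : (fun x => _) = fun x => Num.sqrt (dotc (f x) (f x))).
  by apply: mbounded_sqrt; exact: mbounded_dotc.
by apply/funext => x; rewrite normc_dotE.
Qed.

(** If n and m differ at the coordinate [j], translating x_j by 1 / (2 (n_j - m_j)) multiplies the
    product of characters by exp(i pi) = -1, so the expectation equals its opposite. *)
Lemma Ex_echar_orthogonal (c : R[i]) n m :
  Ex (fun x : TN R => complex.Re (c * (echar n x * conjc (echar m x)))) =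
  if n == m then complex.Re c else 0.
Proof.
case: eqP => [->|nm].
  rewrite -[RHS]Ex_cst; congr Ex; apply/funext => x.
  rewrite /echar conjc_expi -expiD addrN expi0 mulr1//.
have [j nmj] : exists j, n j != m j.
  apply: contra_notP nm => /forallNP H; apply/fsfunP => j.
  by have /negP := H j; rewrite negbK => /eqP.
set g := fun x => _.
have mg : mbounded g.
  suff : cmbounded (fun x : TN R => c * (echar n x * conjc (echar m x))) by case.
  apply: cmboundedM; first exact: cmbounded_cst.
  apply: cmboundedM; [|apply: cmbounded_conjc]; exact: cmbounded_echar.
have pg : Zperiodic g by move=> x k; rewrite /g !Zperiodic_echar.
pose d : R := (n j)%:~R - (m j)%:~R.
have d0 : d != 0 by rewrite subr_eq0 eqr_int.
have := Ex_translate j (2 * d)^-1 mg pg.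
rewrite (_ : (fun x => g _) = fun x => - g x).
  by rewrite ExN// => /eqP; rewrite eqNr => /eqP.
apply/funext => x; rewrite /g !echar_translate conjcM [conjc (expi (_ * (2 * pi * _)))]conjc_expi.
have -> : echar n x * expi ((n j)%:~R * (2 * pi * (2 * d)^-1)) *
    (conjc (echar m x) * expi (- ((m j)%:~R * (2 * pi * (2 * d)^-1)))) =
    - (echar n x * conjc (echar m x)).
  rewrite mulrACA -expiD (_ : _ + _ = pi); last by rewrite /d in d0 *; field.
  by rewrite (_ : expi pi = -1) ?mulrN1//; rewrite /expi cospi sinpi; apply: eq_complexP; rewrite /= ?oppr0.
by rewrite mulrN; case: (c * _).
Qed.

End dual.

(** * Radial monotonicity *)

Section convex_seq.
Variable R : realType.

(** A positive increment would persist by convexity and force linear growth. *)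
Lemma convex_bounded_nonincreasing (u : nat -> R) (B : R) :
  (forall j, u j <= B) -> (forall j, 2 * u j.+1 <= u j + u j.+2) ->
  forall j, u j <= u 0%N.
Proof.
move=> uB uc.
suff H j : u j.+1 <= u j by elim=> // j IH; exact: le_trans (H j) IH.
rewrite leNgt; apply/negP => lt; set d := u j.+1 - u j.
have d0 : 0 < d by rewrite subr_gt0.
have inc i : d <= u (j + i).+1 - u (j + i)%N.
  elim: i => [|i IH]; first by rewrite addn0.
  by have := uc (j + i)%N; rewrite addnS; lra.
have grow i : i%:R * d + u j <= u (j + i)%N.
  elim: i => [|i IH]; first by rewrite addn0 mul0r add0r.
  by have := inc i; rewrite addnS -natr1 mulrDl; lra.
set N := (Num.truncn ((B - u j) / d)).+1.
have : (B - u j) / d < N%:R by exact: truncnS_gt.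
rewrite ltr_pdivrMr// => HN; have := grow N; have := uB (j + N)%N; lra.
Qed.

End convex_seq.

(** To be applied with [F1], [F2] the values at the two dilated radii and [F3], [F4] those at the
    two translated points: once integrated, the latter cancel against [F0] and only the radial
    second difference is left. *)
Lemma Ex_five_ge (R : realType) (c : R) (F1 F2 F3 F4 F0 : TN R -> R) :
  mbounded F1 -> mbounded F2 -> mbounded F3 -> mbounded F4 -> mbounded F0 ->
  Ex F3 = Ex F0 -> Ex F4 = Ex F0 ->
  (forall x, c <= F1 x + F2 x + (F3 x + F4 x) - 4 * F0 x) ->
  c <= Ex F1 + Ex F2 - 2 * Ex F0.
Proof.
move=> m1 m2 m3 m4 m0 E3 E4 H.
have m12 := mboundedD m1 m2; have m34 := mboundedD m3 m4.
have m40 := mboundedM (mbounded_cst 4) m0.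
have := le_Ex (mbounded_cst c) (mboundedB (mboundedD m12 m34) m40) H.
rewrite Ex_cst (ExB (mboundedD m12 m34) m40) (ExD m12 m34) (ExD m1 m2) (ExD m3 m4) (ExZ 4 m0) E3 E4.
by move: (Ex F1) (Ex F2) (Ex F0) => x1 x2 x3; lra.
Qed.

Section bellman_dist.
Variable R : realType.
Local Notation C := R[i].
Local Notation normc := Normc.normc.

Lemma ler_Re_normc (z : C) : `|complex.Re z| <= normc z.
Proof. by case: z => c d /=; rewrite -sqrtr_sqr ler_wsqrtr// lerDl sqr_ge0. Qed.

Lemma dotc_dist (K r : R) (z z0 y y0 : C) :
  normc z0 <= K -> normc y <= K ->
  normc (z - z0) <= K * r -> normc (y - y0) <= K * r ->
  `|dotc z y - dotc z0 y0| <= 2 * K ^+ 2 * r.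
Proof.
move=> z0K yK zz yy.
have -> : dotc z y - dotc z0 y0 = dotc (z - z0) y + dotc z0 (y - y0).
  clear; case: z z0 y y0 => a1 a2 [c1 c2] [d1 d2] [f1 f2]; rewrite /dotc/=; ring.
have h1 := dotc_le zz yK; have h2 := dotc_ge zz yK.
have h3 := dotc_le z0K yy; have h4 := dotc_ge z0K yy.
have e1 : K * r * K = K ^+ 2 * r by ring.
have e2' : K * (K * r) = K ^+ 2 * r by ring.
rewrite e1 in h1 h2; rewrite e2' in h3 h4.
by rewrite ler_norml; apply/andP; split; lra.
Qed.

(** A Lipschitz bound at radius 0. It supplies the boundedness and the limit as r tends to 0 that
    the convexity argument requires. *)
Lemma bellman_dist (K r e2 L b : R) (z z0 y y0 : C) (v v0 : R) :
  1 <= K -> 0 <= r <= 1 -> 0 < e2 -> e2 <= 1 ->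
  normc z <= K -> normc z0 <= K -> normc y <= K -> normc y0 <= K ->
  normc (z - z0) <= K * r -> normc (y - y0) <= K * r -> `|v - v0| <= K * r ->
  1 <= L + v - dotc y y -> 1 <= L + v0 - dotc y0 y0 -> 0 <= b <= 1 ->
  bellman e2 L b z0 y0 v0 <= bellman e2 L b z y v + 10 * K ^+ 3 / e2 * r.
Proof.
move=> K1 /andP[r0 r1] e20 e21 zK z0K yK y0K zz yy vv g1 g01 /andP[b0 b1].
have K0 : 0 <= K by apply: le_trans K1.
have D1 := dotc_dist z0K zK zz zz.
have D2 := dotc_dist z0K yK zz yy.
have D3 := dotc_dist y0K yK yy yy.
rewrite /bellman.
set A := dotc z z + e2; set A0 := dotc z0 z0 + e2.
set g := L + v - dotc y y in g1 *; set g0 := L + v0 - dotc y0 y0 in g01 *.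
have Ae : e2 <= A by rewrite lerDr dotcc_ge0.
have A0e : e2 <= A0 by rewrite lerDr dotcc_ge0.
have A0p : 0 <= A0 by apply: le_trans A0e; exact: ltW.
have Ap : 0 <= A by apply: le_trans Ae; exact: ltW.
have Kr : 0 <= K * r by rewrite mulr_ge0.
pose X := K ^+ 3 / e2 * r.
have e2V : 1 <= e2^-1 by rewrite invf_ge1.
have K3r : K ^+ 3 * r <= X.
  by rewrite /X ler_wpM2r// ler_peMr ?exprn_ge0.
have K2r : K ^+ 2 * r <= K ^+ 3 * r by rewrite ler_wpM2r// [leRHS]exprS ler_peMl ?exprn_ge0.
have K1r : K * r <= K ^+ 2 * r by rewrite ler_wpM2r// expr2 ler_peMl.
have sA2 : Num.sqrt A <= 2 * K.
  have K20 : 0 <= 2 * K by rewrite mulr_ge0.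
  rewrite -(@ler_pXn2r _ 2) ?nnegrE ?sqrtr_ge0// sqr_sqrtr// /A.
  have : dotc z z <= K * K by exact: dotc_le.
  have : 1 <= K * K by rewrite -[1]mulr1 ler_pM.
  by lra.
have sq : Num.sqrt A0 - Num.sqrt A <= 2 * X.
  have [h|h] := leP (Num.sqrt A0) (Num.sqrt A).
    by apply: (@le_trans _ _ 0); rewrite ?subr_le0// mulr_ge0// (le_trans _ K3r)// mulr_ge0// exprn_ge0.
  (* As e2 <= 1, A0 >= e2 >= e2^2; this bounds the square roots away from 0 and makes their
     difference Lipschitz in A. *)
  have se : e2 <= Num.sqrt A0 + Num.sqrt A.
    apply: (@le_trans _ _ (Num.sqrt A0)); last by rewrite lerDl sqrtr_ge0.
    rewrite -(@ler_pXn2r _ 2) ?nnegrE ?sqrtr_ge0 ?(ltW e20)// sqr_sqrtr// (le_trans _ A0e)//.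
    by rewrite expr2 ler_piMl// ltW.
  have : (Num.sqrt A0 - Num.sqrt A) * e2 <= 2 * (K ^+ 2 * r).
    apply: (@le_trans _ _ ((Num.sqrt A0 - Num.sqrt A) * (Num.sqrt A0 + Num.sqrt A))).
      by rewrite ler_wpM2l// subr_ge0 ltW.
    rewrite -subr_sqr !sqr_sqrtr// /A0 /A.
    by move: D1; rewrite ler_norml => /andP[? ?]; lra.
  rewrite -ler_pdivlMr// => /le_trans; apply.
  by rewrite -mulrA ler_pM2l// /X [leRHS]mulrAC ler_wpM2r// invr_ge0 ltW.
have gi : g0^-1 - g^-1 <= 3 * (K ^+ 2 * r).
  have gp : 0 < g by apply: lt_le_trans g1.
  have g0p : 0 < g0 by apply: lt_le_trans g01.
  have gg : g - g0 <= 3 * (K ^+ 2 * r).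
    by move: D3 vv; rewrite !ler_norml /g /g0 => /andP[? ?] /andP[? ?]; lra.
  have -> : g0^-1 - g^-1 = (g - g0) / (g * g0) by field; rewrite !gt_eqF.
  have K2r0 : 0 <= K ^+ 2 * r by rewrite mulr_ge0 ?exprn_ge0.
  rewrite ler_pdivrMr ?mulr_gt0// (le_trans gg)// ler_peMr ?mulr_ge0//.
  by rewrite -[1]mulr1 ler_pM.
have t1 : (Num.sqrt A0 - Num.sqrt A) / g0 <= 2 * X.
  have g0p : 0 < g0 by apply: lt_le_trans g01.
  rewrite ler_pdivrMr// (le_trans sq)// ler_peMr// mulr_ge0// (le_trans _ K3r)// mulr_ge0// exprn_ge0//.
have t2 : Num.sqrt A * (g0^-1 - g^-1) <= 6 * X.
  apply: (@le_trans _ _ (2 * K * (3 * (K ^+ 2 * r)))); last first.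
    by rewrite (_ : _ * _ = 6 * (K ^+ 3 * r)); [rewrite ler_pM2l|ring].
  apply: (@le_trans _ _ (Num.sqrt A * (3 * (K ^+ 2 * r)))).
    by rewrite ler_wpM2l// sqrtr_ge0.
  by rewrite ler_wpM2r// mulr_ge0// mulr_ge0// exprn_ge0.
have t3 : b * (dotc z y - dotc z0 y0) <= 2 * X.
  have X0 : 0 <= 2 * X by rewrite mulr_ge0// (le_trans _ K3r)// mulr_ge0// exprn_ge0.
  apply: (@le_trans _ _ (b * (2 * X))); last by rewrite ler_piMl.
  by rewrite ler_wpM2l//; move: D2; rewrite ler_norml => /andP[? ?]; lra.
have -> : 10 * K ^+ 3 / e2 * r = 10 * X by rewrite /X; ring.
have e : Num.sqrt A0 / g0 - Num.sqrt A / g = (Num.sqrt A0 - Num.sqrt A) / g0 + Num.sqrt A * (g0^-1 - g^-1).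
  by ring.
move: t1 t2 t3 e; rewrite (mulrBr b).
move: (Num.sqrt A0 / g0) (Num.sqrt A / g) (_ / g0) (Num.sqrt A * _) (b * _) (b * _) => x1 x2 x3 x4 x5 x6.
lra.
Qed.

Lemma bellman_weight_le1 (gm : R) : 1 <= gm -> 0 <= 2 / 5 / gm ^+ 2 <= 1.
Proof.
move=> gm1; have G1 : 1 <= gm ^+ 2 by rewrite exprn_ege1.
rewrite divr_ge0 ?(le_trans ler01 G1)//= ler_pdivrMr ?(lt_le_trans ltr01 G1)//.
by rewrite mul1r (le_trans _ G1)//; lra.
Qed.

(* [u] is almost convex in [log r], with an error of order [r h ^+ 3] for the
   step [h]; adding [kap * r], whose second difference is [kap r h ^+ 2], makes it
   convex.  Being bounded as [log r] tends to [-oo], it is nondecreasing. *)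
Lemma radial_convexity (u : R -> R) (E D B : R) : 0 <= E -> 0 <= D -> 0 <= B ->
  (forall h r, 0 <= h -> h <= 2^-1 -> D * h <= 1 -> 0 <= r -> r * (1 + h) <= 1 ->
     - (E * r * h ^+ 3) <= u (r * (1 + h)) + u (r / (1 + h)) - 2 * u r) ->
  (forall r, 0 <= r <= 1 -> u 0 <= u r + B * r) ->
  (forall r, 0 <= r <= 1 -> u r <= u 0 + B * r) ->
  u 0 <= u 1.
Proof.
move=> E0 D0 B0 step low up.
apply/ler_addgt0Pr => eps eps0.
pose kap := Num.min (eps / 2) 1.
have e20 : 0 < eps / 2 by rewrite divr_gt0.
have kap0 : 0 < kap by rewrite lt_min e20 ltr01.
have kap1 : kap <= 1 by rewrite ge_min lexx orbT.
have kape : kap <= eps / 2 by rewrite ge_min lexx.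
pose M := E + D + 2.
have M2 : 2 <= M by rewrite /M lerDr addr_ge0.
have M0 : 0 < M by apply: lt_le_trans M2.
(* Thus M h = kap / 2. Since E <= M, the error E r h^3 is at most kap r h^2 / 2, below the second
   difference kap r h^2 / (1 + h) of kap r; since D <= M and 2 <= M, the step also satisfies D h <=
   1 and h <= 1/2. *)
pose h := kap / (2 * M).
have h0 : 0 < h by rewrite divr_gt0// mulr_gt0.
have hM : 2 * (M * h) = kap by rewrite mulrA /h mulrC divfK// gt_eqF// mulr_gt0.
have Mh2 : 2 * h <= M * h by rewrite ler_wpM2r// ltW.
have EM : E * h <= M * h by rewrite ler_wpM2r ?(ltW h0)// /M; lra.
have DM : D * h <= M * h by rewrite ler_wpM2r ?(ltW h0)// /M; lra.
have h2 : h <= 2^-1 by lra.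
have Dh : D * h <= 1 by lra.
have rho0 : 0 < 1 + h by rewrite addr_gt0.
pose r_ (j : nat) := (1 + h)^-1 ^+ j.
have rV1 : 0 <= (1 + h)^-1 <= 1 by rewrite invr_ge0 (ltW rho0)/= invf_le1// lerDl ltW.
have r01 j : 0 <= r_ j <= 1.
  have /andP[? ?] := rV1.
  by rewrite exprn_ge0//= exprn_ile1.
have rS j : r_ j.+1 * (1 + h) = r_ j by rewrite /r_ exprSr divfK// gt_eqF.
pose w j := u (r_ j) + kap * r_ j.
have wB j : w j <= u 0 + B + kap.
  have /andP[a0 a1] := r01 j; rewrite /w lerD//; last by rewrite ler_piMr// ltW.
  by rewrite (le_trans (up _ (r01 j)))// lerD2l ler_piMr.
have wc j : 2 * w j.+1 <= w j + w j.+2.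
  have /andP[a0 a1] := r01 j.+1.
  have a2 : r_ j.+1 * (1 + h) <= 1 by rewrite rS; have /andP[] := r01 j.
  have := step h (r_ j.+1) (ltW h0) h2 Dh a0 a2.
  have -> : r_ j.+1 / (1 + h) = r_ j.+2 by rewrite /r_ [RHS]exprSr.
  rewrite rS /w.
  have e1 : kap * r_ j + kap * r_ j.+2 - 2 * (kap * r_ j.+1) = kap * r_ j.+1 * (h ^+ 2 / (1 + h)).
    rewrite -(rS j) (_ : r_ j.+2 = r_ j.+1 / (1 + h)); last by rewrite /r_ [LHS]exprSr.
    by field; rewrite gt_eqF.
  have e2 : h ^+ 2 / 2 <= h ^+ 2 / (1 + h).
    by rewrite ler_wpM2l ?exprn_ge0 ?(ltW h0)// lef_pV2 ?posrE//; lra.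
  have e3 : kap * r_ j.+1 * (h ^+ 2 / 2) <= kap * r_ j.+1 * (h ^+ 2 / (1 + h)).
    by rewrite ler_wpM2l// mulr_ge0// ltW.
  have e4 : E * r_ j.+1 * h ^+ 3 <= kap * r_ j.+1 * (h ^+ 2 / 2).
    have -> : E * r_ j.+1 * h ^+ 3 = r_ j.+1 * h ^+ 2 * (E * h) by ring.
    have -> : kap * r_ j.+1 * (h ^+ 2 / 2) = r_ j.+1 * h ^+ 2 * (M * h) by rewrite -hM; field.
    by rewrite ler_wpM2l// mulr_ge0// exprn_ge0// ltW.
  move: e1 e3 e4; move: (kap * r_ j) (kap * r_ j.+2) (kap * r_ j.+1 * (h ^+ 2 / (1 + h)))
    (kap * r_ j.+1 * (h ^+ 2 / 2)) (E * _ * _) (kap * r_ j.+1) => x1 x2 x3 x4 x5 x6.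
  lra.
have wle := convex_bounded_nonincreasing wB wc.
have bern j : 1 + j%:R * h <= (1 + h) ^+ j.
  elim: j => [|j IH]; first by rewrite mul0r addr0 expr0.
  rewrite exprS -natr1; apply: (@le_trans _ _ ((1 + h) * (1 + j%:R * h))).
    have : 0 <= j%:R * h ^+ 2 by rewrite mulr_ge0 ?sqr_ge0.
    by move: (j%:R) => c; lra.
  by rewrite ler_wpM2l// ltW.
(* [j] steps bring the radius (1 + h)^-j below eps / (2 B), by Bernoulli's inequality. One half of
   eps pays for [B * r_ j], the other half for [kap]. *)
pose t := B / (eps / 2 * h).
have := truncnS_gt t; set j := (Num.truncn t).+1 => tj.
have Brj : B * r_ j <= eps / 2.
  rewrite /r_ exprVn ler_pdivrMr ?exprn_gt0//.
  apply: (@le_trans _ _ (eps / 2 * (j%:R * h))); last first.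
    by rewrite ler_wpM2l ?(ltW e20)// (le_trans _ (bern j))// lerDr.
  have eh0 : 0 < eps / 2 * h by exact: mulr_gt0.
  move: tj; rewrite /t ltr_pdivrMr// => /ltW /le_trans; apply.
  by rewrite mulrCA mulrA.
have := wle j; rewrite /w {3 4}/r_ expr0 mulr1.
have := low _ (r01 j); have /andP[a0 _] := r01 j.
have : 0 <= kap * r_ j by rewrite mulr_ge0// ltW.
move: (kap * r_ j) (B * r_ j) Brj => x1 x2; lra.
Qed.

End bellman_dist.

(** * Monotonicity in the radius of one coordinate *)

Section radial_step.
Variables (R : realType) (k : nat).
Local Notation C := R[i].
Local Notation normc := Normc.normc.

Definition cpoly (J : Type) (s : seq J) (m : J -> nat) (al : J -> TN R -> C)
  (x : TN R) (w : C) : C := \sum_(j <- s) al j x * w ^+ m j.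

(** The degree in [w] is also the frequency in x_k, so translating x_k amounts to rotating [w]. Two
    of the star points then become translations, which do not change expectations. *)
Definition rotating (J : Type) (m : J -> nat) (al : J -> TN R -> C) : Prop :=
  forall j t x, al j (translate k t x) = al j x * expi (2 * pi * t) ^+ m j.

Lemma cpoly_translate (J : Type) (s : seq J) m al t x (w : C) : rotating m al ->
  cpoly s m al (translate k t x) w = cpoly s m al x (w * expi (2 * pi * t)).
Proof.
by move=> rot; apply: eq_bigr => j _; rewrite rot exprMn; ring.
Qed.

Lemma cmbounded_cpoly (J : Type) (s : seq J) m al (w : C) :
  (forall j, cmbounded (al j)) -> cmbounded (fun x => cpoly s m al x w).
Proof.
by move=> mal; apply: cmbounded_sum => j; apply: cmboundedM => //; exact: cmbounded_cst.
Qed.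

Lemma Zperiodic_cpoly (J : Type) (s : seq J) m al (w : C) :
  (forall j, Zperiodic (al j)) -> Zperiodic (fun x => cpoly s m al x w).
Proof. by move=> pal x z; apply: eq_bigr => j _; rewrite pal. Qed.

Lemma cpoly_radial1 (J : Type) (s : seq J) m al x (r : R) :
  cpoly s m al x r%:C%C = radial_poly s (al^~ x) m r 1.
Proof. by apply: eq_bigr => j _; rewrite mulr1. Qed.

Variables (J J' : Type) (s : seq J) (s' : seq J') (m : J -> nat) (m' : J' -> nat).
Variables (al be : J -> TN R -> C) (ga : J' -> TN R -> C).
Variables (ba bb : J -> R) (bg : J' -> R) (e2 C0 : R).
Hypotheses (hal : forall j, cmbounded (al j)) (hbe : forall j, cmbounded (be j))
  (hga : forall j, cmbounded (ga j)).
Hypotheses (pal : forall j, Zperiodic (al j)) (pbe : forall j, Zperiodic (be j))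
  (pga : forall j, Zperiodic (ga j)).
Hypotheses (bal : forall j x, normc (al j x) <= ba j)
  (bbe : forall j x, normc (be j x) <= bb j) (bga : forall j x, normc (ga j x) <= bg j).
Hypotheses (ral : rotating m al) (rbe : rotating m be) (rga : rotating m' ga).
Hypotheses (e20 : 0 < e2) (e21 : e2 <= 1) (C00 : 0 <= C0).

Let f x w := cpoly s m al x w.
Let phi x w := cpoly s m be x w.
Let v x w := complex.Re (cpoly s' m' ga x w).

Hypothesis HG : forall x (r : R), 0 <= r <= 1 ->
  `|v x r%:C%C - dotc (phi x r%:C%C) (phi x r%:C%C)| <= C0.

(** With |V - |Phi|^2| <= C0, the denominator L + V - |Phi|^2 lies in [1, 2 C0 + 1], and [gm] is its
    upper bound. *)
Let L := C0 + 1.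
Let gm := 2 * C0 + 1.
Let b := 2 / 5 / gm ^+ 2.

Let W x w := bellman e2 L b (f x w) (phi x w) (v x w).

(** One constant for the three families of coefficients, with the weights required in the estimates
    at the star points; the summand 1 ensures [1 <= K]. *)
Let K : R := \sum_(j <- s) ba j * (42 * 4 ^+ m j) + \sum_(j <- s) bb j * (42 * 4 ^+ m j)
   + \sum_(j <- s') bg j * (42 * 4 ^+ m' j) + 1.

Let bound_sum (I : Type) (t : seq I) (p : I -> nat) (th : I -> TN R -> C) (bt : I -> R) x :
  (forall j x, normc (th j x) <= bt j) ->
  \sum_(j <- t) normc (th j x) * (42 * 4 ^+ p j) <= \sum_(j <- t) bt j * (42 * 4 ^+ p j).
Proof. by move=> H; apply: ler_sum => j _; rewrite ler_wpM2r// mulr_ge0// exprn_ge0. Qed.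

Let bound_ge0 (I : Type) (t : seq I) (p : I -> nat) (th : I -> TN R -> C) (bt : I -> R) :
  (forall j x, normc (th j x) <= bt j) -> 0 <= \sum_(j <- t) bt j * (42 * 4 ^+ p j).
Proof.
move=> H; apply: sumr_ge0 => j _; rewrite mulr_ge0 ?mulr_ge0 ?exprn_ge0//.
exact: le_trans (normc_ge0 _) (H j (fun=> 0)).
Qed.

Let alK x : \sum_(j <- s) normc (al j x) * (42 * 4 ^+ m j) <= K.
Proof.
apply: le_trans (bound_sum _ _ x bal) _.
have h1 := bound_ge0 s m bbe; have h2 := bound_ge0 s' m' bga; rewrite /K.
by rewrite -!addrA lerDl !addr_ge0.
Qed.

Let beK x : \sum_(j <- s) normc (be j x) * (42 * 4 ^+ m j) <= K.
Proof.
apply: le_trans (bound_sum _ _ x bbe) _.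
have h1 := bound_ge0 s m bal; have h2 := bound_ge0 s' m' bga; rewrite /K.
by rewrite -addrA [X in _ <= X + _]addrC -addrA lerDl !addr_ge0.
Qed.

Let gaK x : \sum_(j <- s') normc (ga j x) * (42 * 4 ^+ m' j) <= K.
Proof.
apply: le_trans (bound_sum _ _ x bga) _.
have h1 := bound_ge0 s m bbe; have h2 := bound_ge0 s m bal; rewrite /K.
by rewrite -addrA addrCA lerDl !addr_ge0.
Qed.

Let K1 : 1 <= K.
Proof.
have h1 := bound_ge0 s m bbe; have h2 := bound_ge0 s m bal; have h3 := bound_ge0 s' m' bga.
by rewrite /K lerDr !addr_ge0.
Qed.

Let g x w := L + v x w - dotc (phi x w) (phi x w).

Let g_bounds x (r : R) : 0 <= r <= 1 -> 1 <= g x r%:C%C <= gm.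
Proof.
move=> /(HG x); rewrite ler_norml /g /L /gm => /andP[h1 h2].
by apply/andP; split; lra.
Qed.

Section small_step.
Variable h : R.
Hypotheses (h0 : 0 <= h) (h2 : h <= 2^-1) (hK : 80 * K ^+ 2 * h <= e2).

Let tau : R := asin h / (2 * pi).

Let h11 : -1 <= h <= 1.
Proof.
have a0 := h0; have a1 := h2.
by apply/andP; split; lra.
Qed.

Let expi_tau : expi (2 * pi * tau) = (Num.sqrt (1 - h ^+ 2) +i* h)%C.
Proof.
have -> : 2 * pi * tau = asin h.
  by rewrite /tau mulrC divfK// mulf_neq0// gt_eqF// pi_gt0.
by rewrite /expi cos_asin// asinK// in_itv.
Qed.

Let expi_tauN : expi (2 * pi * (- tau)) = (Num.sqrt (1 - h ^+ 2) -i* h)%C.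
Proof. by rewrite mulrN -conjc_expi expi_tau. Qed.

(** For the dilations the radius stays in [0, 1]. For the rotations the value is the one at radius
    [r] over a translated point, where the bound holds as well. *)
Let g_star (r : R) x (i : 'I_4) : 0 <= r -> r * (1 + h) <= 1 ->
  1 <= g x (r%:C%C * star_point h i).
Proof.
move=> r0 rh; have a0 := h0.
have rle : r <= 1 by apply: le_trans rh; rewrite ler_peMr// lerDl.
have r01 : 0 <= r <= 1 by rewrite r0.
case: i => -[|[|[|[|//]]]] /= ?; rewrite /star_point/=.
- have rh01 : 0 <= r * (1 + h) <= 1 by rewrite rh mulr_ge0// addr_ge0.
  by rewrite -rmorphM; have /andP[] := g_bounds x rh01.
- rewrite -expi_tau /g /v /phi -!cpoly_translate//.
  by have /andP[] := g_bounds (translate k tau x) r01.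
- have rh01 : 0 <= r / (1 + h) <= 1.
    by rewrite divr_ge0 ?addr_ge0//= ler_pdivrMr ?ltr_wpDr// mul1r (le_trans rle)// lerDl.
  by rewrite -rmorphM; have /andP[] := g_bounds x rh01.
- rewrite -expi_tauN /g /v /phi -!cpoly_translate//.
  by have /andP[] := g_bounds (translate k (- tau) x) r01.
Qed.

(** An instance of [four_points]. Nothing is asked of the individual increments of [v] beyond the
    bounds on the denominator: as the real part of a polynomial it is harmonic, and its four
    increments add up to O(r h^3). *)
Let W_star (r : R) x : 0 <= r -> r * (1 + h) <= 1 ->
  - (150 * K ^+ 5 * r * h ^+ 3 / e2 ^+ 2) <=
  \sum_(i < 4) (W x (r%:C%C * star_point h i) - W x r%:C%C).
Proof.
move=> r0 rh; have a0 := h0; have a1 := h2.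
have rle : r <= 1 by apply: le_trans rh; rewrite ler_peMr// lerDl.
have r01 : 0 <= r <= 1 by rewrite r0.
pose RP (I : Type) (t : seq I) p (th : I -> TN R -> C) := radial_poly t (th^~ x) p r.
pose RD (I : Type) (t : seq I) p (th : I -> TN R -> C) := radial_deriv t (th^~ x) p r.
have RPE (I : Type) (t : seq I) p (th : I -> TN R -> C) (z : C) :
  cpoly t p th x (r%:C%C * z) = RP I t p th z by [].
have RPE1 (I : Type) (t : seq I) p (th : I -> TN R -> C) :
  cpoly t p th x r%:C%C = RP I t p th 1 by rewrite -RPE mulr1.
pose E (I : Type) (t : seq I) p (th : I -> TN R -> C) (i : 'I_4) :=
  RP I t p th (star_point h i) - RP I t p th 1 - h%:C%C * ('i%C ^+ i * RD I t p th).
have sE (I : Type) (t : seq I) p (th : I -> TN R -> C) :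
    \sum_i E I t p th i = \sum_i (RP I t p th (star_point h i) - RP I t p th 1).
  by rewrite sumrB -mulr_sumr sum_iX mulr0 subr0.
have EE (I : Type) (t : seq I) p (th : I -> TN R -> C) i : RP I t p th 1 +
    (h%:C%C * ('i%C ^+ (i : 'I_4) * RD I t p th) + E I t p th i) = RP I t p th (star_point h i).
  by rewrite /E; ring.
pose dv (i : 'I_4) := v x (r%:C%C * star_point h i) - v x r%:C%C.
have := @four_points R K r h e2 L gm b (RP _ s m al 1) (RD _ s m al) (RP _ s m be 1) (RD _ s m be)
  (v x r%:C%C) (E _ s m al) (E _ s m be) dv K1 r01.
rewrite /W /f /phi !RPE1.
set GG := bellman _ _ _ (RP _ s m al 1) _ _.
move=> H.
rewrite (eq_bigr (fun i : 'I_4 => bellman e2 L b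
  (RP _ s m al 1 + (h%:C%C * ('i%C ^+ i * RD _ s m al) + E _ s m al i))
  (RP _ s m be 1 + (h%:C%C * ('i%C ^+ i * RD _ s m be) + E _ s m be i))
  (v x r%:C%C + dv i) - GG)); last first.
  by move=> i _; rewrite !RPE !EE /dv (addrC (v x r%:C%C)) subrK.
apply: H => //.
- by rewrite h0 (le_trans h2)// invf_le1// ler1n.
- exact: (radial_poly1_le r01 (alK x)).
- exact: (radial_poly1_le r01 (beK x)).
- exact: (radial_deriv_le r01 (alK x)).
- exact: (radial_deriv_le r01 (beK x)).
- by move=> i; exact: (radial_poly_incr h0 h2 r01 (alK x)).
- by move=> i; exact: (radial_poly_incr h0 h2 r01 (beK x)).
- by rewrite sE; exact: (radial_poly_sum h0 h2 r01 (alK x)).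
- by rewrite sE; exact: (radial_poly_sum h0 h2 r01 (beK x)).
- have := radial_poly_sum h0 h2 r01 (gaK x).
  rewrite (_ : \sum_i dv i = complex.Re (\sum_i (RP _ s' m' ga (star_point h i) - RP _ s' m' ga 1))).
    by apply: le_trans; exact: le_trans (ler_norm _) (ler_Re_normc _).
  rewrite Re_sum; apply: eq_bigr => i _.
  by rewrite /dv /v RPE1 RPE; case: (RP _ _ _ _ _) => ? ?; case: (RP _ _ _ _ _).
- by rewrite -RPE1; exact: (g_bounds x r01).
- move=> i; rewrite EE -RPE /dv (addrC (v x r%:C%C)) subrK.
  exact: g_star.
Qed.

Lemma bellman_star_ge (r : R) x : 0 <= r -> r * (1 + h) <= 1 ->
  - (150 * K ^+ 5 * r * h ^+ 3 / e2 ^+ 2) <=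
  W x (r * (1 + h))%:C%C + W x (r / (1 + h))%:C%C +
  (W (translate k tau x) r%:C%C + W (translate k (- tau) x) r%:C%C) - 4 * W x r%:C%C.
Proof.
move=> r0 rh; have := W_star x r0 rh; move=> /le_trans; apply.
rewrite !big_ord_recl big_ord0.
have -> : star_point h ord0 = (1 + h)%:C%C by [].
have -> : star_point h (lift ord0 ord0) = (Num.sqrt (1 - h ^+ 2) +i* h)%C by [].
have -> : star_point h (lift ord0 (lift ord0 ord0)) = ((1 + h)^-1)%:C%C by [].
have -> : star_point h (lift ord0 (lift ord0 (lift ord0 ord0))) = (Num.sqrt (1 - h ^+ 2) -i* h)%C by [].
rewrite -expi_tau -expi_tauN -!rmorphM.
have WT t : W x (r%:C%C * expi (2 * pi * t)) = W (translate k t x) r%:C%C.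
  by rewrite /W /f /phi /v !cpoly_translate.
rewrite !WT.
move: (W x (r * (1 + h))%:C%C) (W x (r / (1 + h))%:C%C) (W (translate k tau x) r%:C%C)
  (W (translate k (- tau) x) r%:C%C) (W x r%:C%C) => *.
lra.
Qed.

End small_step.

Let mW (w : C) : (forall x, 1 <= g x w) -> mbounded (W^~ w).
Proof.
move=> g1.
have mf : cmbounded (f^~ w) by exact: cmbounded_cpoly.
have mphi : cmbounded (phi^~ w) by exact: cmbounded_cpoly.
have mv : mbounded (v^~ w) by apply: (@cmbounded_cpoly _ s' m' ga _ hga).1.
apply: mboundedB; last by apply: mboundedM; [exact: mbounded_cst|exact: mbounded_dotc].
apply: mboundedM.
  apply: mbounded_sqrt; apply: mboundedD; last exact: mbounded_cst.
  exact: mbounded_dotc.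
apply: mbounded_inv; first by [].
apply: mboundedB; last exact: mbounded_dotc.
by apply: mboundedD => //; exact: mbounded_cst.
Qed.

Let WT t x (w : C) : W (translate k t x) w = W x (w * expi (2 * pi * t)).
Proof. by rewrite /W /f /phi /v !cpoly_translate. Qed.

Let mWr (r : R) : 0 <= r <= 1 -> mbounded (W^~ r%:C%C).
Proof. by move=> r01; apply: mW => x; have /andP[] := g_bounds x r01. Qed.

Let pW (r : R) : Zperiodic (fun x => W x r%:C%C).
Proof.
move=> x z; rewrite /W /f /phi /v.
by rewrite (Zperiodic_cpoly s m _ pal) (Zperiodic_cpoly s m _ pbe) (Zperiodic_cpoly s' m' _ pga).
Qed.

Let Ex_step (r h : R) : 0 <= h -> h <= 2^-1 -> 80 * K ^+ 2 * h <= e2 ->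
  0 <= r -> r * (1 + h) <= 1 ->
  - (150 * K ^+ 5 * r * h ^+ 3 / e2 ^+ 2) <=
  Ex (W^~ (r * (1 + h))%:C%C) + Ex (W^~ (r / (1 + h))%:C%C) - 2 * Ex (W^~ r%:C%C).
Proof.
move=> h0 h2 hK r0 rh.
have rle : r <= 1 by apply: le_trans rh; rewrite ler_peMr// lerDl.
have r01 : 0 <= r <= 1 by rewrite r0.
have m1 : mbounded (W^~ (r * (1 + h))%:C%C) by apply: mWr; rewrite rh mulr_ge0// addr_ge0.
have m2 : mbounded (W^~ (r / (1 + h))%:C%C).
  by apply: mWr; rewrite divr_ge0 ?addr_ge0//= ler_pdivrMr ?ltr_wpDr// mul1r (le_trans rle)// lerDl//.
have m0 := mWr r01.
have mt t : mbounded (fun x => W (translate k t x) r%:C%C).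
  rewrite (_ : (fun x => _) = W^~ (r%:C%C * expi (2 * pi * t))); last by apply/funext => x; rewrite WT.
  apply: mW => x; rewrite /g /v /phi -!cpoly_translate//.
  by have /andP[] := g_bounds (translate k t x) r01.
set tau := asin h / (2 * pi).
exact: (Ex_five_ge m1 m2 (mt tau) (mt (- tau)) m0 (Ex_translate k tau m0 (pW r))
  (Ex_translate k (- tau) m0 (pW r)) (fun x => bellman_star_ge h0 h2 hK x r0 rh)).
Qed.

Let cpoly0_dist (I : Type) (t : seq I) p (th : I -> TN R -> C) x (r : R) :
  0 <= r <= 1 -> \sum_(j <- t) normc (th j x) * (42 * 4 ^+ p j) <= K ->
  normc (cpoly t p th x r%:C%C - cpoly t p th x (0 : R)%:C%C) <= K * r.
Proof.
move=> r01 H; by have := radial_poly1_0 r01 H; rewrite -cpoly_radial1.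
Qed.

Let cpoly_norm (I : Type) (t : seq I) p (th : I -> TN R -> C) x (r : R) :
  0 <= r <= 1 -> \sum_(j <- t) normc (th j x) * (42 * 4 ^+ p j) <= K ->
  normc (cpoly t p th x r%:C%C) <= K.
Proof.
move=> r01 H; by have := radial_poly1_le r01 H; rewrite -cpoly_radial1.
Qed.

Let b01 : 0 <= b <= 1.
Proof. by apply: bellman_weight_le1; rewrite /gm lerDr mulr_ge0. Qed.

Let v_dist (r : R) x : 0 <= r <= 1 -> `|v x r%:C%C - v x (0 : R)%:C%C| <= K * r.
Proof.
move=> r01.
have -> : v x r%:C%C - v x (0 : R)%:C%C = complex.Re (cpoly s' m' ga x r%:C%C - cpoly s' m' ga x (0 : R)%:C%C).
  by rewrite /v; case: (cpoly _ _ _ _ _) => ? ?; case: (cpoly _ _ _ _ _).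
by apply: le_trans (ler_Re_normc _) _; exact: cpoly0_dist r01 (gaK x).
Qed.

Let z01 : 0 <= (0 : R) <= 1. Proof. by rewrite lexx ler01. Qed.

Let W_dist (r : R) x : 0 <= r <= 1 ->
  W x (0 : R)%:C%C <= W x r%:C%C + 10 * K ^+ 3 / e2 * r /\
  W x r%:C%C <= W x (0 : R)%:C%C + 10 * K ^+ 3 / e2 * r.
Proof.
move=> r01.
have /andP[gr1 _] := g_bounds x r01; have /andP[g01 _] := g_bounds x z01.
have n1 := cpoly_norm r01 (alK x); have n2 := cpoly_norm z01 (alK x).
have n3 := cpoly_norm r01 (beK x); have n4 := cpoly_norm z01 (beK x).
have n5 := cpoly0_dist r01 (alK x); have n6 := cpoly0_dist r01 (beK x).
have n7 := v_dist x r01.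
split; first exact: (bellman_dist K1 r01 e20 e21 n1 n2 n3 n4 n5 n6 n7 gr1 g01 b01).
rewrite -normcN opprB in n5; rewrite -normcN opprB in n6; rewrite distrC in n7.
exact: (bellman_dist K1 r01 e20 e21 n2 n1 n4 n3 n5 n6 n7 g01 gr1 b01).
Qed.

Let Ex_dist (r : R) : 0 <= r <= 1 ->
  Ex (W^~ (0 : R)%:C%C) <= Ex (W^~ r%:C%C) + 10 * K ^+ 3 / e2 * r /\
  Ex (W^~ r%:C%C) <= Ex (W^~ (0 : R)%:C%C) + 10 * K ^+ 3 / e2 * r.
Proof.
move=> r01; have mr := mWr r01; have m0 := mWr z01.
have mc := mbounded_cst (10 * K ^+ 3 / e2 * r); split.
  have := le_Ex m0 (mboundedD mr mc) (fun x => (W_dist x r01).1).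
  by rewrite (ExD mr mc) Ex_cst.
have := le_Ex mr (mboundedD m0 mc) (fun x => (W_dist x r01).2).
by rewrite (ExD m0 mc) Ex_cst.
Qed.

Lemma Ex_bellman_radial : Ex (W^~ (0 : R)%:C%C) <= Ex (W^~ (1 : R)%:C%C).
Proof.
apply: (@radial_convexity R (fun r => Ex (W^~ r%:C%C)) (150 * K ^+ 5 / e2 ^+ 2)
  (80 * K ^+ 2 / e2) (10 * K ^+ 3 / e2)).
- by rewrite divr_ge0 ?mulr_ge0 ?exprn_ge0 ?(le_trans ler01 K1)// ltW.
- by rewrite divr_ge0 ?mulr_ge0 ?exprn_ge0 ?(le_trans ler01 K1)// ltW.
- by rewrite divr_ge0 ?mulr_ge0 ?exprn_ge0 ?(le_trans ler01 K1)// ltW.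
- move=> h r h0 h2 hK r0 rh.
  have hK' : 80 * K ^+ 2 * h <= e2 by move: hK; rewrite mulrAC ler_pdivrMr// mul1r.
  have := Ex_step h0 h2 hK' r0 rh; apply: le_trans.
  by rewrite le_eqVlt; apply/orP; left; apply/eqP; ring.
- exact: (fun r r01 => (Ex_dist r01).1).
- exact: (fun r r01 => (Ex_dist r01).2).
Qed.

End radial_step.

(** * The upper bound *)

Section hankel_estimate.
Variable R : realType.
Local Notation C := R[i].
Local Notation normc := Normc.normc.

Definition same_tail (k : nat) (n m : ZN) : bool :=
  `[< forall j, (k < j)%N -> n j = m j >].

(** The order by the last coordinate enters here: among the frequencies supported on the coordinates
    up to [k], all exponents of exp(2 pi i x_k) are nonnegative, so the partial sums are analytic in
    that variable. *)
Lemma gt_last_ge0 n k : gt_last n -> Zlow k.+1 n -> 0 <= n k.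
Proof.
move=> [j [nj nl]] nk; have [kj|jk|->] := ltngtP k j; last exact: ltW.
  by move: nj; rewrite nk ?ltxx.
by rewrite nl.
Qed.

Lemma gt_last_Zlow0 n : gt_last n -> ~ Zlow 0 n.
Proof. by move=> [j [nj _]] n0; move: nj; rewrite n0 ?ltxx. Qed.

Lemma Zlow_succ n k : (n \in Zlow k) = (n \in Zlow k.+1) && (n k == 0).
Proof.
apply/idP/andP; rewrite !in_setE.
  by move=> nk; split; [exact: ZlowW nk|rewrite nk].
move=> [nk /eqP n0] j; rewrite leq_eqVlt => /predU1P[<-//|]; exact: nk.
Qed.

Lemma same_tail_succ n m k :
  same_tail k n m = same_tail k.+1 n m && (n k.+1 == m k.+1).
Proof.
apply/asboolP/andP => [H|[/asboolP H /eqP E] j].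
  by split; [apply/asboolP => j jk; apply: H; exact: ltnW|apply/eqP; exact: H].
by rewrite leq_eqVlt => /predU1P[<-//|]; exact: H.
Qed.

Lemma same_tail_Zlow n m k : same_tail k n m -> (n \in Zlow k.+1) = (m \in Zlow k.+1).
Proof.
move=> /asboolP H; apply/idP/idP; rewrite !in_setE => L j jk; first by rewrite -H// L.
by rewrite H// L.
Qed.

Lemma Zlow_same_tail n m k : n \in Zlow k.+1 -> m \in Zlow k.+1 -> same_tail k n m.
Proof. by rewrite !in_setE => Ln Lm; apply/asboolP => j jk; rewrite Ln// Lm. Qed.

Section radial_functions.
Variables (S : seq ZN) (c : ZN -> C).
Hypothesis Sgt : forall n, n \in S -> gt_last n.

Definition radial_fun (b : ZN -> C) (k : nat) (r : R) (x : TN R) : C :=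
  \sum_(n <- S | n \in Zlow k.+1) (b n * echar n x) * (r%:C%C) ^+ `|n k|%N.

Definition pair_coef (n m : ZN) (x : TN R) : C :=
  (c n * conjc (c m)) * (echar n x * conjc (echar m x)).

Definition radial_energy (k : nat) (r : R) (x : TN R) : R :=
  \sum_(n <- S) \sum_(m <- S | same_tail k n m)
     complex.Re (pair_coef n m x) * r ^+ `|n k - m k|%N.

(** The value 0 for negative [n k] makes [rotating] true for every index, in [S] or not. *)
Let al (b : ZN -> C) (k : nat) (n : ZN) (x : TN R) : C :=
  if 0 <= n k then b n * echar n x else 0.

Let low (k : nat) : seq ZN := [seq n <- S | n \in Zlow k.+1].

Let radial_fun_cpoly b k (r : R) x :
  radial_fun b k r x = cpoly (low k) (fun n : ZN => `|n k|%N) (al b k) x r%:C%C.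
Proof.
rewrite /cpoly big_filter /radial_fun big_seq_cond [RHS]big_seq_cond.
apply: eq_bigr => n /andP[nS nk]; rewrite /al ifT//.
by apply: gt_last_ge0; [exact: Sgt|rewrite in_setE in nk].
Qed.

(** Conjugating when n_k < m_k preserves the real part and turns the frequency in x_k into |n_k -
    m_k|. The energy is thus the real part of a polynomial in [w]. *)
Let ga (k : nat) (p : ZN * ZN) (x : TN R) : C :=
  if p.2 k <= p.1 k then pair_coef p.1 p.2 x else conjc (pair_coef p.1 p.2 x).

Let pairs (k : nat) : seq (ZN * ZN) :=
  [seq p <- [seq (n, m) | n <- S, m <- S] | same_tail k p.1 p.2].

Let radial_energy_cpoly k (r : R) x :
  radial_energy k r x =
  complex.Re (cpoly (pairs k) (fun p : ZN * ZN => `|p.1 k - p.2 k|%N) (ga k) x r%:C%C).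
Proof.
rewrite /cpoly Re_sum big_filter big_mkcond big_allpairs /radial_energy.
apply: eq_bigr => n _; rewrite [LHS]big_mkcond; apply: eq_bigr => m _ /=.
case: ifP => // _; rewrite -rmorphXn /ga/=.
by case: ifP => _; case: (pair_coef n m x) => u w /=; rewrite mulr0 ?subr0 ?oppr0 ?mul0r ?mulNr ?mulr0 ?oppr0 ?subr0.
Qed.

Let al_rot b k : rotating k (fun n : ZN => `|n k|%N) (al b k).
Proof.
move=> n t x; rewrite /al; case: ifP => [n0|]; last by rewrite mul0r.
rewrite echar_translate mulrA -expi_natmul; congr (_ * expi (_ * _)).
by rewrite -{1}(gez0_abs n0).
Qed.

Let pair_coef_translate n m k t x : pair_coef n m (translate k t x) =
  pair_coef n m x * expi (((n k)%:~R - (m k)%:~R) * (2 * pi * t)).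
Proof.
rewrite /pair_coef !echar_translate conjcM [conjc (expi _)]conjc_expi mulrBl expiD.
by ring.
Qed.

Let ga_rot k : rotating k (fun p : ZN * ZN => `|p.1 k - p.2 k|%N) (ga k).
Proof.
move=> [n m] t x; rewrite /ga/=; case: ifPn => [mn|]; rewrite -expi_natmul pair_coef_translate.
  congr (_ * expi (_ * _)); rewrite -intrB -{1}(@gez0_abs (n k - m k)) ?subr_ge0//.
rewrite -ltNge => nm; rewrite conjcM conjc_expi; congr (_ * expi _).
rewrite -mulNr opprB -intrB; congr (_ * _).
by rewrite distnC -{1}(@gez0_abs (m k - n k)) ?subr_ge0 ?ltW.
Qed.

Let cmb_al b k n : cmbounded (al b k n).
Proof.
rewrite /al; case: (0 <= n k); last exact: cmbounded_cst.
by apply: cmboundedM; [exact: cmbounded_cst|exact: cmbounded_echar].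
Qed.

Let cmb_pair n m : cmbounded (pair_coef n m).
Proof.
apply: cmboundedM; first exact: cmbounded_cst.
by apply: cmboundedM; [|apply: cmbounded_conjc]; exact: cmbounded_echar.
Qed.

Let cmb_ga k p : cmbounded (ga k p).
Proof. by rewrite /ga; case: (p.2 k <= p.1 k) => //; exact: cmbounded_conjc. Qed.

Let per_al b k n : Zperiodic (al b k n).
Proof. by move=> x z; rewrite /al; case: ifP => // _; rewrite Zperiodic_echar. Qed.

Let per_ga k p : Zperiodic (ga k p).
Proof. by move=> x z; rewrite /ga /pair_coef !Zperiodic_echar. Qed.

Let bal b k n x : normc (al b k n x) <= normc (b n).
Proof.
rewrite /al; case: ifP => _; last by rewrite Normc.normc0 normc_ge0.
by rewrite Normc.normcM normc_echar mulr1.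
Qed.

Lemma normc_conjc (z : C) : normc (conjc z) = normc z.
Proof. by case: z => u w /=; rewrite sqrrN. Qed.

Lemma normc_pair_coef n m x : normc (pair_coef n m x) = normc (c n) * normc (c m).
Proof. by rewrite !Normc.normcM !normc_conjc !normc_echar !mulr1. Qed.

Let bga k p x : normc (ga k p x) <= normc (c p.1) * normc (c p.2).
Proof. by rewrite /ga; case: ifP => _; rewrite ?normc_conjc normc_pair_coef. Qed.

Lemma dotc_radial_fun k (r : R) x :
  dotc (radial_fun c k r x) (radial_fun c k r x) =
  \sum_(n <- S | n \in Zlow k.+1) \sum_(m <- S | m \in Zlow k.+1)
     complex.Re (pair_coef n m x) * r ^+ (`|n k| + `|m k|).
Proof.
rewrite /radial_fun dotc_suml; apply: eq_bigr => n _.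
rewrite dotc_sumr; apply: eq_bigr => m _.
rewrite dotcE !conjcM.
have -> : conjc (r%:C%C ^+ `|m k|) = r%:C%C ^+ `|m k| by rewrite -rmorphXn conjc_real.
rewrite [X in complex.Re X](_ : _ = pair_coef n m x * (r ^+ (`|n k| + `|m k|))%:C%C).
  by case: (pair_coef n m x) => u w /=; rewrite mulr0 subr0.
rewrite /pair_coef rmorphXn exprD.
by move: (r%:C%C ^+ _) (r%:C%C ^+ _) (echar _ _) (conjc _) (conjc _) => *; ring.
Qed.

Section estimate.
Variables (a : ZN -> C) (mu : ZN -> R).
Hypothesis cmu : forall n, normc (c n) <= mu n.
Hypothesis tailF : forall k,
  \sum_(n <- S | n \notin Zlow k.+1) \sum_(m <- S | same_tail k n m) mu n * mu m <= 1.
Hypothesis blockF : forall k b L : nat, (0 < b)%N ->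
  \sum_(1 <= l < L) (\sum_(b * l <= j < b * l.+1)
     \sum_(n <- S | (n \in Zlow k.+1) && (n k == j%:Z)) mu n) ^+ 2 <= 1.

Let mu0 n : 0 <= mu n. Proof. exact: le_trans (normc_ge0 _) (cmu n). Qed.

Let Re_pair_le n m x : `|complex.Re (pair_coef n m x)| <= mu n * mu m.
Proof.
by rewrite (le_trans (ler_Re_normc _))// normc_pair_coef ler_pM ?normc_ge0.
Qed.

(** Grouping the frequencies by n_k gives the form of [poisson_kernel_form_le] for the masses [nu].
    The kernel vanishes when one index is 0, so sums from 0 agree with sums from 1, and the mass at
    0, which the hypothesis does not bound, never enters. *)
Let low_part k (r : R) : 0 <= r <= 1 ->
  \sum_(n <- S | n \in Zlow k.+1) \sum_(m <- S | m \in Zlow k.+1)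
    mu n * mu m * (r ^+ `|n k - m k|%N - r ^+ (`|n k| + `|m k|)) <= 480.
Proof.
move=> r01; have [r0 r1] := andP r01.
pose nu j := \sum_(n <- S | (n \in Zlow k.+1) && (n k == j%:Z)) mu n.
have nu0 j : 0 <= nu j by apply: sumr_ge0.
pose N := (\max_(n <- S) `|n k|%N).+1.
have nN n : n \in S -> (`|n k| < N)%N by move=> nS; rewrite ltnS; exact: (@leq_bigmax_seq _ S xpredT (fun n : ZN => `|n k|%N) n nS isT).
have regroup (G : nat -> R) :
    \sum_(n <- S | n \in Zlow k.+1) mu n * G `|n k|%N = \sum_(0 <= i < N) nu i * G i.
  transitivity (\sum_(0 <= i < N) \sum_(n <- S)
      if (n \in Zlow k.+1) && (n k == i%:Z) then mu n * G i else 0); last first.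
    by apply: eq_bigr => i _; rewrite /nu mulr_suml [RHS]big_mkcond.
  rewrite exchange_big/= big_mkcond/= big_seq [RHS]big_seq; apply: eq_bigr => n nS.
  case: (boolP (n \in Zlow k.+1)) => nk /=; last by rewrite big1.
  have n0 : 0 <= n k by apply: gt_last_ge0; [exact: Sgt|rewrite in_setE in nk].
  rewrite (bigD1_seq `|n k|%N) ?iota_uniq ?mem_index_iota ?nN//= gez0_abs// eqxx.
  rewrite big1 ?addr0// => i ni; case: (n k =P i%:Z) => // E.
  by move: ni; rewrite E absz_nat eqxx.
have -> : \sum_(n <- S | n \in Zlow k.+1) \sum_(m <- S | m \in Zlow k.+1)
    mu n * mu m * (r ^+ `|n k - m k|%N - r ^+ (`|n k| + `|m k|)) =
  \sum_(0 <= i < N) \sum_(0 <= j < N) nu i * nu j * (r ^+ `|i%:Z - j%:Z|%N - r ^+ (i + j)).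
  transitivity (\sum_(n <- S | n \in Zlow k.+1) mu n *
      \sum_(0 <= j < N) nu j * (r ^+ (`|Posz `|n k|%N - j%:Z|%N) - r ^+ (`|n k| + j))).
    rewrite big_seq_cond [RHS]big_seq_cond; apply: eq_bigr => n /andP[nS nk].
    rewrite -(regroup (fun j => r ^+ (`|Posz `|n k|%N - j%:Z|%N) - r ^+ (`|n k| + j))) mulr_sumr.
    rewrite big_seq_cond [RHS]big_seq_cond; apply: eq_bigr => m /andP[mS mk].
    rewrite in_setE in nk; rewrite in_setE in mk.
    by rewrite !gez0_abs ?mulrA//; apply: gt_last_ge0 => //; exact: Sgt.
  rewrite (regroup (fun i => \sum_(0 <= j < N) nu j * (r ^+ `|i%:Z - j%:Z|%N - r ^+ (i + j)))).
  by apply: eq_bigr => i _; rewrite mulr_sumr; apply: eq_bigr => j _; rewrite mulrA.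
apply: le_trans (poisson_kernel_form_le N nu0 (blockF k) r01).
rewrite big_ltn// [X in X + _]big1 ?add0r; last first.
  by move=> j _; rewrite add0n distnC subr0 absz_nat subrr mulr0.
apply: ler_sum => i _; rewrite big_ltn// [X in X + _](_ : _ = 0) ?add0r//.
by rewrite addn0 subr0 absz_nat subrr mulr0.
Qed.

Let energy_bound k (r : R) x : 0 <= r <= 1 ->
  `|radial_energy k r x - dotc (radial_fun c k r x) (radial_fun c k r x)| <= 481.
Proof.
move=> r01; rewrite dotc_radial_fun /radial_energy.
rewrite (bigID (fun n => n \in Zlow k.+1))/= addrAC.
have -> : \sum_(n <- S | n \in Zlow k.+1) \sum_(m <- S | same_tail k n m)
     complex.Re (pair_coef n m x) * r ^+ `|n k - m k|%N =
   \sum_(n <- S | n \in Zlow k.+1) \sum_(m <- S | m \in Zlow k.+1)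
     complex.Re (pair_coef n m x) * r ^+ `|n k - m k|%N.
  apply: eq_bigr => n nk; apply: eq_bigl => m.
  apply/idP/idP => [/same_tail_Zlow <-//|]; exact: Zlow_same_tail.
rewrite -sumrB; apply: le_trans (ler_normD _ _) _.
rewrite (_ : 481 = 480 + 1); last by rewrite -natr1.
apply: lerD.
  apply: le_trans (low_part k r01); apply: le_trans (ler_norm_sum _ _ _) _.
  apply: ler_sum => n _; rewrite -sumrB; apply: le_trans (ler_norm_sum _ _ _) _.
  apply: ler_sum => m _; rewrite -mulrBr normrM ler_pM// ger0_norm//.
  rewrite subr_ge0; have [r0 r1] := andP r01; rewrite ler_wiXn2l//.
  by lia.
apply: le_trans (tailF k); apply: le_trans (ler_norm_sum _ _ _) _.
apply: ler_sum => n _; apply: le_trans (ler_norm_sum _ _ _) _.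
apply: ler_sum => m _; rewrite normrM -[leRHS]mulr1 ler_pM//.
have [r0 r1] := andP r01.
by rewrite ger0_norm ?exprn_ge0// exprn_ile1.
Qed.

Let C0 : R := 481.
Let b : R := 2 / 5 / (2 * C0 + 1) ^+ 2.
Let Om e2 k (r : R) x := bellman e2 (C0 + 1) b (radial_fun a k r x)
  (radial_fun c k r x) (radial_energy k r x).

Let Om_step e2 k : 0 < e2 -> e2 <= 1 -> Ex (Om e2 k 0) <= Ex (Om e2 k 1).
Proof.
move=> e20 e21.
have HG x (r : R) : 0 <= r <= 1 ->
  `|complex.Re (cpoly (pairs k) (fun p : ZN * ZN => `|p.1 k - p.2 k|%N) (ga k) x r%:C%C) -
    dotc (cpoly (low k) (fun n : ZN => `|n k|%N) (al c k) x r%:C%C)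
      (cpoly (low k) (fun n : ZN => `|n k|%N) (al c k) x r%:C%C)| <= C0.
  by move=> r01; rewrite -radial_energy_cpoly -radial_fun_cpoly; exact: energy_bound.
have C00 : 0 <= C0 by rewrite ler0n.
have H := Ex_bellman_radial (cmb_al a k) (cmb_al c k) (cmb_ga k) (per_al a k) (per_al c k)
  (per_ga k) (bal a k) (bal c k) (bga k) (al_rot a k) (al_rot c k) (ga_rot k) e20 e21 C00 HG.
have OmE r : Om e2 k r = fun x => bellman e2 (C0 + 1) b
   (cpoly (low k) (fun n : ZN => `|n k|%N) (al a k) x r%:C%C)
   (cpoly (low k) (fun n : ZN => `|n k|%N) (al c k) x r%:C%C)
   (complex.Re (cpoly (pairs k) (fun p : ZN * ZN => `|p.1 k - p.2 k|%N) (ga k) x r%:C%C)).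
  by apply/funext => x; rewrite /Om !radial_fun_cpoly radial_energy_cpoly.
by rewrite !OmE; exact: H.
Qed.

(** Since 0^0 = 1, radius 0 in the coordinate k + 1 keeps exactly the terms whose frequency vanishes
    there. *)
Let radial_fun_succ d k x : radial_fun d k 1 x = radial_fun d k.+1 0 x.
Proof.
rewrite /radial_fun big_mkcond [RHS]big_mkcond; apply: eq_bigr => n _.
rewrite (Zlow_succ n k.+1); case: (n \in Zlow k.+2) => //=.
rewrite expr0n absz_eq0; case: eqP => _; last by rewrite mulr0.
by rewrite rmorph1 expr1n.
Qed.

Let radial_energy_succ k x : radial_energy k 1 x = radial_energy k.+1 0 x.
Proof.
rewrite /radial_energy; apply: eq_bigr => n _.
rewrite big_mkcond [RHS]big_mkcond; apply: eq_bigr => m _.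
rewrite same_tail_succ; case: (same_tail k.+1 n m) => //=.
by rewrite expr0n absz_eq0 subr_eq0 expr1n; case: eqP => _; rewrite ?mulr0.
Qed.

Let Om_succ e2 k : Om e2 k 1 = Om e2 k.+1 0.
Proof. by apply/funext => x; rewrite /Om !radial_fun_succ radial_energy_succ. Qed.

Let Om_mono e2 k : 0 < e2 -> e2 <= 1 -> Ex (Om e2 0 0) <= Ex (Om e2 k 1).
Proof.
move=> e20 e21; elim: k => [|k IH]; first exact: Om_step.
by apply: (le_trans IH); rewrite Om_succ; exact: Om_step.
Qed.

Let g_ge1 k (r : R) x : 0 <= r <= 1 ->
  1 <= C0 + 1 + radial_energy k r x - dotc (radial_fun c k r x) (radial_fun c k r x).
Proof. by move=> /(energy_bound k x); rewrite ler_norml -/C0 => /andP[? ?]; lra. Qed.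

Let b0 : 0 <= b. Proof. by rewrite divr_ge0 ?exprn_ge0 ?addr_ge0 ?mulr_ge0 ?ler0n. Qed.

(** The chain of expectations starts at radius 0 in the coordinate 0, where F = 0 because no
    frequency of [S] is zero, so the Bellman function is nonnegative. It ends at a coordinate [K]
    beyond all supports, where the quotient is at most |f| + e because its denominator is at least
    1, and where the pairing integrates to the sum of coefficients by orthogonality. Then e tends to
    0. *)
Lemma sum_coef_le_Ex_normc : uniq S ->
  b * (\sum_(n <- S) complex.Re (a n * conjc (c n))) <=
  Ex (fun x => normc (\sum_(n <- S) a n * echar n x)).
Proof.
move=> uS; have [K HK] := Zlow_bound_seq S.
pose f d x := \sum_(n <- S) d n * echar n x : C.
have mf d : cmbounded (f d).
  by apply: cmbounded_sum => n; apply: cmboundedM; [exact: cmbounded_cst|exact: cmbounded_echar].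
have fE d x : radial_fun d K 1 x = f d x.
  rewrite /radial_fun /f big_mkcond big_seq [RHS]big_seq; apply: eq_bigr => n nS.
  rewrite ifT ?rmorph1 ?expr1n ?mulr1// in_setE; apply: ZlowW (HK _ nS); exact: leqnSn.
have dotE : Ex (fun x => dotc (f a x) (f c x)) = \sum_(n <- S) complex.Re (a n * conjc (c n)).
  rewrite (_ : (fun x => _) = fun x => \sum_(n <- S) \sum_(m <- S)
     complex.Re ((a n * conjc (c m)) * (echar n x * conjc (echar m x)))); last first.
    apply/funext => x; rewrite dotc_suml; apply: eq_bigr => n _.
    rewrite dotc_sumr; apply: eq_bigr => m _; rewrite dotcE conjcM.
    by congr complex.Re; rewrite mulrACA.
  have mp (n m : ZN) : mbounded (fun x : TN R => complex.Re ((a n * conjc (c m)) * (echar n x * conjc (echar m x)))).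
    suff : cmbounded (fun x : TN R => (a n * conjc (c m)) * (echar n x * conjc (echar m x))) by case.
    apply: cmboundedM; first exact: cmbounded_cst.
    by apply: cmboundedM; [|apply: cmbounded_conjc]; exact: cmbounded_echar.
  rewrite Ex_sum; last by move=> n; exact: mbounded_sum.
  rewrite big_seq [RHS]big_seq; apply: eq_bigr => n nS.
  rewrite Ex_sum// (bigD1_seq n)//= Ex_echar_orthogonal eqxx big1 ?addr0// => m mn.
  by rewrite Ex_echar_orthogonal eq_sym (negbTE mn).
apply/ler_addgt0Pr => eps eps0.
pose e := Num.min eps 1.
have e0 : 0 < e by rewrite lt_min eps0 ltr01.
have e1 : e <= 1 by rewrite ge_min lexx orbT.
have ee : e <= eps by rewrite ge_min lexx.
have e20 : 0 < e ^+ 2 by rewrite exprn_gt0.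
have e21 : e ^+ 2 <= 1 by rewrite expr_le1// ltW.
have Om0 : 0 <= Ex (Om (e ^+ 2) 0 0).
  apply: Rintegral_ge0 => x _; rewrite /Om /bellman.
  have z01 : 0 <= (0 : R) <= 1 by rewrite lexx ler01.
  have -> : radial_fun a 0 0 x = 0.
    rewrite /radial_fun big_seq_cond big1// => n /andP[nS n1].
    have : n 0%N != 0.
      apply/negP => n0; have := gt_last_Zlow0 (Sgt nS); apply.
      by rewrite -in_setE (Zlow_succ n 0) n1 n0.
    by rewrite -absz_eq0; case: `|n 0%N|%N => // p _; rewrite exprS rmorph0 mul0r mulr0.
  have d0 (z : C) : dotc 0 z = 0 by rewrite /dotc/= !mul0r addr0.
  rewrite !d0 mulr0 subr0 divr_ge0 ?sqrtr_ge0//.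
  exact: le_trans (g_ge1 0 x z01).
have o01 : 0 <= (1 : R) <= 1 by rewrite lexx ler01.
have mn : mbounded (fun x => normc (f a x)) by exact: mbounded_normc.
have md : mbounded (fun x => dotc (f a x) (f c x)) by exact: mbounded_dotc.
have mne := mboundedD mn (mbounded_cst e).
have mbd := mboundedM (mbounded_cst b) md.
have H : Ex (Om (e ^+ 2) K 1) <= Ex (fun x => (normc (f a x) + e) - b * dotc (f a x) (f c x)).
  have fE' d : radial_fun d K 1 = f d by apply/funext => x; exact: fE.
  have menergy : mbounded (radial_energy K 1).
    rewrite (_ : radial_energy K 1 = fun x => complex.Re (cpoly (pairs K)
       (fun p : ZN * ZN => `|p.1 K - p.2 K|%N) (ga K) x 1%:C%C)).
      by have [] := cmbounded_cpoly (pairs K) (fun p : ZN * ZN => `|p.1 K - p.2 K|%N) 1%:C%C (cmb_ga K).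
    by apply/funext => x; rewrite radial_energy_cpoly.
  have mg : mbounded (fun x => C0 + 1 + radial_energy K 1 x - dotc (f c x) (f c x)).
    by apply: mboundedB; [apply: mboundedD => //; exact: mbounded_cst|exact: mbounded_dotc].
  have g1 x : 1 <= C0 + 1 + radial_energy K 1 x - dotc (f c x) (f c x).
    by rewrite -fE'; exact: g_ge1.
  have ms : mbounded (fun x => Num.sqrt (dotc (f a x) (f a x) + e ^+ 2)).
    by apply: mbounded_sqrt; apply: mboundedD; [exact: mbounded_dotc|exact: mbounded_cst].
  have mOm : mbounded (Om (e ^+ 2) K 1).
    rewrite /Om !fE' /bellman; apply: mboundedB => //.
    by apply: mboundedM => //; exact: mbounded_inv.
  apply: le_Ex => //; first exact: mboundedB.
  move=> x; rewrite /Om !fE' /bellman lerD2r.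
  have gp : 0 < C0 + 1 + radial_energy K 1 x - dotc (f c x) (f c x) by apply: lt_le_trans (g1 x).
  have ne0 : 0 <= normc (f a x) + e by rewrite addr_ge0 ?normc_ge0// ltW.
  rewrite ler_pdivrMr//; apply: (@le_trans _ _ (normc (f a x) + e)); last by rewrite ler_peMr.
  rewrite -(@ler_pXn2r _ 2) ?nnegrE ?sqrtr_ge0//.
  rewrite sqr_sqrtr; last by rewrite addr_ge0 ?dotcc_ge0// ltW.
  rewrite -sqr_normc_dot sqrrD -addrA [X in _ <= _ + X]addrC lerD2l lerDl.
  by rewrite mulrn_wge0// mulr_ge0 ?normc_ge0// ltW.
have := le_trans Om0 (le_trans (Om_mono K e20 e21) H).
rewrite (ExB mne mbd) (ExZ b md) (ExD mn (mbounded_cst e)) Ex_cst dotE subr_ge0.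
by move=> /le_trans; apply; rewrite lerD2l.
Qed.

End estimate.
End radial_functions.
End hankel_estimate.

(** * From the two terms of Q to conditions on finite sets of frequencies *)

Section esum_seq.
Variable R : realType.
Local Open Scope ereal_scope.

Lemma sum_le_esum (T : choiceType) (D : set T) (a : T -> \bar R) (t : seq T) :
  uniq t -> (forall x, x \in t -> D x) -> \sum_(x <- t) a x <= \esum_(x in D) a x.
Proof.
move=> ut tD; apply: esum_ge; exists [set` t]; last by rewrite fsbig_seq.
by split; [exact: finite_seq|move=> x /=; exact: tD].
Qed.

Lemma esum_le_seq (T : choiceType) (D : set T) (a : T -> \bar R) (M : \bar R) :
  (forall t, uniq t -> (forall x, x \in t -> D x) -> \sum_(x <- t) a x <= M) ->
  \esum_(x in D) a x <= M.
Proof.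
move=> H; apply: ge_ereal_sup => _ [X [finX XD] <-].
rewrite fsbig_finite//; apply: H; first exact: fset_uniq.
by move=> x; rewrite in_fset_set// inE => /XD.
Qed.

Lemma sqrte_le_sqr (x : \bar R) (s : R) : (0 <= s)%R -> sqrte x <= s%:E -> x <= (s ^+ 2)%:E.
Proof.
case: x => [r| |]// s0; last by rewrite leNye.
rewrite /= !lee_fin => rs; have [r0|r0] := leP 0%R r.
  by rewrite -(sqr_sqrtr r0) ler_pXn2r ?nnegrE ?sqrtr_ge0.
by rewrite (le_trans (ltW r0))// sqr_ge0.
Qed.

End esum_seq.

Section quadratic_conditions.
Variables (R : realType) (lam : ZN -> R) (s : R) (S : seq ZN).
Hypotheses (lam0 : forall n, 0 <= lam n) (s0 : 0 < s).
Hypotheses (uS : uniq S).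

Definition zhi (k : nat) (n : ZN) : ZN := concat k ZN0 n.
Definition zlo (k : nat) (n : ZN) : ZN := concat k n ZN0.

Lemma ZN0E j : ZN0 j = 0. Proof. by rewrite /ZN0 fsfun0E. Qed.

Lemma concat_zlo_zhi k n : concat k (zlo k n) (zhi k n) = n.
Proof. by apply/fsfunP => j; rewrite !concatE; case: ltnP. Qed.

Lemma Zlow_zlo k n : Zlow k (zlo k n).
Proof. by move=> j kj; rewrite concatE ltnNge kj ZN0E. Qed.

Lemma Zhigh_zhi k n : Zhigh k (zhi k n).
Proof. by move=> j kj; rewrite concatE kj ZN0E. Qed.

Lemma zhi_eq0 k n : zhi k n = ZN0 -> Zlow k n.
Proof. by move=> /fsfunP H j kj; have := H j; rewrite concatE ltnNge kj ZN0E. Qed.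

Lemma same_tail_zhi k n m : same_tail k n m = (zhi k.+1 n == zhi k.+1 m).
Proof.
apply/asboolP/eqP => [H|/fsfunP H j kj].
  by apply/fsfunP => j; rewrite !concatE; case: ltnP => // /H.
by have := H j; rewrite !concatE ltnNge kj.
Qed.

Lemma concat_zlo_single k n : Zlow k.+1 n -> concat k (zlo k n) (single k (n k)) = n.
Proof.
move=> nk; apply/fsfunP => j; rewrite !concatE singleE.
by case: ltngtP => // [kj|->]; rewrite ?eqxx// nk.
Qed.

Section tail.
Hypothesis tailQ : forall k, (\esum_(v in Zhigh k `\ ZN0)
  (\esum_(u in Zlow k) (lam (concat k u v))%:E) ^+ 2 <= (s ^+ 2)%:E)%E.

(** Grouped by their common tail, the pairs give the sum of the squares [X v ^+ 2], and [X v] is a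
    partial sum of the inner sum in Q. The tail beyond the coordinate [k] is [zhi k.+1], so the
    level k + 1 of Q is used. *)
Lemma tail_condition k :
  \sum_(n <- S | n \notin Zlow k.+1) \sum_(m <- S | same_tail k n m)
    lam n / s * (lam m / s) <= 1.
Proof.
pose T := [seq n <- S | n \notin Zlow k.+1].
pose V := undup [seq zhi k.+1 n | n <- T].
pose X v := \sum_(n <- T | zhi k.+1 n == v) lam n.
have X0 v : 0 <= X v by apply: sumr_ge0.
have XE v : ((X v)%:E <= \esum_(u in Zlow k.+1) (lam (concat k.+1 u v))%:E)%E.
  pose t := [seq zlo k.+1 n | n <- [seq n <- T | zhi k.+1 n == v]].
  have -> : (X v)%:E = (\sum_(u <- t) (lam (concat k.+1 u v))%:E)%E.
    rewrite /t big_map big_filter /X -sumEFin; apply: eq_bigr => n /eqP <-.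
    by rewrite concat_zlo_zhi.
  apply: sum_le_esum; last by move=> u /mapP[n _ ->]; exact: Zlow_zlo.
  rewrite map_inj_in_uniq ?filter_uniq//.
  move=> n m; rewrite !mem_filter => /andP[/eqP hn _] /andP[/eqP hm _] nm.
  by rewrite -(concat_zlo_zhi k.+1 n) -(concat_zlo_zhi k.+1 m) nm hn hm.
have -> : \sum_(n <- S | n \notin Zlow k.+1) \sum_(m <- S | same_tail k n m)
    lam n / s * (lam m / s) = (\sum_(v <- V) X v ^+ 2) / s ^+ 2.
  transitivity ((\sum_(n <- T) lam n * X (zhi k.+1 n)) / s ^+ 2).
    rewrite mulr_suml big_filter; apply: eq_bigr => n nk.
    rewrite /X big_filter_cond mulr_sumr mulr_suml; apply: eq_big => m.
      rewrite eq_sym same_tail_zhi; case: eqP; rewrite ?andbF// => E.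
      by rewrite andbT; apply/esym; rewrite -(@same_tail_Zlow n) ?nk// same_tail_zhi E.
    by move=> _; rewrite expr2 invfM; ring.
  congr (_ / _).
  transitivity (\sum_(n <- T) \sum_(v <- V) if zhi k.+1 n == v then lam n * X v else 0).
    rewrite big_seq [RHS]big_seq; apply: eq_bigr => n nT.
    rewrite (bigD1_seq (zhi k.+1 n)) ?undup_uniq ?mem_undup ?map_f//= eqxx.
    by rewrite big1 ?addr0// => v; rewrite eq_sym => /negbTE ->.
  rewrite exchange_big/=; apply: eq_bigr => v _.
  by rewrite -big_mkcond/= -mulr_suml.
rewrite ler_pdivrMr ?exprn_gt0// mul1r -lee_fin; apply: le_trans (tailQ k.+1).
apply: (@le_trans _ _ (\sum_(v <- V) (\esum_(u in Zlow k.+1) (lam (concat k.+1 u v))%:E) ^+ 2)%E).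
  rewrite -sumEFin; apply: lee_sum => v _; rewrite EFin_expe lee_sqr ?lee_fin ?XE//.
  by apply: le_trans (XE v); rewrite lee_fin.
apply: sum_le_esum; first exact: undup_uniq.
move=> v; rewrite mem_undup => /mapP[n nT ->]; split; first exact: Zhigh_zhi.
move=> /= /zhi_eq0 nk; move: nT; rewrite mem_filter => /andP[/negP + _]; apply.
by rewrite in_setE.
Qed.

End tail.

Section block.
Variable k : nat.
Hypothesis blockQ : (Fnorm (fun m : nat =>
       \esum_(u in Zlow k) (lam (concat k u (single k m%:Z)))%:E) <= s%:E)%E.

(** A frequency in [Zlow k.+1] is determined by its coordinates below [k] and by [n k]. The mass at
    [n k = j] is therefore a partial sum, without repetition, of the j-th entry of the sequence in
    [Fnorm]. *)
Lemma block_condition (b L : nat) : (0 < b)%N ->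
  \sum_(1 <= l < L) (\sum_(b * l <= j < b * l.+1)
     \sum_(n <- S | (n \in Zlow k.+1) && (n k == j%:Z)) lam n / s) ^+ 2 <= 1.
Proof.
move=> b0.
pose X j := \sum_(n <- S | (n \in Zlow k.+1) && (n k == j%:Z)) lam n.
pose E j := (\esum_(u in Zlow k) (lam (concat k u (single k j%:Z)))%:E)%E.
have X0 j : 0 <= X j by apply: sumr_ge0.
have E0 j : (0 <= E j)%E by apply: esum_ge0 => u _; rewrite lee_fin.
have XE j : ((X j)%:E <= E j)%E.
  pose t := [seq zlo k n | n <- [seq n <- S | (n \in Zlow k.+1) && (n k == j%:Z)]].
  have -> : (X j)%:E = (\sum_(u <- t) (lam (concat k u (single k j%:Z)))%:E)%E.
    rewrite /t big_map big_filter /X -sumEFin; apply: eq_bigr => n /andP[nk /eqP nj].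
    by rewrite -nj concat_zlo_single//; rewrite in_setE in nk.
  apply: sum_le_esum; last by move=> u /mapP[n _ ->]; exact: Zlow_zlo.
  rewrite map_inj_in_uniq ?filter_uniq//.
  move=> n m; rewrite !mem_filter => /andP[/andP[+ /eqP nj] _] /andP[/andP[+ /eqP mj] _] nm.
  rewrite !in_setE => nk mk.
  by rewrite -(concat_zlo_single nk) -(concat_zlo_single mk) nm nj mj.
have -> : \sum_(1 <= l < L) (\sum_(b * l <= j < b * l.+1)
     \sum_(n <- S | (n \in Zlow k.+1) && (n k == j%:Z)) lam n / s) ^+ 2 =
   (\sum_(1 <= l < L) (\sum_(b * l <= j < b * l.+1) X j) ^+ 2) / s ^+ 2.
  rewrite mulr_suml; apply: eq_bigr => l _.
  by rewrite -exprVn -exprMn mulr_suml; congr (_ ^+ 2); apply: eq_bigr => j _; rewrite mulr_suml.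
rewrite ler_pdivrMr ?exprn_gt0// mul1r -lee_fin.
have : (sqrte (\sum_(1 <= l <oo) (\sum_(b * l <= j < b * l.+1) E j) ^+ 2) <= s%:E)%E.
  by apply: le_trans blockQ; apply: ereal_sup_ubound; exists b.
move=> /(sqrte_le_sqr (ltW s0)); apply: le_trans.
apply: (@le_trans _ _ (\sum_(1 <= l < L) (\sum_(b * l <= j < b * l.+1) E j) ^+ 2)%E); last first.
  by apply: nneseries_lim_ge => l _ _; rewrite expe_ge0// sume_ge0.
rewrite -sumEFin; apply: lee_sum => l _.
rewrite EFin_expe lee_sqr ?lee_fin ?sumr_ge0 ?sume_ge0// -sumEFin.
by apply: lee_sum => j _; exact: XE.
Qed.

End block.
End quadratic_conditions.

(** * Fourier coefficients of polynomials and their stability in the L^1 norm *)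

Section fourier_span.
Variable R : realType.
Local Notation C := R[i].
Local Notation P := (haarTN R).
Local Notation normc := Normc.normc.

Lemma L1norm_cmbounded (f : TN R -> C) : cmbounded f ->
  L1norm f = (Ex (fun x => normc (f x)))%:E.
Proof.
move=> mf; rewrite /L1norm /Ex /Rintegral fineK//.
exact: (integrable_fin_num _ (mbounded_integrable (mbounded_normc mf))).
Qed.

Lemma cmbounded_tpoly (s : seq ZN) (c : ZN -> C) :
  cmbounded (fun x => \sum_(n <- s) c n * echar n x).
Proof.
by apply: cmbounded_sum => n; apply: cmboundedM; [exact: cmbounded_cst|exact: cmbounded_echar].
Qed.

Lemma echar_conjc n (x : TN R) : expi (- (2 * pi * pairing n x)) = conjc (echar n x).
Proof. by rewrite conjc_expi. Qed.

(** The free factor [z] yields both parts of a coefficient from a statement on real parts, as Im w =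
    Re(- i w). *)
Lemma Ex_Re_tpoly (s : seq ZN) (c : ZN -> C) (z : C) (n : ZN) :
  Ex (fun x => complex.Re (z * ((\sum_(m <- s) c m * echar m x) * conjc (echar n x)))) =
  complex.Re (z * (\sum_(m <- s | m == n) c m)).
Proof.
rewrite (_ : (fun x => _) = fun x => \sum_(m <- s)
    complex.Re (z * c m * (echar m x * conjc (echar n x)))); last first.
  apply/funext => x; rewrite mulr_suml mulr_sumr Re_sum; apply: eq_bigr => m _.
  by rewrite !mulrA.
rewrite Ex_sum => [|m].
  rewrite mulr_sumr [in RHS]big_mkcond Re_sum; apply: eq_bigr => m _.
  by rewrite Ex_echar_orthogonal; case: eqP.
suff : cmbounded (fun x : TN R => z * c m * (echar m x * conjc (echar n x))) by case.
apply: cmboundedM; first exact: cmbounded_cst.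
by apply: cmboundedM; [|apply: cmbounded_conjc]; exact: cmbounded_echar.
Qed.

(** A list of frequencies as in [span_last] may contain repetitions, hence a sum on the right. *)
Lemma fourier_tpoly (s : seq ZN) (c : ZN -> C) (n : ZN) :
  fourier (fun x => \sum_(m <- s) c m * echar m x) n = \sum_(m <- s | m == n) c m.
Proof.
rewrite /fourier /integralTN; apply: eq_complexP => /=.
  rewrite -[RHS](congr1 (@complex.Re R) (mul1r _)) -Ex_Re_tpoly; congr Rintegral.
  by apply/funext => x; rewrite mul1r echar_conjc.
have ImRe (w : C) : complex.Im w = complex.Re (- 'i%C * w).
  by case: w => u v /=; rewrite oppr0 mul0r mulN1r sub0r opprK.
rewrite ImRe -Ex_Re_tpoly; congr Rintegral.
by apply/funext => x; rewrite ImRe echar_conjc.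
Qed.

Lemma tpoly_fourier (s S : seq ZN) (c : ZN -> C) x : uniq S -> {subset s <= S} ->
  \sum_(n <- S) fourier (fun x => \sum_(m <- s) c m * echar m x) n * echar n x =
  \sum_(m <- s) c m * echar m x.
Proof.
move=> uS sS.
transitivity (\sum_(n <- S) \sum_(m <- s) if m == n then c m * echar m x else 0).
  apply: eq_bigr => n _; rewrite fourier_tpoly mulr_suml big_mkcond.
  by apply: eq_bigr => m _; case: eqP => // ->.
rewrite exchange_big/= big_seq [RHS]big_seq; apply: eq_bigr => m ms.
rewrite (bigD1_seq m) ?sS//= eqxx big1 ?addr0// => n.
by rewrite eq_sym => /negbTE ->.
Qed.

Section L1.
Variable f : TN R -> C.
Hypothesis intf : integrableTN f.

Lemma measurable_normc_integrable : measurable_fun setT (fun x => normc (f x)).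
Proof.
have [/integrableP[/measurable_EFinP m1 _] /integrableP[/measurable_EFinP m2 _]] := intf.
rewrite (_ : (fun x => _) = fun x => Num.sqrt (complex.Re (f x) ^+ 2 + complex.Im (f x) ^+ 2)).
  apply: (@measurableT_comp _ _ _ _ _ _ (@Num.sqrt R)).
    by apply: continuous_measurable_fun; exact: sqrt_continuous.
  by apply: measurable_funD; exact: measurable_funX.
by apply/funext => x; case: (f x).
Qed.

Lemma integrable_normc : P.-integrable setT (fun x => (normc (f x))%:E).
Proof.
have [m1 m2] := intf.
apply: (@le_integrable _ _ _ P setT _ _ ((fun x => `|(complex.Re (f x))%:E|) \+
   (fun x => `|(complex.Im (f x))%:E|))%E) => //.
- by apply/measurable_EFinP; exact: measurable_normc_integrable.
- move=> x _ /=; rewrite lee_fin ger0_norm ?normc_ge0// ger0_norm ?addr_ge0//.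
  case: (f x) => u v /=; rewrite -(@ler_pXn2r _ 2) ?nnegrE ?sqrtr_ge0 ?addr_ge0//.
  rewrite sqr_sqrtr ?addr_ge0 ?sqr_ge0// sqrrD !real_normK ?num_real//.
  by rewrite addrAC lerDl mulrn_wge0// mulr_ge0.
- by apply: integrableD => //; exact: integrable_abse.
Qed.

Lemma integrable_Re_mul (w : TN R -> C) : cmbounded w -> (forall x, normc (w x) <= 1) ->
  P.-integrable setT (fun x => (complex.Re (f x * w x))%:E).
Proof.
move=> [[mr _] [mi _]] w1; apply: le_integrable integrable_normc => //.
- have [/integrableP[/measurable_EFinP m1 _] /integrableP[/measurable_EFinP m2 _]] := intf.
  apply/measurable_EFinP.
  rewrite (_ : (fun x => _) = fun x => complex.Re (f x) * complex.Re (w x) -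
      complex.Im (f x) * complex.Im (w x)).
    by apply: measurable_funB; exact: measurable_funM.
  by apply/funext => x; case: (f x) => a b; case: (w x).
move=> x _ /=; rewrite lee_fin [leRHS]ger0_norm ?normc_ge0//.
by rewrite (le_trans (ler_Re_normc _))// Normc.normcM ler_piMr ?normc_ge0.
Qed.

Lemma Ex_Re_mul_le (w : TN R -> C) : cmbounded w -> (forall x, normc (w x) <= 1) ->
  (`|Rintegral P setT (fun x => complex.Re (f x * w x))|%:E <= L1norm f)%E.
Proof.
move=> mw w1; have iw := integrable_Re_mul mw w1.
rewrite (EFin_normr_Rintegral measurableT iw).
apply: le_trans (le_abse_integral _ measurableT _) _; first by case/integrableP: iw.
apply: ge0_le_integral => //.
- by apply: measurableT_comp => //; case/integrableP: iw.
- by apply/measurable_EFinP; exact: measurable_normc_integrable.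
- move=> x _ /=; rewrite lee_fin.
  by rewrite (le_trans (ler_Re_normc _))// Normc.normcM ler_piMr ?normc_ge0.
Qed.

End L1.

Lemma integrableTN_cmbounded (f : TN R -> C) : cmbounded f -> integrableTN f.
Proof. by move=> [m1 m2]; split; exact: mbounded_integrable. Qed.

Lemma integrableTNB (f g : TN R -> C) : integrableTN f -> integrableTN g -> integrableTN (fun x => f x - g x).
Proof.
move=> [r1 i1] [r2 i2]; split.
  rewrite (_ : (fun x => _) = ((fun x => (complex.Re (f x))%:E) \- (fun x => (complex.Re (g x))%:E))%E).
    exact: integrableB.
  by apply/funext => x /=; case: (f x) => ? ?; case: (g x).
rewrite (_ : (fun x => _) = ((fun x => (complex.Im (f x))%:E) \- (fun x => (complex.Im (g x))%:E))%E).
  exact: integrableB.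
by apply/funext => x /=; case: (f x) => ? ?; case: (g x).
Qed.

(** The real and imaginary parts each move by at most eta; 2 is a crude value for sqrt 2. *)
Lemma normc_fourier_dist (f g : TN R -> C) n (eta : R) : integrableTN f -> integrableTN g ->
  (L1norm (fun x => (f x - g x)%R) <= eta%:E)%E ->
  normc (fourier f n) <= normc (fourier g n) + 2 * eta.
Proof.
move=> If Ig Hd; have Id := integrableTNB If Ig.
have key (z : C) : normc z <= 1 ->
    `|Rintegral P setT (fun x => complex.Re (f x * (conjc (echar n x) * z))) -
     Rintegral P setT (fun x => complex.Re (g x * (conjc (echar n x) * z)))| <= eta.
  move=> z1.
  have mw : cmbounded (fun x : TN R => conjc (echar n x) * z).
    by apply: cmboundedM; [apply: cmbounded_conjc; exact: cmbounded_echar|exact: cmbounded_cst].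
  have w1 x : normc (conjc (echar n x) * z) <= 1.
    by rewrite Normc.normcM normc_conjc normc_echar mul1r.
  rewrite -lee_fin; apply: le_trans Hd; apply: le_trans (Ex_Re_mul_le Id mw w1).
  rewrite -RintegralB//; [|exact: integrable_Re_mul|exact: integrable_Re_mul].
  rewrite le_eqVlt; apply/orP; left; apply/eqP; congr (`|_|%:E); congr Rintegral.
  apply/funext => x; rewrite mulrBl.
  by case: (f x * _) => ? ?; case: (g x * _).
have FE h : fourier h n = (Rintegral P setT (fun x => complex.Re (h x * (conjc (echar n x) * 1))) +i*
    Rintegral P setT (fun x => complex.Re (h x * (conjc (echar n x) * - 'i%C))))%C.
  rewrite /fourier /integralTN; apply: eq_complexP => /=; congr Rintegral.
    by apply/funext => x; rewrite mulr1 echar_conjc.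
  apply/funext => x; rewrite echar_conjc mulrA; case: (h x * _) => u v /=.
  by rewrite oppr0 mulr0 mulrN1 sub0r opprK.
have k1 := key 1; have k2 := key (- 'i%C).
rewrite Normc.normc1 normcN normc_i in k1 k2.
have {}k1 := k1 (lexx _); have {}k2 := k2 (lexx _).
rewrite -(subrK (fourier g n) (fourier f n)).
apply: le_trans (normc_le_add _ _) _; rewrite addrC lerD2l !FE.
move: k1 k2; set a1 := Rintegral _ _ _; set a2 := Rintegral _ _ _.
set b1 := Rintegral _ _ _; set b2 := Rintegral _ _ _ => k1 k2.
rewrite [X in normc X](_ : _ = (a1 - a2) +i* (b1 - b2))%C//.
rewrite /= -(@ler_pXn2r _ 2) ?nnegrE ?sqrtr_ge0//; last first.
  by rewrite mulr_ge0// (le_trans _ k1).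
rewrite sqr_sqrtr ?addr_ge0 ?sqr_ge0// -!(real_normK (num_real (_ - _))).
have q1 : `|a1 - a2| ^+ 2 <= eta ^+ 2 by rewrite ler_pXn2r ?nnegrE// (le_trans _ k1).
have q2 : `|b1 - b2| ^+ 2 <= eta ^+ 2 by rewrite ler_pXn2r ?nnegrE// (le_trans _ k1).
by have := sqr_ge0 eta; rewrite exprMn; lra.
Qed.

Lemma L1norm_triangle (f g : TN R -> C) : integrableTN f -> integrableTN g ->
  (L1norm g <= L1norm f + L1norm (fun x => (f x - g x)%R))%E.
Proof.
move=> If Ig; have Id := integrableTNB If Ig.
rewrite /L1norm -ge0_integralD//; first last.
- by apply/measurable_EFinP; exact: measurable_normc_integrable.
- by move=> x _; rewrite lee_fin normc_ge0.
- by apply/measurable_EFinP; exact: measurable_normc_integrable.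
- by move=> x _; rewrite lee_fin normc_ge0.
apply: ge0_le_integral => //.
- by move=> x _; rewrite lee_fin normc_ge0.
- by apply/measurable_EFinP; exact: measurable_normc_integrable.
- by apply/measurable_EFinP; apply: measurable_funD; exact: measurable_normc_integrable.
- move=> x _; rewrite -EFinD lee_fin.
  rewrite -[X in normc X <= _](subKr (f x)); apply: le_trans (normc_le_add _ _) _.
  by rewrite normcN.
Qed.

End fourier_span.

(** * The upper bound for all of H^1 by density *)

Section upper_bound.
Variable R : realType.
Local Notation C := R[i].
Local Notation P := (haarTN R).
Local Notation normc := Normc.normc.

Lemma sum_subseq_le (T : eqType) (t S : seq T) (F : T -> R) : uniq t -> uniq S ->
  {subset t <= S} -> (forall x, 0 <= F x) -> \sum_(x <- t) F x <= \sum_(x <- S) F x.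
Proof.
move=> ut uS tS F0; rewrite [leRHS](bigID (mem t))/=.
rewrite (_ : \sum_(x <- S | x \in t) F x = \sum_(x <- t) F x) ?lerDl ?sumr_ge0//.
rewrite -big_filter; apply: perm_big; apply: uniq_perm; rewrite ?filter_uniq// => x.
by rewrite mem_filter; case: (boolP (x \in t)) => //= /tS ->.
Qed.

Section multiplier.
Variables (lam : ZN -> R) (B : R).
Hypotheses (lam0 : forall n, 0 <= lam n) (B0 : 0 <= B).
Hypothesis HB : forall (S : seq ZN) (a : ZN -> C), uniq S -> (forall n, n \in S -> gt_last n) ->
  \sum_(n <- S) lam n * normc (a n) <= B * Ex (fun x => normc (\sum_(n <- S) a n * echar n x)).

(** The hypothesis is applied to [t] enlarged by the spectrum of g, so that g is recovered from its
    coefficients; the added terms on the left are nonnegative. *)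
Let span_bound (t : seq ZN) g : uniq t -> (forall n, n \in t -> gt_last n) -> span_last g ->
  ((\sum_(n <- t) lam n * normc (fourier g n))%:E <= B%:E * L1norm g)%E.
Proof.
move=> ut tgt [s [c [sgt ->]]].
pose S := undup (s ++ t).
have uS : uniq S by exact: undup_uniq.
have Sgt n : n \in S -> gt_last n by rewrite mem_undup mem_cat => /orP[/sgt|/tgt].
have sS : {subset s <= S} by move=> n ns; rewrite mem_undup mem_cat ns.
have tS : {subset t <= S} by move=> n ns; rewrite mem_undup mem_cat ns orbT.
rewrite L1norm_cmbounded; last exact: cmbounded_tpoly.
rewrite -EFinM lee_fin.
set g0 := fun x : TN R => \sum_(n <- s) c n * echar n x.
have := HB (fourier g0) uS Sgt.
rewrite (_ : (fun x => normc (\sum_(n <- S) fourier g0 n * echar n x)) = fun x => normc (g0 x)).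
  apply: le_trans; apply: sum_subseq_le => // n.
  by rewrite mulr_ge0 ?normc_ge0.
by apply/funext => x; rewrite /g0 tpoly_fourier.
Qed.

Lemma H1_last_bound (f : TN R -> C) : H1_last f ->
  (\esum_(n in gt_last) (lam n * normc (fourier f n))%:E <= B%:E * L1norm f)%E.
Proof.
move=> [[_ If] Hf]; apply: esum_le_seq => t ut tgt.
have fin_f : L1norm f \is a fin_num by exact: (integrable_fin_num _ (integrable_normc If)).
set r := fine (L1norm f); have rE : L1norm f = r%:E by rewrite fineK.
rewrite rE -EFinM sumEFin lee_fin; apply/ler_addgt0Pr => eps eps0.
pose La := \sum_(n <- t) lam n.
have La0 : 0 <= La by apply: sumr_ge0.
have D0 : 0 < B + 2 * La + 1 by rewrite ltr_wpDl// addr_ge0// mulr_ge0.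
(* Replacing f by g costs 2 eta La on the left and B eta on the right, together at most eps; the
   summand 1 keeps the divisor positive. *)
pose eta := eps / (B + 2 * La + 1).
have eta0 : 0 < eta by rewrite divr_gt0.
have etaD : (B + 2 * La + 1) * eta = eps by rewrite mulrC divfK// gt_eqF.
have [g gspan gd] := Hf _ eta0.
have Ig : integrableTN g.
  by have [s [c [_ ->]]] := gspan; apply: integrableTN_cmbounded; exact: cmbounded_tpoly.
have gL := L1norm_triangle If Ig.
have gB := span_bound ut tgt gspan.
have gr : (B%:E * L1norm g <= (B * (r + eta))%:E)%E.
  rewrite EFinM lee_wpmul2l ?lee_fin//; apply: le_trans gL _.
  by rewrite rE EFinD leeD2l// ltW.
have {gB gr} := le_trans gB gr; rewrite lee_fin => gB.
have : \sum_(n <- t) lam n * normc (fourier f n) <=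
    \sum_(n <- t) (lam n * normc (fourier g n) + 2 * eta * lam n).
  apply: ler_sum => n _; have := normc_fourier_dist n If Ig (ltW gd).
  by move=> /(ler_wpM2l (lam0 n)); rewrite mulrDr (mulrC (lam n) (2 * eta)).
rewrite big_split/= -mulr_sumr -/La; move: gB etaD.
by move: (\sum_(n <- t) _) (\sum_(n <- t) _) => x1 x2; nra.
Qed.

Lemma multiplier_norm_le : (multiplier_norm lam <= B%:E)%E.
Proof.
apply: ereal_inf_lbound; split; first by rewrite lee_fin.
exact: H1_last_bound.
Qed.

End multiplier.

(* [481] bounds the variation of the energy: [480] is the constant of
   [poisson_kernel_form_le] and [1] that of [tail_condition]. *)
Definition upper_const : R := (2 / 5 / (2 * 481 + 1) ^+ 2)^-1.

Lemma upper_const_gt0 : 0 < upper_const.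
Proof.
rewrite invr_gt0; apply: divr_gt0; first by apply: divr_gt0; exact: ltr0Sn.
by apply: exprn_gt0; apply: ltr_wpDl ltr01; apply: mulr_ge0; exact: ler0n.
Qed.

Lemma Fnorm_ge0 (mu : nat -> \bar R) : (0 <= Fnorm mu)%E.
Proof.
apply: (@le_trans _ _ (sqrte (\sum_(1 <= k <oo) (\sum_(1 * k <= j < 1 * k.+1) mu j) ^+ 2)%E)).
  exact: sqrte_ge0.
by apply: ereal_sup_ubound; exists 1%N.
Qed.

Lemma multiplier_norm_le_Q (lam : ZN -> R) (s : R) : (forall n, 0 <= lam n) -> 0 < s ->
  (Q lam <= s%:E)%E -> (multiplier_norm lam <= (upper_const * s)%:E)%E.
Proof.
move=> lam0 s0 Qs.
apply: multiplier_norm_le => //; first by rewrite mulr_ge0 ?ltW// upper_const_gt0.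
move: Qs; rewrite /Q.
set E1 := ereal_sup _; set E2 := ereal_sup _ => Qs.
have E10 : (0 <= E1)%E.
  apply: le_trans (Fnorm_ge0 _) _; last by apply: ereal_sup_ubound; exists 0%N.
have E20 : (0 <= E2)%E.
  apply: le_trans (sqrte_ge0 _) _; last by apply: ereal_sup_ubound; exists 0%N.
have E1s : (E1 <= s%:E)%E by apply: le_trans Qs; rewrite leeDl.
have E2s : (E2 <= s%:E)%E by apply: le_trans Qs; rewrite leeDr.
have tailQ k : (\esum_(v in Zhigh k `\ ZN0)
  (\esum_(u in Zlow k) (lam (concat k u v))%:E) ^+ 2 <= (s ^+ 2)%:E)%E.
  apply: sqrte_le_sqr; first exact: ltW.
  by apply: le_trans E2s; apply: ereal_sup_ubound; exists k.
have blockQ k : (Fnorm (fun m : nat =>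
       \esum_(u in Zlow k) (lam (concat k u (single k m%:Z)))%:E) <= s%:E)%E.
  by apply: le_trans E1s; apply: ereal_sup_ubound; exists k.
move=> S a uS Sgt.
(* When a_n = 0 the second factor is 0, by the convention for division by 0, and the bound on |c_n|
   still holds. *)
pose c n : C := ((lam n / s)%:C)%C * (a n / (normc (a n))%:C%C).
have cmu n : normc (c n) <= lam n / s.
  have ls0 : 0 <= lam n / s by rewrite divr_ge0// ltW.
  rewrite Normc.normcM normc_real ger0_norm// ler_piMr//.
  rewrite Normc.normcM Normc.normcV normc_real (ger0_norm (normc_ge0 _)).
  by have [->|n0] := eqVneq (normc (a n)) 0; rewrite ?mul0r// divff.
have := sum_coef_le_Ex_normc Sgt a cmu (tail_condition lam0 s0 uS tailQ)
  (fun k b L => block_condition lam0 s0 uS (@blockQ k) L) uS.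
rewrite -/upper_const.
have -> : \sum_(n <- S) complex.Re (a n * conjc (c n)) = (\sum_(n <- S) lam n * normc (a n)) / s.
  rewrite mulr_suml; apply: eq_bigr => n _.
  rewrite -dotcE /c dotcZr.
  have -> : a n / (normc (a n))%:C%C = ((normc (a n))^-1)%:C%C * a n by rewrite mulrC fmorphV.
  rewrite dotcZr -sqr_normc_dot; have -> : (normc (a n))^-1 * normc (a n) ^+ 2 = normc (a n).
    by have [->|n0] := eqVneq (normc (a n)) 0; [rewrite expr0n mulr0|rewrite expr2 mulKf].
  by rewrite mulrAC.
move=> H; rewrite -mulrA -ler_pdivrMl ?upper_const_gt0//.
rewrite invrK -ler_pdivrMl// mulrCA mulrC.
by move: H; rewrite [X in _ -> X <= _]mulrC [_ / s]mulrC.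
Qed.

End upper_bound.

(** * The lower bound *)

Section test_functions.
Variable R : realType.
Local Notation C := R[i].
Local Notation P := (haarTN R).
Local Notation normc := Normc.normc.

(** Different indices may carry the same frequency; collecting them exhibits the test function as an
    element of the span and gives its coefficients. *)
Lemma tpoly_collect (I : eqType) (T : seq I) (F : I -> ZN) (w : I -> C) (x : TN R) :
  \sum_(t <- T) w t * echar (F t) x =
  \sum_(n <- undup [seq F t | t <- T]) (\sum_(t <- T | F t == n) w t) * echar n x.
Proof.
transitivity (\sum_(n <- undup [seq F t | t <- T]) \sum_(t <- T)
    if F t == n then w t * echar (F t) x else 0); last first.
  apply: eq_bigr => n _; rewrite mulr_suml [RHS]big_mkcond; apply: eq_bigr => t _.
  by case: eqP => // ->.
rewrite exchange_big/=.
rewrite big_seq [RHS]big_seq; apply: eq_bigr => t tT.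
rewrite (bigD1_seq (F t)) ?undup_uniq ?mem_undup ?map_f//= eqxx big1 ?addr0// => n.
by rewrite eq_sym => /negbTE ->.
Qed.

Lemma span_last_mem_H1 (f : TN R -> C) : span_last f -> H1_last f.
Proof.
move=> Hf; have [s [c [sgt fE]]] := Hf.
have If : integrableTN f by rewrite fE; apply: integrableTN_cmbounded; exact: cmbounded_tpoly.
split.
  split => //; rewrite fE => x k; apply: eq_bigr => n _; congr (_ * _).
  exact: Zperiodic_echar.
move=> eps eps0; exists f => //.
rewrite (_ : (fun x => _) = (fun=> 0 : C)); last by apply/funext => x; rewrite subrr.
rewrite (@L1norm_cmbounded _ (fun=> 0 : C)); last exact: cmbounded_cst.
by rewrite Normc.normc0 Ex_cst lte_fin.
Qed.

Lemma parseval_inj (I : eqType) (T : seq I) (F : I -> ZN) (w : I -> C) : uniq T ->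
  {in T &, injective F} ->
  Ex (fun x => dotc (\sum_(t <- T) w t * echar (F t) x) (\sum_(t <- T) w t * echar (F t) x)) =
  \sum_(t <- T) dotc (w t) (w t).
Proof.
move=> uT injF.
rewrite (_ : (fun x => _) = fun x => \sum_(t <- T) \sum_(u <- T)
   complex.Re ((w t * conjc (w u)) * (echar (F t) x * conjc (echar (F u) x)))); last first.
  apply/funext => x; rewrite dotc_suml; apply: eq_bigr => t _.
  rewrite dotc_sumr; apply: eq_bigr => u _; rewrite dotcE conjcM.
  by congr complex.Re; rewrite mulrACA.
have mp t u : mbounded (fun x : TN R =>
    complex.Re ((w t * conjc (w u)) * (echar (F t) x * conjc (echar (F u) x)))).
  suff : cmbounded (fun x : TN R => (w t * conjc (w u)) * (echar (F t) x * conjc (echar (F u) x))) by case.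
  apply: cmboundedM; first exact: cmbounded_cst.
  by apply: cmboundedM; [|apply: cmbounded_conjc]; exact: cmbounded_echar.
rewrite Ex_sum; last by move=> t; exact: mbounded_sum.
rewrite big_seq [RHS]big_seq; apply: eq_bigr => t tT.
rewrite Ex_sum// (bigD1_seq t)//= Ex_echar_orthogonal eqxx big_seq_cond big1 ?addr0 -?dotcE//.
move=> u /andP[uT' ut]; rewrite Ex_echar_orthogonal; case: eqP => // /injF tu.
by move: ut; rewrite tu// eqxx.
Qed.

Section hankel_test.
Variables (lam : ZN -> R) (M : R).
Hypotheses (lam0 : forall n, 0 <= lam n) (M0 : 0 <= M).
Hypothesis HM : forall f : TN R -> C, H1_last f ->
  (\esum_(n in gt_last) (lam n * normc (fourier f n))%:E <= M%:E * L1norm f)%E.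
Variables (A1 A2 A3 U B : seq ZN).
Hypotheses (uA1 : uniq A1) (uA2 : uniq A2) (uA3 : uniq A3) (uU : uniq U) (uB : uniq B).
Hypothesis A10 : (0 < size A1)%N.
Hypothesis uA23 : uniq (A2 ++ A3).
Hypothesis addU : forall p u, p \in A1 -> u \in U -> zadd p u \in A2 ++ A3.
Hypothesis pos : forall p p' q, p \in A1 -> p' \in A2 ++ A3 -> q \in B ->
  gt_last (zsub (zadd p' q) p).
Hypothesis inj2 : {in [seq (p, q) | p <- A2, q <- B] &, injective (fun t => zadd t.1 t.2)}.
Hypothesis inj3 : {in [seq (p, q) | p <- A3, q <- B] &, injective (fun t => zadd t.1 t.2)}.
Hypothesis size23 : (size A2 + size A3 <= 4 * size A1)%N.

Let b (q : ZN) : R := \sum_(u <- U) lam (zadd u q).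
Let beta : R := \sum_(q <- B) b q ^+ 2.
Let N : R := (size A1)%:R.

Let N0 : 0 < N. Proof. by rewrite ltr0n. Qed.
Let b0 q : 0 <= b q. Proof. by apply: sumr_ge0. Qed.
Let beta0 : 0 <= beta. Proof. by apply: sumr_ge0 => q _; rewrite sqr_ge0. Qed.

Let D (x : TN R) : C := \sum_(p <- A1) 1 * echar p x.
(** The enlarged set is [A2 ++ A3]. The sums p' + q need only be distinct over each of the two
    pieces, so Parseval's identity is applied to [h A2] and [h A3] separately. *)
Let h (A : seq ZN) (x : TN R) : C :=
  \sum_(t <- [seq (p, q) | p <- A, q <- B]) (b t.2)%:C%C * echar (zadd t.1 t.2) x.

Let T := [seq (p, t) | p <- A1, t <- [seq (p', q) | p' <- A2 ++ A3, q <- B]].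
Let freq (t : ZN * (ZN * ZN)) := zsub (zadd t.2.1 t.2.2) t.1.
Let w (t : ZN * (ZN * ZN)) : C := (N^-1 * b t.2.2)%:C%C.
Let f (x : TN R) : C := \sum_(t <- T) w t * echar (freq t) x.

Let fE x : f x = (N^-1)%:C%C * (conjc (D x) * (h A2 x + h A3 x)).
Proof.
have -> : h A2 x + h A3 x = h (A2 ++ A3) x.
  by rewrite /h allpairs_cat big_cat.
have -> : conjc (D x) = \sum_(p <- A1) conjc (echar p x).
  by rewrite /D rmorph_sum; apply: eq_bigr => p _; rewrite mul1r.
rewrite /f /T big_allpairs mulr_suml mulr_sumr; apply: eq_bigr => p _.
rewrite /h mulr_sumr mulr_sumr; apply: eq_bigr => t _.
rewrite /w /freq [(p, t).2]/= [(p, t).1]/= echar_zsub.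
have -> : (N^-1 * b t.2)%:C%C = (N^-1)%:C%C * (b t.2)%:C%C by rewrite -rmorphM.
by ring.
Qed.

Let cmb_h A : cmbounded (h A).
Proof.
by apply: cmbounded_sum => t; apply: cmboundedM; [exact: cmbounded_cst|exact: cmbounded_echar].
Qed.

Let cmb_D : cmbounded D.
Proof.
by apply: cmbounded_sum => t; apply: cmboundedM; [exact: cmbounded_cst|exact: cmbounded_echar].
Qed.

Let dotc_realr (r : R) : dotc r%:C%C r%:C%C = r ^+ 2.
Proof. by rewrite /dotc/= mulr0 addr0. Qed.

Let Ex_D : Ex (fun x => dotc (D x) (D x)) = N.
Proof.
rewrite (@parseval_inj _ A1 id (fun=> 1) uA1); last by move=> ? ?.
rewrite (eq_bigr (fun=> 1)) => [|p _]; last by rewrite (dotc_realr 1) expr1n.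
by rewrite big_const_seq count_predT iter_addr_0.
Qed.

Let Ex_h A : uniq A -> {in [seq (p, q) | p <- A, q <- B] &, injective (fun t => zadd t.1 t.2)} ->
  Ex (fun x => dotc (h A x) (h A x)) = (size A)%:R * beta.
Proof.
move=> uA injA; rewrite (parseval_inj (F := fun t => zadd t.1 t.2))//; last first.
  by rewrite allpairs_uniq// => -[? ?] [? ?].
rewrite big_allpairs/= (eq_bigr (fun=> beta)).
  by rewrite big_const_seq count_predT iter_addr_0 mulr_natl.
by move=> p _; apply: eq_bigr => q _; rewrite dotc_realr.
Qed.

(** Cauchy-Schwarz in the form of AM-GM with a free parameter [t], integrated pointwise. The 8 is 2
    * 4: a factor 2 for splitting the square of h A2 + h A3, a factor 4 from [size23]. *)
Let norm_f (t : R) : 0 < t -> Ex (fun x => normc (f x)) <= (t + 8 * beta / t) / 2.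
Proof.
move=> t0.
have mD := mbounded_dotc cmb_D cmb_D.
have m2 := mbounded_dotc (cmb_h A2) (cmb_h A2).
have m3 := mbounded_dotc (cmb_h A3) (cmb_h A3).
have mf : cmbounded f.
  by apply: cmbounded_sum => u; apply: cmboundedM; [exact: cmbounded_cst|exact: cmbounded_echar].
pose c1 : R := N^-1 * t / 2; pose c2 : R := N^-1 / t.
have m23 := mboundedD m2 m3.
have H : Ex (fun x => normc (f x)) <=
    Ex (fun x => c1 * dotc (D x) (D x) + c2 * (dotc (h A2 x) (h A2 x) + dotc (h A3 x) (h A3 x))).
  apply: le_Ex.
  - exact: mbounded_normc.
  - by apply: mboundedD; apply: mboundedM => //; exact: mbounded_cst.
  move=> x; rewrite fE !Normc.normcM normc_real normc_conjc ger0_norm ?invr_ge0 ?(ltW N0)//.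
  rewrite /c1 /c2 -!mulrA -mulrDr ler_wpM2l ?invr_ge0 ?(ltW N0)//.
  have n23 : normc (h A2 x + h A3 x) <= normc (h A2 x) + normc (h A3 x) by exact: normc_le_add.
  rewrite -!sqr_normc_dot; move: n23 (normc_ge0 (D x)) (normc_ge0 (h A2 x + h A3 x)).
  move: (normc (D x)) (normc (h A2 x)) (normc (h A3 x)) (normc (h A2 x + h A3 x)) => d y z s sle d0 s0.
  rewrite -(ler_pM2l t0) (_ : t * (_ + _) = t ^+ 2 * d ^+ 2 / 2 + (y ^+ 2 + z ^+ 2)); last first.
    by field; rewrite gt_eqF.
  have s2 : s ^+ 2 <= (y + z) ^+ 2 by rewrite ler_pXn2r ?nnegrE// (le_trans s0).
  have := sqr_ge0 (t * d - s); have := sqr_ge0 (y - z); nra.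
apply: (le_trans H).
rewrite ExD; [|exact: mboundedM (mbounded_cst _) mD|exact: mboundedM (mbounded_cst _) m23].
rewrite (ExZ c1 mD) (ExZ c2 m23) (ExD m2 m3) Ex_D !Ex_h// -mulrDl -natrD.
have s4 : (size A2 + size A3)%:R <= 4 * N :> R by rewrite -natrM ler_nat.
have e1 : c1 * N = t / 2 by rewrite /c1; field; rewrite gt_eqF.
have e2 : c2 * (4 * N * beta) = 8 * beta / t / 2 by rewrite /c2; field; rewrite !gt_eqF.
rewrite e1 mulrDl lerD2l -e2 ler_wpM2l ?ler_wpM2r//.
by rewrite /c2 divr_ge0 ?invr_ge0// ltW.
Qed.

(** All weights are nonnegative, so contributions to one frequency do not cancel. For fixed p and q,
    the indices p' = p + u with u in U give the frequencies u + q, hence at least b_q^2 / N; summing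
    over the N elements p of A1 gives beta. *)
Let lower_f : beta <= M * Ex (fun x => normc (f x)).
Proof.
pose s := undup [seq freq t | t <- T].
pose c n : C := \sum_(t <- T | freq t == n) w t.
have fE' : f = fun x => \sum_(n <- s) c n * echar n x.
  by apply: funext => x; rewrite /f (tpoly_collect T freq w x).
have sgt n : n \in s -> gt_last n.
  rewrite mem_undup => /mapP[t /allpairsP[[p t'] /= [pA1 /allpairsP[[p' q] /= [pA qB ->]] ->]] ->].
  exact: pos.
have Hf : H1_last f.
  by apply: span_last_mem_H1; exists s, c; split.
have := HM Hf; rewrite L1norm_cmbounded; last by rewrite fE'; exact: cmbounded_tpoly.
have low : ((\sum_(n <- s) lam n * normc (fourier f n))%:E <=
    \esum_(n in gt_last) (lam n * normc (fourier f n))%:E)%E.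
  by rewrite -sumEFin; apply: sum_le_esum; rewrite ?undup_uniq.
move=> /(le_trans low); rewrite -EFinM lee_fin; apply: le_trans.
have w0 t : 0 <= N^-1 * b t.2.2 by rewrite mulr_ge0// invr_ge0 ltW.
have cE n : n \in s -> normc (fourier f n) = \sum_(t <- T | freq t == n) N^-1 * b t.2.2.
  move=> ns; rewrite fE' fourier_tpoly -big_filter.
  rewrite (_ : [seq i <- s | i == n] = [:: n]); last first.
    by rewrite filter_pred1_uniq ?undup_uniq.
  rewrite big_seq1 /c /w.
  rewrite (_ : \sum_(t <- T | _) _ = (\sum_(t <- T | freq t == n) N^-1 * b t.2.2)%:C%C).
    by rewrite normc_real ger0_norm// sumr_ge0.
  by rewrite rmorph_sum.
have -> : \sum_(n <- s) lam n * normc (fourier f n) = \sum_(t <- T) N^-1 * b t.2.2 * lam (freq t).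
  rewrite big_seq; under eq_bigr => n ns do rewrite (cE n ns).
  rewrite -big_seq.
  transitivity (\sum_(n <- s) \sum_(t <- T) if freq t == n then N^-1 * b t.2.2 * lam (freq t) else 0).
    apply: eq_bigr => n _; rewrite mulr_sumr big_mkcond; apply: eq_bigr => t _.
    by case: eqP => // ->; rewrite mulrC.
  rewrite exchange_big/= big_seq [RHS]big_seq; apply: eq_bigr => t tT.
  rewrite (bigD1_seq (freq t)) ?undup_uniq ?mem_undup ?map_f//= eqxx big1 ?addr0// => n.
  by rewrite eq_sym => /negbTE ->.
rewrite /T big_allpairs/=.
apply: (@le_trans _ _ (\sum_(p <- A1) N^-1 * beta)).
  rewrite big_const_seq count_predT iter_addr_0 -mulr_natl -/N mulrA divff ?mul1r//.
  by rewrite gt_eqF.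
rewrite big_seq [leRHS]big_seq; apply: ler_sum => p pA1.
rewrite big_allpairs/= exchange_big/= /beta mulr_sumr; apply: ler_sum => q _.
rewrite -mulr_sumr -mulrA ler_wpM2l ?invr_ge0 ?(ltW N0)// expr2 ler_wpM2l//.
rewrite /b /freq/=.
pose G p' := lam (zsub (zadd p' q) p).
rewrite (_ : \sum_(u <- U) lam (zadd u q) = \sum_(p' <- [seq zadd p u | u <- U]) G p'); last first.
  rewrite big_map; apply: eq_bigr => u _; congr lam; apply/fsfunP => j.
  by rewrite /G !(zsubE, zaddE); ring.
apply: sum_subseq_le => //.
- rewrite map_inj_uniq// => u v /fsfunP uv; apply/fsfunP => j.
  by have := uv j; rewrite !zaddE => /addrI.
- by move=> _ /mapP[u uU' ->]; exact: addU.
- by move=> p'; exact: lam0.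
Qed.

Lemma hankel_test : \sum_(q <- B) (\sum_(u <- U) lam (zadd u q)) ^+ 2 <= 8 * M ^+ 2.
Proof.
rewrite -/beta.
have H t : 0 < t -> beta <= M * ((t + 8 * beta / t) / 2).
  by move=> t0; apply: le_trans lower_f _; rewrite ler_wpM2l// norm_f.
have [M1|Mn] := eqVneq M 0.
  by have := H 1 ltr01; rewrite M1 mul0r expr0n mulr0.
have Mp : 0 < M by rewrite lt_def Mn.
(* With t = 8 M the bound reads beta <= 4 M^2 + beta / 2. *)
have M8 : 0 < 8 * M by rewrite mulr_gt0.
have := H _ M8; rewrite (_ : M * _ = 4 * M ^+ 2 + beta / 2); last by field; rewrite gt_eqF.
lra.
Qed.

End hankel_test.
End test_functions.

(** * Boxes of frequencies *)

Section boxes.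

Fixpoint box (k : nat) (lo : nat -> int) (len : nat -> nat) : seq ZN :=
  if k is k'.+1 then
    [seq zadd p (single k' (lo k' + i%:Z)) | p <- box k' lo len, i <- iota 0 (len k')]
  else [:: ZN0].

Lemma size_box k lo len : size (box k lo len) = (\prod_(j < k) len j)%N.
Proof.
elim: k => [|k IH]; first by rewrite big_ord0.
by rewrite big_ord_recr/= size_allpairs size_iota IH.
Qed.

Lemma mem_box k lo len n : n \in box k lo len <->
  Zlow k n /\ forall j, (j < k)%N -> lo j <= n j < lo j + (len j)%:Z.
Proof.
elim: k n => [|k IH] n /=.
  rewrite inE; split=> [/eqP ->|[H _]]; first by split=> // j _; rewrite ZN0E.
  by apply/eqP/fsfunP => j; rewrite ZN0E H.
split.
  move=> /allpairsP[[p i] /= [/IH[pk pb]]]; rewrite mem_iota add0n => /andP[_ ik] ->.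
  split=> [j kj|j]; first by rewrite zaddE singleE pk ?gtn_eqF// ltnW.
  rewrite ltnS leq_eqVlt => /predU1P[->|jk]; rewrite zaddE singleE.
    by rewrite eqxx pk// add0r lerDl ltrD2l ltz_nat ik.
  by rewrite ltn_eqF// addr0; exact: pb.
move=> [nk nb]; apply/allpairsP; exists (zlo k n, `|n k - lo k|%N) => /=.
have /andP[h1 h2] := nb k (ltnSn k).
have E : `|n k - lo k|%N%:Z = n k - lo k by rewrite gez0_abs// subr_ge0.
split.
- apply/IH; split; first exact: Zlow_zlo.
  by move=> j jk; rewrite concatE jk nb// ltnW.
- by rewrite mem_iota/= add0n -ltz_nat E ltrBlDl.
- apply/fsfunP => j; rewrite E addrC subrK zaddE concatE singleE ZN0E.
  by case: ltngtP => [_|kj|->]; rewrite ?addr0 ?add0r// nk.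
Qed.

Lemma uniq_box k lo len : uniq (box k lo len).
Proof.
elim: k => //= k IH; apply: allpairs_uniq => //; first exact: iota_uniq.
move=> _ _ /allpairsP[[p i] /= [/mem_box[pk _] _ ->]] /allpairsP[[q j] /= [/mem_box[qk _] _ ->]].
move=> /= /fsfunP H; congr pair.
  apply/fsfunP => l; have := H l; rewrite !zaddE !singleE.
  case: ltngtP => [_|lk|->]; first by rewrite !addr0.
    by rewrite (pk _ (ltnW lk)) (qk _ (ltnW lk)).
  by rewrite (pk _ (leqnn k)) (qk _ (leqnn k)).
have := H k; rewrite !zaddE !singleE eqxx pk// qk// !add0r => /addrI.
by case.
Qed.

(** (1 + 2 b / N)^i <= 2 k / (2 k - i) by induction on i <= k: each factor is at most (2 k - i) / (2
    k - i - 1) as soon as N >= 4 k b. At i = k the bound is 2. *)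
Lemma exists_sidelength (k b : nat) :
  exists2 N : nat, (0 < N)%N & ((N + 2 * b) ^ k <= 2 * N ^ k)%N.
Proof.
pose N := (4 * k * b + 1)%N; exists N; first by rewrite /N addn1.
suff H i : (i <= k)%N -> ((N + 2 * b) ^ i * (2 * k - i) <= N ^ i * (2 * k))%N.
  have [->|k0] := posnP k; first by rewrite !expn0.
  have := H k (leqnn k); have -> : (2 * k - k = k)%N by lia.
  by rewrite [leqRHS]mulnA leq_pmul2r// [leqRHS]mulnC.
elim: i => [|i IH] ik; first by rewrite !expn0 subn0.
have {IH} := IH (ltnW ik).
set X := ((N + _) ^ i)%N; set Y := (N ^ i)%N => IH.
rewrite !expnS -/X -/Y.
have step : ((N + 2 * b) * (2 * k - i.+1) <= N * (2 * k - i))%N by rewrite /N; nia.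
apply: (@leq_trans (X * (N * (2 * k - i)))).
  by rewrite [((N + _) * X)%N]mulnC -mulnA leq_mul2l step orbT.
by rewrite mulnCA -[leqRHS]mulnA leq_mul2l IH orbT.
Qed.

Lemma exists_coord_bound (U : seq ZN) :
  exists b : nat, forall u j, u \in U -> - b%:Z <= u j <= b%:Z.
Proof.
elim: U => [|u U [b Hb]]; first by exists 0%N.
exists (b + \sum_(j <- finsupp u) `|u j|)%N => v j; rewrite inE => /predU1P[->|vU]; last first.
  have /andP[h1 h2] := Hb v j vU; apply/andP; split; lia.
rewrite -ler_norml -abszE lez_nat; apply: leq_trans (leq_addl _ _).
have [ju|ju] := boolP (j \in finsupp u); last by rewrite fsfun_dflt.
by rewrite (bigD1_seq j) ?fset_uniq//= leq_addr.
Qed.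

End boxes.

(** * The two families of test sets *)

Section lower_bound.
Variable R : realType.
Local Notation C := R[i].
Local Notation normc := Normc.normc.

Lemma sqrte_le_of_sqr (x : \bar R) (s : R) : 0 <= s -> (x <= (s ^+ 2)%:E)%E -> (sqrte x <= s%:E)%E.
Proof.
case: x => [r| |]// s0; rewrite /= !lee_fin => rs.
by rewrite -(ger0_norm s0) -sqrtr_sqr ler_wsqrtr.
Qed.

(* The sets [U] may be chosen independently for the different [v], since a
   common finite set contains them all. *)
Lemma sum_esum_sqr_le (T I : choiceType) (V : seq T) (D : set I) (a : T -> I -> R) (K : R) :
  (forall v u, 0 <= a v u) ->
  (forall U, uniq U -> (forall u, u \in U -> D u) ->
     \sum_(v <- V) (\sum_(u <- U) a v u) ^+ 2 <= K) ->
  (\sum_(v <- V) (\esum_(u in D) (a v u)%:E) ^+ 2 <= K%:E)%E.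
Proof.
move=> a0 H.
pose E v := (\esum_(u in D) (a v u)%:E)%E.
have E0 v : (0 <= E v)%E by apply: esum_ge0 => u _; rewrite lee_fin.
(* The inner sums are completed one [v] at a time: those over [V1] are already the full ones, those
   over [V2] still share a finite set [U]. At each step, uniting [U] with the set chosen for the new
   [v] only increases the other sums. *)
suff G V1 V2 : V = V1 ++ V2 -> forall U, uniq U -> (forall u, u \in U -> D u) ->
    (\sum_(v <- V1) E v ^+ 2 + (\sum_(v <- V2) (\sum_(u <- U) a v u) ^+ 2)%:E <= K%:E)%E.
  have := G V [::] (esym (cats0 V)) [::] isT (fun _ => False_ind _ \o notF).
  by rewrite big_nil adde0.
elim/last_ind: V1 V2 => [|V1 v IH] V2 VE U uU UD.
  by rewrite big_nil add0e lee_fin; move: VE => /= <-; exact: H.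
have {}IH := IH (v :: V2) _; rewrite -cat_rcons in IH; have {}IH := IH VE.
set X := (\sum_(w <- V1) E w ^+ 2)%E in IH.
set r := \sum_(w <- V2) (\sum_(u <- U) a w u) ^+ 2.
have X0 : (0 <= X)%E by apply: sume_ge0 => w _; exact: expe_ge0.
have Xfin : X \is a fin_num.
  rewrite ge0_fin_numE//.
  apply: (@le_lt_trans _ _ K%:E); last exact: ltry.
  by apply: le_trans (IH U uU UD); rewrite leeDl// lee_fin sumr_ge0// => w _; rewrite sqr_ge0.
set x := fine X; have xE : X = x%:E by rewrite fineK.
rewrite -cats1 big_cat/= big_seq1 -/X.
have S U' : uniq U' -> (forall u, u \in U' -> D u) -> x + (\sum_(u <- U') a v u) ^+ 2 + r <= K.
  move=> uU' UD'; pose W := undup (U ++ U').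
  have WD u : u \in W -> D u by rewrite mem_undup mem_cat => /orP[/UD|/UD'].
  have := IH W (undup_uniq _) WD; rewrite xE -EFinD lee_fin big_cons addrA; apply: le_trans.
  have sq w (U1 : seq I) : uniq U1 -> {subset U1 <= W} ->
      (\sum_(u <- U1) a w u) ^+ 2 <= (\sum_(u <- W) a w u) ^+ 2.
    move=> uU1 sU1; rewrite ler_pXn2r ?nnegrE ?sumr_ge0//.
    by apply: sum_subseq_le => //; exact: undup_uniq.
  apply: lerD; first by rewrite lerD2l sq// => u uU1; rewrite mem_undup mem_cat uU1 orbT.
  by apply: ler_sum => w _; apply: sq => // u uU1; rewrite mem_undup mem_cat uU1.
have K0 : 0 <= K - x - r.
  by have := S [::] isT (fun _ => False_ind _ \o notF); rewrite big_nil expr0n/= addr0; lra.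
have Es : (E v <= (Num.sqrt (K - x - r))%:E)%E.
  apply: esum_le_seq => U' uU' UD'; rewrite sumEFin lee_fin.
  rewrite -[leLHS]ger0_norm ?sumr_ge0// -sqrtr_sqr ler_wsqrtr//.
  by have := S U' uU' UD'; lra.
have Efin : E v \is a fin_num by rewrite ge0_fin_numE//; exact: le_lt_trans Es (ltry _).
move: Es; rewrite xE -(fineK Efin) lee_fin -EFinM -!EFinD lee_fin => Es.
have : fine (E v) ^+ 2 <= K - x - r.
  by rewrite -[leRHS]sqr_sqrtr// ler_pXn2r ?nnegrE ?sqrtr_ge0// fine_ge0.
by rewrite expr2; lra.
Qed.

Section conditions.
Variables (lam : ZN -> R) (M : R).
Hypotheses (lam0 : forall n, 0 <= lam n) (M0 : 0 <= M).
Hypothesis lamN : forall n, ~ gt_last n -> lam n = 0.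
Hypothesis HM : forall f : TN R -> C, H1_last f ->
  (\esum_(n in gt_last) (lam n * normc (fourier f n))%:E <= M%:E * L1norm f)%E.

Lemma gt_last_concat k u v : Zhigh k v -> v <> ZN0 -> gt_last (concat k u v) -> gt_last v.
Proof.
move=> vk v0 [i [i0 H]]; have [ik|ki] := ltnP i k; last first.
  exists i; move: i0; rewrite concatE ltnNge ki/=; split=> // j ij.
  by have := H j ij; rewrite concatE ltnNge (leq_trans ki (ltnW ij)).
case: v0; apply/fsfunP => j; rewrite ZN0E; have [/vk //|kj] := ltnP j k.
by have := H j (leq_trans ik kj); rewrite concatE ltnNge kj.
Qed.

(** The test boxes live on the coordinates below [k] and the tails on the others, so p' + v
    determines both summands and [A3] may be empty. Tails that are not positive in the order
    contribute 0, by the convention on [lam]; for the others, adding elements of the boxes does not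
    change the last coordinate. *)
Lemma tail_sum_le k (V U : seq ZN) : uniq V -> uniq U ->
  (forall v, v \in V -> (Zhigh k `\ ZN0) v) -> (forall u, u \in U -> Zlow k u) ->
  \sum_(v <- V) (\sum_(u <- U) lam (concat k u v)) ^+ 2 <= 8 * M ^+ 2.
Proof.
move=> uV uU HV HU.
pose B := [seq v <- V | `[< gt_last v >]].
have HB q : q \in B -> gt_last q /\ Zhigh k q.
  by rewrite mem_filter => /andP[/asboolP ? /HV[]].
have [b Hb] := exists_coord_bound U.
have [N N0 HN] := exists_sidelength k b.
pose A1 := box k (fun=> 0) (fun=> N).
pose A2 := box k (fun=> - b%:Z) (fun=> N + 2 * b)%N.
have lowhigh (p p' q q' : ZN) : Zlow k p -> Zlow k p' -> Zhigh k q -> Zhigh k q' ->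
    zadd p q = zadd p' q' -> (p, q) = (p', q').
  move=> Hp Hp' Hq Hq' /fsfunP H; congr pair; apply/fsfunP => j; have := H j; rewrite !zaddE.
    have [jk|kj] := ltnP j k; last by rewrite (Hp _ kj) (Hp' _ kj).
    by rewrite (Hq _ jk) (Hq' _ jk) !addr0.
  have [jk|kj] := ltnP j k; first by rewrite (Hq _ jk) (Hq' _ jk).
  by rewrite (Hp _ kj) (Hp' _ kj) !add0r.
have -> : \sum_(v <- V) (\sum_(u <- U) lam (concat k u v)) ^+ 2 =
    \sum_(q <- B) (\sum_(u <- U) lam (zadd u q)) ^+ 2.
  rewrite /B big_filter [RHS]big_mkcond/= big_seq [RHS]big_seq; apply: eq_bigr => v vV.
  have [vk v0] := HV v vV; case: asboolP => gv.
    congr (_ ^+ 2); rewrite big_seq [RHS]big_seq; apply: eq_bigr => u /HU uk; congr lam.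
    apply/fsfunP => j; rewrite concatE zaddE.
    have [jk|kj] := ltnP j k; first by rewrite (vk _ jk) addr0.
    by rewrite (uk _ kj) add0r.
  rewrite big1 ?expr0n// => u _; apply: lamN => /gt_last_concat.
  by move=> /(_ vk v0).
have lowA2 p : p \in A2 ++ [::] -> Zlow k p by rewrite cats0 => /mem_box[].
apply: (@hankel_test R lam M lam0 M0 HM A1 A2 [::]) => //.
- exact: uniq_box.
- exact: uniq_box.
- exact: filter_uniq.
- by rewrite size_box prod_nat_const card_ord expn_gt0 N0.
- by rewrite cats0; exact: uniq_box.
- move=> p u /mem_box[pk Hp] uU'; rewrite cats0; apply/mem_box; split.
    by move=> j kj; rewrite zaddE pk// (HU u).
  move=> j jk; rewrite zaddE; have /andP[? ?] := Hb u j uU'; have /andP[? ?] := Hp j jk.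
  apply/andP; split; lia.
- move=> p p' q /mem_box[pk _] /lowA2 pk' /HB[[i [i0 Hi]] qk].
  have ki : (k <= i)%N by rewrite leqNgt; apply/negP => /qk qi; rewrite qi in i0.
  exists i; rewrite zsubE zaddE pk// pk'// add0r subr0; split=> // j ij.
  have kj := leq_trans ki (ltnW ij).
  by rewrite zsubE zaddE pk// pk'// add0r subr0 Hi.
- move=> _ _ /allpairsP[[p q] /= [pA qB ->]] /allpairsP[[p' q'] /= [pA' qB' ->]] /=.
  have [_ ?] := HB q qB; have [_ ?] := HB q' qB'.
  by apply: lowhigh => //; apply: lowA2; rewrite cats0.
- by rewrite addn0 !size_box !prod_nat_const !card_ord (leq_trans HN)// leq_pmul2r ?expn_gt0 ?N0.
Qed.

(** A block is translated to its left end: q is [a * l] in the coordinate [k], and [U'] adds to [U]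
    the interval [0, a) of that coordinate. Then p + u has k-th coordinate in [0, 2a), where adding
    multiples of [a] is not injective; it is on the halves [0, a) and [a, 2a), whence [A2] and [A3].
    Since l >= 1, q_k >= a > p_k, so p' + q - p has a positive last coordinate: the block at the
    origin has to be left out. *)
Lemma block_sum_le k a L (U : seq ZN) : (0 < a)%N -> uniq U ->
  (forall u, u \in U -> Zlow k u) ->
  \sum_(1 <= l < L) (\sum_(u <- U) \sum_(a * l <= j < a * l.+1)
     lam (concat k u (single k j%:Z))) ^+ 2 <= 8 * M ^+ 2.
Proof.
move=> a0 uU HU.
pose B := [seq single k (a * l)%N%:Z | l <- index_iota 1 L].
pose U' := [seq zadd u (single k i%:Z) | u <- U, i <- iota 0 a].
have [b Hb] := exists_coord_bound U.
have [N N0 HN] := exists_sidelength k b.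
pose A1 := box k.+1 (fun=> 0) (fun j => if j == k then a else N).
pose A2 := box k.+1 (fun j => if j == k then 0 else - b%:Z)
  (fun j => if j == k then a else N + 2 * b)%N.
pose A3 := box k.+1 (fun j => if j == k then a%:Z else - b%:Z)
  (fun j => if j == k then a else N + 2 * b)%N.
have -> : \sum_(1 <= l < L) (\sum_(u <- U) \sum_(a * l <= j < a * l.+1)
     lam (concat k u (single k j%:Z))) ^+ 2 = \sum_(q <- B) (\sum_(u <- U') lam (zadd u q)) ^+ 2.
  rewrite big_map; apply: eq_bigr => l _; congr (_ ^+ 2).
  rewrite big_allpairs_dep big_seq [RHS]big_seq; apply: eq_bigr => u /HU uk.
  rewrite -{1}[(a * l)%N]add0n mulnS big_addn addnK /index_iota subn0.
  apply: eq_bigr => i _; congr lam; apply/fsfunP => j.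
  rewrite concatE !zaddE !singleE PoszD.
  by case: ltngtP => [jk|kj|->]; rewrite ?addr0// uk ?(ltnW kj)// ?add0r.
have prodE (c : nat) : (\prod_(j < k.+1) (if (j : nat) == k then a else c) = c ^ k * a)%N.
  rewrite big_ord_recr/= eqxx; congr (_ * _)%N.
  rewrite (eq_bigr (fun=> c)) ?prod_nat_const ?card_ord// => i _.
  by rewrite ltn_eqF.
have kcoord lo len n : n \in box k.+1 lo len -> lo k <= n k < lo k + (len k)%:Z.
  by move=> /mem_box[_]; apply.
have mA23 p : p \in A2 ++ A3 <-> [/\ Zlow k.+1 p, 0 <= p k < (2 * a)%N%:Z &
    forall j, (j < k)%N -> - b%:Z <= p j < N%:Z + b%:Z].
  rewrite mem_cat; split.
    move=> /orP[] /mem_box[pk Hp]; split => //.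
    - by have := Hp k (ltnSn k); rewrite eqxx => /andP[? ?]; apply/andP; split; lia.
    - move=> j jk; have := Hp j (ltnW jk); rewrite ltn_eqF// => /andP[? ?]; apply/andP; split; lia.
    - by have := Hp k (ltnSn k); rewrite eqxx => /andP[? ?]; apply/andP; split; lia.
    - move=> j jk; have := Hp j (ltnW jk); rewrite ltn_eqF// => /andP[? ?]; apply/andP; split; lia.
  move=> [pk /andP[h1 h2] Hp]; have [h|h] := ltP (p k) a%:Z; apply/orP; [left|right].
    apply/mem_box; split => // j; rewrite ltnS leq_eqVlt => /predU1P[->|jk].
      by rewrite eqxx h1 add0r h.
    by rewrite ltn_eqF//; have /andP[? ?] := Hp j jk; apply/andP; split; lia.
  apply/mem_box; split => // j; rewrite ltnS leq_eqVlt => /predU1P[->|jk].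
    by rewrite eqxx h; lia.
  by rewrite ltn_eqF//; have /andP[? ?] := Hp j jk; apply/andP; split; lia.
have inj (c : nat) (A : seq ZN) : (forall p, p \in A -> c%:Z <= p k < c%:Z + a%:Z) -> 
    {in [seq (p, q) | p <- A, q <- B] &, injective (fun t => zadd t.1 t.2)}.
  move=> HA _ _ /allpairsP[[p q] /= [/HA pA /mapP[l _ ->] ->]]
    /allpairsP[[p' q'] /= [/HA pA' /mapP[l' _ ->] ->]] /= /fsfunP H.
  have ll : l = l'.
    have := H k; rewrite !zaddE !singleE eqxx => E.
    move: pA pA' => /andP[? ?] /andP[? ?].
    have [lt|lt|//] := ltngtP l l'.
      by have : (a * l.+1 <= a * l')%N; [rewrite leq_pmul2l|lia].
    by have : (a * l'.+1 <= a * l)%N; [rewrite leq_pmul2l|lia].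
  by rewrite ll in H *; congr pair; apply/fsfunP => j; have := H j; rewrite !zaddE => /addIr.
apply: (@hankel_test R lam M lam0 M0 HM A1 A2 A3) => //.
- exact: uniq_box.
- exact: uniq_box.
- exact: uniq_box.
- apply: allpairs_uniq => //; first exact: iota_uniq.
  move=> _ _ /allpairsP[[u i] /= [/HU uk _ ->]] /allpairsP[[v j] /= [/HU vk _ ->]] /= /fsfunP H.
  congr pair; last first.
    by have := H k; rewrite !zaddE !singleE eqxx uk// vk// !add0r; case.
  apply/fsfunP => l; have := H l; rewrite !zaddE !singleE.
  by have [->|_] := eqVneq l k; rewrite ?addr0// uk// vk.
- rewrite map_inj_uniq ?iota_uniq// => l l' /fsfunP /(_ k); rewrite !singleE eqxx => -[].
  by move=> /eqP; rewrite eqn_pmul2l// => /eqP.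
- by rewrite size_box prodE muln_gt0 expn_gt0 N0.
- rewrite cat_uniq !uniq_box andbT/=; apply/hasPn => p /kcoord; rewrite eqxx => /andP[h _].
  by apply/negP => /kcoord; rewrite eqxx add0r => /andP[_]; rewrite ltNge h.
- move=> p u /mem_box[pk Hp] /allpairsP[[v i] /= [vU + ->]].
  rewrite mem_iota add0n /= => ia; apply/mA23; split.
  + by move=> j kj; rewrite !zaddE singleE pk// gtn_eqF// (HU v)// ltnW.
  + have := Hp k (ltnSn k); rewrite !zaddE singleE eqxx (HU v)// => /andP[? ?].
    apply/andP; split; lia.
  + move=> j jk; have := Hp j (ltnW jk); rewrite !zaddE singleE ltn_eqF// => /andP[? ?].
    have /andP[? ?] := Hb v j vU; apply/andP; split; lia.
- move=> p p' q /mem_box[pk Hp] /mA23[pk' /andP[h _] _] /mapP[l + ->].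
  rewrite mem_index_iota => /andP[l1 _]; exists k; split; last first.
    by move=> j kj; rewrite zsubE zaddE singleE pk// pk'// gtn_eqF.
  rewrite zsubE zaddE singleE eqxx; have := Hp k (ltnSn k); rewrite eqxx => /andP[_ h'].
  have : (a * 1 <= a * l)%N by rewrite leq_pmul2l.
  lia.
- apply: (inj 0%N) => p /kcoord; rewrite eqxx//.
- apply: (inj a) => p /kcoord; rewrite eqxx//.
- rewrite !size_box !prodE addnn -mul2n mulnA.
  apply: (@leq_trans (2 * (2 * N ^ k * a))); first by rewrite -mulnA leq_pmul2l// leq_mul2r HN orbT.
  by rewrite !mulnA.
Qed.

End conditions.
End lower_bound.

(** * The two inequalities between Q and the multiplier norm *)

Section lower_bound_Q.
Variable R : realType.
Local Notation C := R[i].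
Local Notation normc := Normc.normc.

Section real_norm.
Variables (lam : ZN -> R) (M : R).
Hypotheses (lam0 : forall n, 0 <= lam n) (M0 : 0 <= M).
Hypothesis lamN : forall n, ~ gt_last n -> lam n = 0.
Hypothesis HM : forall f : TN R -> C, H1_last f ->
  (\esum_(n in gt_last) (lam n * normc (fourier f n))%:E <= M%:E * L1norm f)%E.

(** 3 is a rational bound for sqrt 8; the two terms of Q then give 6 M. *)
Let sqr_le : 8 * M ^+ 2 <= (3 * M) ^+ 2.
Proof. by rewrite exprMn ler_wpM2r ?sqr_ge0// -natrX ler_nat. Qed.

Let M3 : 0 <= 3 * M. Proof. by rewrite mulr_ge0. Qed.

Lemma tail_le k : (sqrte (\esum_(v in Zhigh k `\ ZN0)
  (\esum_(u in Zlow k) (lam (concat k u v))%:E) ^+ 2) <= (3 * M)%:E)%E.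
Proof.
apply: sqrte_le_of_sqr => //; apply: esum_le_seq => V uV HV.
apply: le_trans (_ : (8 * M ^+ 2)%:E <= _)%E; last by rewrite lee_fin.
apply: sum_esum_sqr_le => [v u|U uU HU]; first exact: lam0.
exact: (tail_sum_le lam0 M0 lamN HM).
Qed.

Lemma Fnorm_le k : (Fnorm (fun m : nat =>
  \esum_(u in Zlow k) (lam (concat k u (single k m%:Z)))%:E) <= (3 * M)%:E)%E.
Proof.
apply: ge_ereal_sup => _ [a a0 <-]; apply: sqrte_le_of_sqr => //.
apply: le_trans (_ : (8 * M ^+ 2)%:E <= _)%E; last by rewrite lee_fin.
apply: lime_le.
  apply: is_cvg_nneseries => n _ _; apply: expe_ge0; apply: sume_ge0 => j _.
  by apply: esum_ge0 => u _; rewrite lee_fin.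
near=> L.
(* The finite sum over a block and the unordered sum over [u] are exchanged, so that each block
   becomes a single unordered sum over [Zlow k]. *)
rewrite (eq_bigr (fun l => (\esum_(u in Zlow k)
    (\sum_(a * l <= j < a * l.+1) lam (concat k u (single k j%:Z)))%:E) ^+ 2)%E).
  apply: sum_esum_sqr_le => [v u|U uU HU]; first exact: sumr_ge0.
  exact: (block_sum_le lam0 M0 HM).
move=> l _; congr (_ ^+ 2)%E.
rewrite -esum_sum; first by apply: eq_esum => u _; rewrite sumEFin.
by move=> u j _ _; rewrite lee_fin.
Unshelve. all: by end_near. Qed.

Lemma Q_le : (Q lam <= (6 * M)%:E)%E.
Proof.
rewrite (_ : 6 * M = 3 * M + 3 * M); last by ring.
rewrite EFinD; apply: leeD; apply: ge_ereal_sup => _ [k _ <-].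
  exact: Fnorm_le.
exact: tail_le.
Qed.

End real_norm.

Lemma Q_le_multiplier_norm (lam : ZN -> R) : (forall n, 0 <= lam n) ->
  (forall n, ~ gt_last n -> lam n = 0) -> (6^-1%:E * Q lam <= multiplier_norm lam)%E.
Proof.
move=> lam0 lamN; apply: le_ereal_inf_tmp => -[M| |] [M0 HM]; rewrite ?leey//.
rewrite lee_pdivrMl// -EFinM; apply: Q_le => //.
Qed.

Lemma Q_ge0 (lam : ZN -> R) : (0 <= Q lam)%E.
Proof.
apply: adde_ge0.
  by apply: le_trans (Fnorm_ge0 _) _; last by apply: ereal_sup_ubound; exists 0%N.
by apply: le_trans (sqrte_ge0 _) _; last by apply: ereal_sup_ubound; exists 0%N.
Qed.

(** The bound for s >= Q requires s > 0, while Q may be 0; hence s = Q + e / C with e tending to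
    0. *)
Lemma multiplier_norm_le_CQ (lam : ZN -> R) : (forall n, 0 <= lam n) ->
  (multiplier_norm lam <= (upper_const R)%:E * Q lam)%E.
Proof.
move=> lam0; have C0 := upper_const_gt0 R.
have := Q_ge0 lam; case QE : (Q lam) => [q| |]// q0; last by rewrite gt0_muley ?lte_fin// leey.
apply/lee_addgt0Pr => e e0; have e1 : 0 < e / upper_const R by rewrite divr_gt0.
rewrite (_ : (_ + _)%E = (upper_const R * (q + e / upper_const R))%:E).
  apply: multiplier_norm_le_Q => //; first by rewrite ltr_wpDl.
  by rewrite QE lee_fin lerDl ltW.
by rewrite mulrDr mulrCA divff ?gt_eqF// mulr1 EFinD EFinM.
Qed.

End lower_bound_Q.

Theorem theorem3p1 (R : realType) :
  exists c C : R, [/\ 0 < c, c <= C &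
    forall lam : ZN -> R,
      (forall n : ZN, 0 <= lam n) ->
      (forall n : ZN, ~ gt_last n -> lam n = 0) ->
      (c%:E * Q lam <= multiplier_norm lam)%E /\
      (multiplier_norm lam <= C%:E * Q lam)%E].
Proof.
(* The summand 1/6 gives c <= C without computing [upper_const]. *)
exists 6^-1, (upper_const R + 6^-1); split.
- by rewrite invr_gt0.
- by rewrite lerDr ltW// upper_const_gt0.
move=> lam lam0 lamN; split; first exact: Q_le_multiplier_norm.
apply: le_trans (multiplier_norm_le_CQ lam0) _.
by rewrite lee_wpmul2r ?Q_ge0// lee_fin lerDl invr_ge0.
Qed.
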